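(* For every interior curved face $F\in\mathcal F_I$ of the space-time surface triangulation of $S_h$, the conormal jump $[1]_{\boldsymbol\nu}|_F=(\boldsymbol\nu_h|_{K_S^1}+\boldsymbol\nu_h|_{K_S^2})|_F$ satisfies $$\|[1]_{\boldsymbol\nu}\|_{L^\infty(F)}\lesssim h^{k_{g,s}}+\Delta t^{k_{g,q}},\qquad \|\mathbf P_S^e\,[1]_{\boldsymbol\nu}\|_{L^\infty(F)}\lesssim h^{2k_{g,s}}+\Delta t^{2k_{g,q}},$$ where $\mathbf P_S^e=\mathbf I-\mathbf n_S^e(\mathbf n_S^e)^T$.
   Context: Conventions. $\lesssim,\gtrsim$ denote inequalities up to constants independent of the mesh size $h$, the time step size $\Delta t$ and the way the surface cuts the mesh (and of $F$); $\sim$ means both. $h,\Delta t$ are sufficiently small. $k_{g,s},k_{g,q}\ge1$ are polynomial degrees. $\nabla,D$ are spatial, $\nabla_{(x,t)},D_{(x,t)}$ space-time derivatives. Continuous surface. $\Omega\subset\mathbb R^3$ is a domain, $T>0$, $\mathbf w:\Omega\times[0,T]\to\mathbb R^3$ a smooth velocity field, $\phi:\Omega\times[0,T]\to\mathbb R$ solves $\partial_t\phi+\mathbf w\cdot\nabla\phi=0$, and $\Gamma(t)=\{x\in\Omega:\phi(x,t)=0\}$ is a closed connected orientable $C^2$-hypersurface for all $t\in[0,T]$. $S=\bigcup_{t}\Gamma(t)\times\{t\}\subset\mathbb R^4$. In a neighborhood $U$ of $S$: $\|\nabla\phi\|\sim1$, $\|D^2\phi\|\lesssim1$, $|\partial_t\phi|\lesssim1$,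 $\|\partial_t\nabla\phi\|\lesssim1$, and $|\phi(x+\epsilon\nabla\phi(x,t),t)-\phi(x+\tilde\epsilon\nabla\phi(x,t),t)|\sim|\epsilon-\tilde\epsilon|$ for $\epsilon,\tilde\epsilon\in[0,\epsilon_0]$. The space-time unit normal on $S$ is $\mathbf n_S=\nabla_{(x,t)}\phi/\|\nabla_{(x,t)}\phi\|$. $\delta(\cdot,t)$ is the spatial signed distance to $\Gamma(t)$ (sufficiently smooth on $U$), $\mathbf n=\nabla\delta$, $\mathbf p(x,t)=(x-\delta(x,t)\mathbf n(x,t),t)$; $v^e=v\circ\mathbf p$ for $v$ on $S$. Discrete surface. $0=t_0<\dots<t_N=T$, $I_n=[t_{n-1},t_n]$, $Q_n=\Omega\times I_n$; $\mathcal T$ is a member of a shape regular family of tetrahedral triangulations of $\Omega$; $V_h^m$: continuous piecewise polynomials of degree $\le m$; $V_h^{m_s,m_q}$: functions $v$ on $\Omega\times[0,T]$ with $v|_{Q_n}=\sum_{i=0}^{m_q}t^iv_i(x)$, $v_i\in V_h^{m_s}$. $\phi_h\in V_h^{k_{g,s},k_{g,q}}$; $\hat\phi_h(\cdot,t)$ is the piecewise linear nodal interpolant of $\phi_h(\cdot,t)$; $S^n_{\rm lin}=\{(x,t)\in Q_n:\hat\phi_h(x,t)=0\}$; $\mathcal T_n^\Gamma$: the $K\in\mathcal T$ cut by $\{\hat\phi_h(\cdot,t)=0\}$ (positive two-dimensional measure) for some $t\in I_n$, $\Omega_n^\Gamma$ its union, $Q_n^S=\Omega_n^\Gamma\times I_n\subset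 U$, $Q_{h,n}^S$ the set of prisms $K\times I_n$, $K\in\mathcal T_n^\Gamma$. Accuracy of $\phi_h$: for all $n$ and $(m_s,m_q)\in(\{0,\dots,k_{g,s}+1\}\times\{0,1\})\cup(\{0\}\times\{0,\dots,k_{g,q}+1\})$, $\|D^{m_s}\partial_t^{m_q}(\phi_h-\phi)\|_{L^\infty(Q_n^S)}\lesssim h^{k_{g,s}+1-m_s}+\Delta t^{k_{g,q}+1-m_q}$ (elementwise); with nodes $\tau_0^n,\dots,\tau_{k_{g,q}}^n\in I_n$ and nodal basis $\mathcal X_{\tau_m^n}$ of polynomials of degree $\le k_{g,q}$ on $I_n$ there are $\phi_{\tau_m^n}\in C(\Omega)\cap C^{k_{g,s}+1}(\Omega_n^\Gamma)$ with $\|D^{m_s}(\phi_h(\cdot,\tau_m^n)-\phi_{\tau_m^n})\|_{L^\infty(\Omega_n^\Gamma)}\lesssim h^{k_{g,s}+1-m_s}$, $0\le m_s\le k_{g,s}+1$; and there is $\phi_H\in C^{k_{g,q}+1}(I_n;V_h^{k_{g,s}})$ with, for $0\le m_q\le k_{g,q}+1$, $m_s\in\{0,1\}$: $\|\partial_t^{m_q}(\phi_H-\phi_h)\|_{L^\infty(Q_n^S)}\lesssim\Delta t^{k_{g,q}+1-m_q}$, $\|D^{m_s}\partial_t^{m_q}(\phi_H-\phi_h)\|_{L^\infty(Q_n^S)}\lesssim h^{k_{g,s}+1-m_s}+\Delta t^{k_{g,q}+1-m_q}$. Mesh deformation. For $t=\tau_m^n$, $K\in\mathcal T_n^\Gamma$,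 $x\in K$ let $d_h(x)$ be the number of smallest absolute value with $(\mathcal E_K\phi_h)(x+d_h(x)\nabla\phi_h|_K(x,t),t)=\hat\phi_h(x,t)$, $\mathcal E_K$ being polynomial extension from $K$. $\Theta^n_{h,t}\in(V_h^{k_{g,s}})^3$ on $\Omega_n^\Gamma$ has as value at each Lagrange node the average over all $K\in\mathcal T_n^\Gamma$ containing it of $x+d_h(x)\nabla\phi_h|_K(x,t)$. $\Theta^n_{h,s}(x,t)=\sum_m\mathcal X_{\tau_m^n}(t)\Theta^n_{h,\tau_m^n}(x)$, $\Theta_h^n(x,t)=(\Theta^n_{h,s}(x,t),t)$, a homeomorphism of $Q_n^S$ onto its image. $S_h^n=\Theta_h^n(S^n_{\rm lin})$, $S_h=\bigcup_nS_h^n$. Space-time unit normal of $S_h^n$: $\mathbf n_{S_h}\circ\Theta_h^n=(D_{(x,t)}\Theta_h^n)^{-T}\nabla_{(x,t)}\hat\phi_h/\|\cdot\|$ (elementwise). Triangulation and conormals. $\mathcal T_{S_h^n}=\{\Theta_h^n(P)\cap S_h^n:P\in Q_{h,n}^S\}$ is the set of smooth three-dimensional pieces of $S_h^n$; $\mathcal F_I^n=\{\partial K_S^1\cap\partial K_S^2:K_S^1\ne K_S^2\in\mathcal T_{S_h^n}\}$ is the set of interior (two-dimensional, curved) faces, $\mathcal F_I=\bigcup_n\mathcal F_I^n$. $\boldsymbol\nu_h|_{K_S}$ is the outer unit conormal of $K_S$ on $\partial K_S$ (tangential to $K_S$, orthogonal to $\partial K_S$). Known property: $\|\mathbf n_S^e-\mathbf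 n_{S_h}\|_{L^\infty(S_h)}\lesssim h^{k_{g,s}}+\Delta t^{k_{g,q}}$ (holding also for the one-sided values on faces). *)

(* Defs.v *)
From HB Require Import structures.
From mathcomp Require Import all_boot all_order all_algebra.
From mathcomp Require Import all_classical all_reals all_analysis.
Set Implicit Arguments.
Unset Strict Implicit.
Unset Printing Implicit Defensive.
Import Order.TTheory GRing.Theory Num.Theory numFieldNormedType.Exports.
Local Open Scope classical_set_scope.
Local Open Scope ring_scope.

(** * Euclidean geometry.  The library norm on ['rV_n] is the maximum norm;
    only its topology is used, all lengths are measured with [enorm]. *)

Section Euclidean.
Context {R : realType} {n : nat}.
Implicit Types (u v x y : 'rV[R]_n) (A : set 'rV[R]_n).

Definition dotp u v : R := \sum_i u 0 i * v 0 i.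
Definition enorm u : R := Num.sqrt (dotp u u).
Definition normalize u : 'rV[R]_n := (enorm u)^-1 *: u.
Definition diam A : R := sup [set enorm (x - y) | x in A & y in A].
Definition dist_to x A : R := inf [set enorm (x - y) | y in A].

(** [A] has zero [d]-dimensional Hausdorff measure.  No bound on the size of
    the covering sets is needed: for [d > 0] the Hausdorff measure and the
    Hausdorff content have the same null sets. *)
Definition hausdorff_null (d : nat) A : Prop :=
  forall e : R, 0 < e ->
  exists (B : nat -> set 'rV[R]_n) (r : nat -> R),
    [/\ A `<=` \bigcup_k B k,
        forall k, 0 <= r k,
        forall k x y, B k x -> B k y -> enorm (x - y) <= r k
      & (\sum_(0 <= k <oo) (r k ^+ d)%:E <= e%:E)%E].

Definition ae_on (d : nat) A (P : 'rV[R]_n -> Prop) : Prop :=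
  hausdorff_null d [set x | A x /\ ~ P x].

(** Bouligand tangent cone of [A] at [y]. *)
Definition tangent_cone A y : set 'rV[R]_n :=
  [set v | forall e : R, 0 < e -> exists a s,
     [/\ A a, 0 < s, s < e & enorm (s^-1 *: (a - y) - v) < e]].

(** [nu] is the outer unit conormal at [y] of the hypersurface-with-boundary
    [A]: with [m] a unit normal of [A] at [y], the tangent cone of [A] at [y] is
    half of the tangent space [m^\bot]; [nu] is the unit vector of [m^\bot] that
    is orthogonal to the edge of this half-space, the tangent space of the
    boundary, and that points out of [A].
    Such a [nu] is unique, and there is none where [A] is not a
    hypersurface with (smooth) boundary. *)
Definition outer_conormal A y (nu : 'rV[R]_n) : Prop :=
  enorm nu = 1 /\
  exists m, [/\ enorm m = 1, dotp nu m = 0 &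
    tangent_cone A y = [set v | dotp v m = 0 /\ dotp v nu <= 0]].

(** Partial derivatives; [pders [:: i1; ...; ik] f] is
    d_i1 (... (d_ik f)). *)
Definition pder (i : 'I_n) (f : 'rV[R]_n -> R) : 'rV[R]_n -> R :=
  fun x => 'D_(delta_mx 0 i) f x.
Definition pders (l : seq 'I_n) (f : 'rV[R]_n -> R) : 'rV[R]_n -> R :=
  foldr pder f l.
Definition grad (f : 'rV[R]_n -> R) x : 'rV[R]_n := \row_i pder i f x.
Definition jac (f : 'rV[R]_n -> 'rV[R]_n) x : 'M[R]_n :=
  \matrix_(i, j) pder j (fun y => f y 0 i) x.

(** [pders l f] and all the intermediate derivatives exist and are continuous
    on [O]. *)
Fixpoint has_pders (l : seq 'I_n) (O : set 'rV[R]_n) (f : 'rV[R]_n -> R) :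
    Prop :=
  (forall x, O x -> {for x, continuous (pders l f)}) /\
  if l is i :: l' then
    has_pders l' O f /\
    forall x, O x -> derivable (pders l' f) x (delta_mx 0 i)
  else True.

(** [C^k] regularity on a set that need not be open: on an open superset. *)
Definition Ck (k : nat) A (f : 'rV[R]_n -> R) : Prop :=
  exists O, [/\ open O, A `<=` O &
    forall l, (size l <= k)%N -> has_pders l O f].

Definition C2_hypersurface A : Prop :=
  forall x, A x -> exists O g,
    [/\ open O, O x, Ck 2 O g, (forall y, O y -> grad g y != 0)
      & (forall y, O y -> (A y <-> g y = 0))].

Definition orientable A : Prop :=
  exists N : 'rV[R]_n -> 'rV[R]_n,
    [/\ {within A, continuous N}, forall x, A x -> enorm (N x) = 1
      & forall x v, A x -> tangent_cone A x v -> dotp (N x) v = 0].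

Definition poly_fun (m : nat) (p : 'rV[R]_n -> R) : Prop :=
  exists c : {ffun 'I_n -> 'I_m.+1} -> R, forall x,
    p x = \sum_(a : {ffun 'I_n -> 'I_m.+1} | (\sum_i a i <= m)%N)
             c a * \prod_i x 0 i ^+ a i.

End Euclidean.

(** * Space-time: ['rV_(3 + 1)], the time being the last coordinate. *)

Section SpaceTime.
Context {R : realType}.

Definition st (x : 'rV[R]_3) (t : R) : 'rV[R]_(3 + 1) := row_mx x t%:M.
Definition xpart (z : 'rV[R]_(3 + 1)) : 'rV[R]_3 := lsubmx z.
Definition tpart (z : 'rV[R]_(3 + 1)) : R := rsubmx z 0 0.

Definition cyl (A : set 'rV[R]_3) (I : set R) : set 'rV[R]_(3 + 1) :=
  [set z | A (xpart z) /\ I (tpart z)].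

Definition xdir (i : 'I_3) : 'I_(3 + 1) := lshift 1 i.
Definition tdir : 'I_(3 + 1) := rshift 3 ord0.

(** The derivative d_{s1} ... d_{sk} (d_t)^m. *)
Definition xtdirs (s : seq 'I_3) (m : nat) : seq 'I_(3 + 1) :=
  map xdir s ++ nseq m tdir.

Definition gradx (f : 'rV[R]_(3 + 1) -> R) z : 'rV[R]_3 :=
  \row_i pder (xdir i) f z.
Definition dert (f : 'rV[R]_(3 + 1) -> R) z : R := pder tdir f z.

End SpaceTime.

Record problem (R : realType) := Problem {
  Omega : set 'rV[R]_3;
  Tend : R;
  vel : 'rV[R]_(3 + 1) -> 'rV[R]_3;
  phi : 'rV[R]_(3 + 1) -> R;
  nbhd : set 'rV[R]_(3 + 1);
  sdist : 'rV[R]_(3 + 1) -> R;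
  eps0 : R }.

Section Continuous.
Context {R : realType} (P : problem R).

Definition QT : set 'rV[R]_(3 + 1) := cyl (Omega P) `[0, Tend P].

Definition Gamma (t : R) : set 'rV[R]_3 :=
  [set x | Omega P x /\ phi P (st x t) = 0].

Definition surface : set 'rV[R]_(3 + 1) :=
  [set z | tpart z \in `[0, Tend P] /\ Gamma (tpart z) (xpart z)].

Definition closest z : 'rV[R]_(3 + 1) :=
  st (xpart z - sdist P z *: gradx (sdist P) z) (tpart z).

Definition nS z : 'rV[R]_(3 + 1) := normalize (grad (phi P) z).
Definition nSe z : 'rV[R]_(3 + 1) := nS (closest z).
Definition PSe z : 'M[R]_(3 + 1) := 1%:M - (nSe z)^T *m nSe z.

(** The pairs (m_s, m_q) for which the accuracy of phi_h is assumed. *)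
Definition accuracy_orders (ks kq ms mq : nat) : Prop :=
  (ms <= ks.+1 /\ mq <= 1)%N \/ (ms = 0 /\ mq <= kq.+1)%N.

(** [c] is the common constant of all the estimates up to constants. *)
Record continuous_setting (ks kq : nat) (c : R) : Prop := {
  cs_const : 0 < c;
  cs_open : open (Omega P);
  cs_connected : connected (Omega P);
  cs_time : 0 < Tend P;
  cs_vel : forall k i, Ck k QT (fun z => vel P z 0 i);
  cs_phi1 : Ck 1 QT (phi P);
  cs_transport : forall z, QT z ->
    dert (phi P) z + dotp (vel P z) (gradx (phi P) z) = 0;
  cs_Gamma : forall t, t \in `[0, Tend P] ->
    [/\ Gamma t !=set0, compact (Gamma t), connected (Gamma t),
        C2_hypersurface (Gamma t) & orientable (Gamma t)];
  cs_nbhd : exists O, [/\ open O, nbhd P = O `&` QT & surface `<=` O];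
  cs_phi2 : Ck 2 (nbhd P) (phi P);
  cs_phi_reg : exists O, [/\ open O, nbhd P `<=` O &
    forall s mq, accuracy_orders ks kq (size s) mq ->
      has_pders (xtdirs s mq) O (phi P)];
  cs_grad : forall z, nbhd P z -> c^-1 <= enorm (gradx (phi P) z) <= c;
  cs_hess : forall z i j, nbhd P z ->
    `|pders [:: xdir i; xdir j] (phi P) z| <= c;
  cs_dt : forall z, nbhd P z -> `|dert (phi P) z| <= c;
  cs_dtgrad : forall z i, nbhd P z ->
    `|pders [:: tdir; xdir i] (phi P) z| <= c;
  cs_eps0 : 0 < eps0 P;
  cs_line : forall z e e', nbhd P z ->
    e \in `[0, eps0 P] -> e' \in `[0, eps0 P] ->
    let at_ a := phi P (st (xpart z + a *: gradx (phi P) z) (tpart z)) in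
    c^-1 * `|e - e'| <= `|at_ e - at_ e'| <= c * `|e - e'|;
  cs_sdist : forall z, nbhd P z ->
    sdist P z = Num.sg (phi P z) * dist_to (xpart z) (Gamma (tpart z));
  cs_sdist_reg : Ck 2 (nbhd P) (sdist P);
  cs_closest : forall z, nbhd P z -> surface (closest z) }.

End Continuous.

(** The time nodes [tnode 0, ..., tnode nslab], the tetrahedra, given by their
    four vertices, the discrete level set function and the nodes
    [tau n 0, ..., tau n k_{g,q}] of the time slab [n], which is
    [[tnode n, tnode n.+1]]. *)
Record discretization (R : realType) := Discretization {
  nslab : nat;
  tnode : nat -> R;
  ntet : nat;
  vert : 'I_ntet -> 'I_4 -> 'rV[R]_3;
  phih : 'rV[R]_(3 + 1) -> R;
  tau : nat -> nat -> R }.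

Section Mesh.
Context {R : realType} (D : discretization R).
Implicit Types (K L : 'I_(ntet D)) (n : 'I_(nslab D)).

Definition hull_of K (A : pred 'I_4) : set 'rV[R]_3 :=
  [set x | exists l : 'I_4 -> R,
    [/\ forall i, 0 <= l i, forall i, ~~ A i -> l i = 0, \sum_i l i = 1
      & x = \sum_i l i *: vert K i]].

Definition tet K : set 'rV[R]_3 := hull_of K predT.

Definition common_vert K L : pred 'I_4 :=
  fun i => [exists j, vert L j == vert K i].

Record triangulation (Om : set 'rV[R]_3) (c : R) : Prop := {
  tri_cover : \bigcup_K tet K = closure Om;
  tri_regular : forall K, exists x r, [/\ 0 < r,
    forall y, enorm (y - x) <= r -> tet K y & diam (tet K) <= c * r];
  tri_conforming : forall K L, K != L ->
    tet K `&` tet L = hull_of K (common_vert K L) /\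
    (tet K)° `&` (tet L)° = set0 }.

Record time_grid (T : R) : Prop := {
  tg_start : tnode D 0 = 0;
  tg_end : tnode D (nslab D) = T;
  tg_incr : forall n, tnode D n < tnode D n.+1 }.

Definition slab n : set R := `[tnode D n, tnode D n.+1].
Definition prism n K : set 'rV[R]_(3 + 1) := cyl (tet K) (slab n).

Definition mesh_size : R := \big[Num.max/0]_(K < ntet D) diam (tet K).
Definition time_step : R := \big[Num.max/0]_(n < nslab D) (tnode D n.+1 - tnode D n).

(** V_h^m *)
Definition fe_space (Om : set 'rV[R]_3) (m : nat) (v : 'rV[R]_3 -> R) : Prop :=
  {within closure Om, continuous v} /\
  forall K, exists p, poly_fun m p /\ forall x, tet K x -> v x = p x.

(** V_h^{ms,mq} *)
Definition st_fe_space (Om : set 'rV[R]_3) (ms mq : nat)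
    (v : 'rV[R]_(3 + 1) -> R) : Prop :=
  forall n, exists q : 'I_mq.+1 -> 'rV[R]_3 -> R,
    (forall i, fe_space Om ms (q i)) /\
    forall x t, closure Om x -> slab n t ->
      v (st x t) = \sum_(i < mq.+1) t ^+ i * q i x.

Definition st_poly (ms mq : nat) (p : 'rV[R]_(3 + 1) -> R) : Prop :=
  exists q : 'I_mq.+1 -> 'rV[R]_3 -> R,
    (forall i, poly_fun ms (q i)) /\
    forall z, p z = \sum_(i < mq.+1) tpart z ^+ i * q i (xpart z).

(** The polynomial extension of [f] from the prism K x I_n; it yields the
    elementwise values and derivatives on the closed prism. *)
Definition st_ext (ms mq : nat) n K (f : 'rV[R]_(3 + 1) -> R) :
    'rV[R]_(3 + 1) -> R :=
  xget (fun=> 0) [set p | st_poly ms mq p /\ forall z, prism n K z -> f z = p z].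

(** The affine function with the values of [f] at the vertices of [K]. *)
Definition affine_interp K (f : 'rV[R]_3 -> R) : 'rV[R]_3 -> R :=
  xget (fun=> 0)
    [set p | poly_fun 1 p /\ forall i, p (vert K i) = f (vert K i)].

(** The Lagrange nodes of degree [k] of [K]. *)
Definition lagrange_node (k : nat) K : set 'rV[R]_3 :=
  [set x | exists a : 'I_4 -> nat, (\sum_i a i = k)%N /\
    x = \sum_i ((a i)%:R / k%:R) *: vert K i].

End Mesh.

Section DiscreteSurface.
Context {R : realType} (ks kq : nat) (D : discretization R).
Implicit Types (K L : 'I_(ntet D)) (n : 'I_(nslab D)) (m : 'I_kq.+1).

(** phi_h and its piecewise linear interpolant on K x I_n, extended as
    polynomials. *)
Definition phihK n K : 'rV[R]_(3 + 1) -> R := st_ext ks kq n K (phih D).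
Definition phihatK n K : 'rV[R]_(3 + 1) -> R := fun z =>
  affine_interp K (fun x => phihK n K (st x (tpart z))) (xpart z).

Definition Slin n : set 'rV[R]_(3 + 1) :=
  [set z | exists K, prism n K z /\ phihatK n K z = 0].

(** T_n^Gamma *)
Definition cut n : set 'I_(ntet D) :=
  [set K | exists2 t, slab n t &
    ~ hausdorff_null 2 [set x | tet K x /\ phihatK n K (st x t) = 0]].

Definition OmegaG n : set 'rV[R]_3 := \bigcup_(K in cut n) tet K.
Definition QS n : set 'rV[R]_(3 + 1) := cyl (OmegaG n) (slab n).

(** d_h at the time node [tau n m] *)
Definition dh n m K (x : 'rV[R]_3) : R :=
  let z := st x (tau D n m) in
  let hits d := phihK n K (st (x + d *: gradx (phihK n K) z) (tau D n m))
                = phihatK n K z in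
  xget 0 [set d | hits d /\ forall d', hits d' -> `|d| <= `|d'| ].

Definition node_image n m K (x : 'rV[R]_3) : 'rV[R]_3 :=
  x + dh n m K x *: gradx (phihK n K) (st x (tau D n m)).

Definition node_average n m (x : 'rV[R]_3) : 'rV[R]_3 :=
  let owner := [pred K | (K \in cut n) && (x \in tet K)] in
  #|owner|%:R^-1 *: \sum_(K | owner K) node_image n m K x.

(** Theta_{h,tau_m^n} on [K], extended as a polynomial *)
Definition ThetaNode n m K : 'rV[R]_3 -> 'rV[R]_3 :=
  xget (fun=> 0 : 'rV[R]_3)
    [set p : 'rV[R]_3 -> 'rV[R]_3 |
             (forall i, poly_fun ks (fun x => p x 0 i)) /\
             forall x, lagrange_node ks K x -> p x = node_average n m x].

Definition time_basis n m (t : R) : R :=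
  \prod_(j < kq.+1 | j != m) ((t - tau D n j) / (tau D n m - tau D n j)).

(** Theta_h^n on K x I_n, extended as a polynomial, and on Q_n^S *)
Definition ThetaK n K : 'rV[R]_(3 + 1) -> 'rV[R]_(3 + 1) := fun z =>
  st (\sum_(m < kq.+1) time_basis n m (tpart z) *: ThetaNode n m K (xpart z)) (tpart z).

Definition Theta n : 'rV[R]_(3 + 1) -> 'rV[R]_(3 + 1) := fun z =>
  xget 0 [set y | exists K, [/\ cut n K, prism n K z & y = ThetaK n K z]].

Definition Sh n : set 'rV[R]_(3 + 1) := Theta n @` (Slin n `&` QS n).

(** The value at Theta_h^n(z), taken from the prism K x I_n, of n_{S_h}. *)
Definition nShK n K z : 'rV[R]_(3 + 1) :=
  normalize (((invmx (jac (ThetaK n K) z))^T *m (grad (phihatK n K) z)^T)^T).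

(** K_S and its boundary, for the piece K_S stemming from K x I_n *)
Definition piece n K : set 'rV[R]_(3 + 1) :=
  (Theta n @` prism n K) `&` Sh n.
Definition piece_boundary n K : set 'rV[R]_(3 + 1) :=
  (Theta n @` (prism n K `\` (prism n K)°)) `&` Sh n.

Definition interior_face n K1 K2 (F : set 'rV[R]_(3 + 1)) : Prop :=
  [/\ cut n K1, cut n K2, piece n K1 <> piece n K2
    & F = piece_boundary n K1 `&` piece_boundary n K2].

Definition elementwise_le n (l : seq 'I_(3 + 1)) (f : 'rV[R]_(3 + 1) -> R)
    (b : R) : Prop :=
  forall K x t, cut n K -> (tet K)° x -> tnode D n < t < tnode D n.+1 ->
    `|pders l f (st x t)| <= b.

Definition rate (ms mq : nat) : R :=
  mesh_size D ^+ (ks.+1 - ms) + time_step D ^+ (kq.+1 - mq).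

Definition C1k (k : nat) (A : set R) (a : R -> R) : Prop :=
  exists O : set R, [/\ open O, A `<=` O &
    forall j t, (j <= k)%N -> O t ->
      {for t, continuous (derive1n j a)} /\
      ((j < k)%N -> derivable (derive1n j a) t 1)].

(** [f] restricted to Om x I_n belongs to C^k(I_n; V_h^{ks}), written in terms
    of finitely many elements of the finite-dimensional space V_h^{ks}. *)
Definition Ck_fe (Om : set 'rV[R]_3) (k : nat) n (f : 'rV[R]_(3 + 1) -> R) :
    Prop :=
  exists (J : nat) (a : 'I_J -> R -> R) (v : 'I_J -> 'rV[R]_3 -> R),
    [/\ forall j, C1k k (slab n) (a j), forall j, fe_space D Om ks (v j)
      & forall x t, closure Om x -> slab n t ->
          f (st x t) = \sum_j a j t * v j x].

(** Suprema of elementwise continuous functions over the interiors of the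
    prisms are L^oo-norms over Q_n^S. *)
Record discrete_setting (P : problem R) (c : R) : Prop := {
  ds_time : time_grid D (Tend P);
  ds_mesh : triangulation D (Omega P) c;
  ds_phih : st_fe_space D (Omega P) ks kq (phih D);
  ds_QS : forall n, QS n `<=` nbhd P;
  ds_tau : forall n m, slab n (tau D n m);
  ds_tau_inj : forall n m m', tau D n m = tau D n m' -> m = m';
  ds_tau_bound : forall n m t, slab n t -> `|time_basis n m t| <= c;
  ds_accuracy : forall n s mq, accuracy_orders ks kq (size s) mq ->
    elementwise_le n (xtdirs s mq) (fun z => phih D z - phi P z)
      (c * rate (size s) mq);
  ds_phitau : forall n m, exists phitau : 'rV[R]_3 -> R,
    [/\ {within Omega P, continuous phitau}, Ck ks.+1 (OmegaG n) phitau
      & forall s K x, (size s <= ks.+1)%N -> cut n K -> (tet K)° x ->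
          `|pders s (fun y => phih D (st y (tau D n m)) - phitau y) x|
            <= c * mesh_size D ^+ (ks.+1 - size s)];
  ds_phiH : forall n, exists phiH : 'rV[R]_(3 + 1) -> R,
    [/\ Ck_fe (Omega P) kq.+1 n phiH,
        forall mq, (mq <= kq.+1)%N ->
          elementwise_le n (xtdirs [::] mq) (fun z => phiH z - phih D z)
            (c * time_step D ^+ (kq.+1 - mq))
      & forall s mq, (size s <= 1)%N -> (mq <= kq.+1)%N ->
          elementwise_le n (xtdirs s mq) (fun z => phiH z - phih D z)
            (c * rate (size s) mq)];
  ds_homeo : forall n,
    {within QS n, continuous (Theta n)} /\
    exists g, {within Theta n @` QS n, continuous g} /\
      forall z, QS n z -> g (Theta n z) = z;
  ds_normal : forall n K z, cut n K -> prism n K z -> Slin n z ->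
    enorm (nSe P (Theta n z) - nShK n K z)
      <= c * (mesh_size D ^+ ks + time_step D ^+ kq) }.

End DiscreteSurface.

(* Main.v *)
(* At a point of a face that is smooth enough, the two pieces have a common edge
   space, orthogonal to both pairs (discrete normal, conormal).  In the plane
   orthogonal to it these pairs are orthonormal bases, and if they are oppositely
   oriented then nu1 + nu2 is the rotation of n1 - n2 by a right angle.  So its
   length is |n1 - n2|, and it is a multiple of n1 + n2, that is, normal to first
   order; since both n_i are close to n_S^e, its tangential part is quadratic.

   The tangent cones of the pieces are the linear images, under the derivative of
   Theta on each prism, of the tangent cones of the zero sets of the piecewise
   linear interpolant.  These derivatives agree along common directions of the
   two prisms and are close to the identity in space, so the edge space and the
   orientations can be found before the deformation.

   If the edge is not contained in a time slice, then in the slice both zero sets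
   are flat and meet along a line, and were they to lie on the same side of it, the
   interpolant would have to vanish twice along a short segment in the direction
   of its gradient, although it increases through each of its zeros.  If the
   edge is contained in the slice t = t0, which means that the interpolant
   vanishes at t0 on a common triangle, then on one side of t0 it has, after
   division by the largest power of t - t0, opposite signs on the two zero sets;
   hence the zero sets lie on opposite sides of t0.

   The points excluded are the images of the tetrahedron edges at the finitely
   many isolated zeros of the vertex values: finitely many Lipschitz curves, a
   set of two-dimensional measure zero. *)
Require Import Defs.
From HB Require Import structures.
From mathcomp Require Import all_boot all_order all_algebra.
From mathcomp Require Import all_classical all_reals all_analysis.
From mathcomp Require Import ring lra.
Import Order.TTheory GRing.Theory Num.Theory numFieldNormedType.Exports.
Local Open Scope classical_set_scope.
Local Open Scope ring_scope.
Set Implicit Arguments.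
Unset Strict Implicit.
Unset Printing Implicit Defensive.

(** * Euclidean vectors *)

Section EuclideanFacts.
Context {R : realType} {n : nat}.
Implicit Types (u v w : 'rV[R]_n) (a : R).

(** Powers of the mesh size h and the time step dt enter only through the assumed bound d = c (h^ks
    + dt^kq) on the error of the normals: the jump is at most 2 d, its tangential part at most 4
    d^2. All other estimates only decide signs. For this it suffices that the gradient of the
    interpolant and the spatial derivative of the deformation have relative errors of at most 1/100,
    which fixes [h0]. That the tangent cones are half-spaces is read off from the conormals, since
    [outer_conormal] holds only where they are. Two obstacles shape the estimates. Accuracy is
    available only on cut tetrahedra, while those lying between two zero sets are not known to be
    cut; where the interpolant vanishes on such a tetrahedron, a zero triangle is exhibited in it.
    And a nodal value of the deformation is an average over tetrahedra of possibly different sizes,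
    whose diameters must be compared through shared vertices. Polynomials are controlled outside
    their tetrahedra by their values at the Lagrange nodes. *)

Lemma dotpC u v : dotp u v = dotp v u.
Proof. by apply: eq_bigr => i _; rewrite mulrC. Qed.

Lemma dotpDl u v w : dotp (u + v) w = dotp u w + dotp v w.
Proof. by rewrite -big_split; apply: eq_bigr => i _; rewrite mxE mulrDl. Qed.

Lemma dotpZl a u w : dotp (a *: u) w = a * dotp u w.
Proof. by rewrite mulr_sumr; apply: eq_bigr => i _; rewrite mxE mulrA. Qed.

Lemma dotpDr u v w : dotp w (u + v) = dotp w u + dotp w v.
Proof. by rewrite dotpC dotpDl !(dotpC w). Qed.

Lemma dotpZr a u w : dotp w (a *: u) = a * dotp w u.
Proof. by rewrite dotpC dotpZl (dotpC w). Qed.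

Lemma dotpNl u w : dotp (- u) w = - dotp u w.
Proof. by rewrite -scaleN1r dotpZl mulN1r. Qed.

Lemma dotpNr u w : dotp w (- u) = - dotp w u.
Proof. by rewrite dotpC dotpNl (dotpC w). Qed.

Lemma dotpBl u v w : dotp (u - v) w = dotp u w - dotp v w.
Proof. by rewrite dotpDl dotpNl. Qed.

Lemma dotpBr u v w : dotp w (u - v) = dotp w u - dotp w v.
Proof. by rewrite dotpDr dotpNr. Qed.

Lemma dotp0l w : dotp 0 w = 0.
Proof. by rewrite -(scale0r w) dotpZl mul0r. Qed.

Lemma dotp0r w : dotp w 0 = 0.
Proof. by rewrite dotpC dotp0l. Qed.

Lemma dotp_suml (I : Type) (r : seq I) (P : pred I) (F : I -> 'rV[R]_n) w :
  dotp (\sum_(i <- r | P i) F i) w = \sum_(i <- r | P i) dotp (F i) w.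
Proof.
elim/big_ind2 : _ => //; first exact: dotp0l.
by move=> ? ? ? ? <- <-; rewrite dotpDl.
Qed.

Lemma dotp_sumr (I : Type) (r : seq I) (P : pred I) (F : I -> 'rV[R]_n) w :
  dotp w (\sum_(i <- r | P i) F i) = \sum_(i <- r | P i) dotp w (F i).
Proof. by rewrite dotpC dotp_suml; apply: eq_bigr => i _; rewrite dotpC. Qed.

Definition dotpE := (dotpDl, dotpDr, dotpNl, dotpNr, dotpZl, dotpZr, dotp0l, dotp0r).

Lemma dotp_mulmx u v : dotp u v = (u *m v^T) 0 0.
Proof. by rewrite mxE; apply: eq_bigr => i _; rewrite mxE. Qed.

Lemma dotp_ge0 u : 0 <= dotp u u.
Proof. by apply: sumr_ge0 => i _; rewrite -expr2 sqr_ge0. Qed.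

Lemma dotp_eq0 u : (dotp u u == 0) = (u == 0).
Proof.
apply/idP/eqP => [|->]; last by rewrite dotp0l.
rewrite psumr_eq0; last by move=> i _; rewrite -expr2 sqr_ge0.
move=> /allP u0; apply/rowP => i; rewrite mxE; apply/eqP.
by have := u0 i (mem_index_enum _); rewrite /= mulf_eq0 orbb.
Qed.

Lemma enorm_ge0 u : 0 <= enorm u.
Proof. exact: sqrtr_ge0. Qed.

Lemma enorm_sqr u : enorm u ^+ 2 = dotp u u.
Proof. by rewrite sqr_sqrtr // dotp_ge0. Qed.

Lemma enorm_eq0 u : (enorm u == 0) = (u == 0).
Proof. by rewrite -dotp_eq0 -enorm_sqr sqrf_eq0. Qed.

Lemma enorm0 : enorm (0 : 'rV[R]_n) = 0.
Proof. by apply/eqP; rewrite enorm_eq0. Qed.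

Lemma enorm_gt0 u : (0 < enorm u) = (u != 0).
Proof. by rewrite lt_def enorm_ge0 andbT enorm_eq0. Qed.

Lemma enormZ a u : enorm (a *: u) = `|a| * enorm u.
Proof. by rewrite /enorm dotpZl dotpZr mulrA -expr2 sqrtrM ?sqr_ge0 // sqrtr_sqr. Qed.

Lemma enormN u : enorm (- u) = enorm u.
Proof. by rewrite -scaleN1r enormZ normrN1 mul1r. Qed.

Lemma enorm_distC u v : enorm (u - v) = enorm (v - u).
Proof. by rewrite -enormN opprB. Qed.

Lemma cauchy_schwarz u v : `|dotp u v| <= enorm u * enorm v.
Proof.
rewrite -[_ * _]ger0_norm ?mulr_ge0 ?enorm_ge0 //.
rewrite -ler_sqr ?nnegrE ?normr_ge0 // !real_normK ?num_real // exprMn !enorm_sqr.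
have [->|u0] := eqVneq u 0; first by rewrite !dotp0l expr0n mul0r.
have uu : 0 < dotp u u by rewrite lt_def dotp_ge0 dotp_eq0 u0.
have := dotp_ge0 (v - (dotp u v / dotp u u) *: u).
rewrite !dotpE (dotpC v u); set p := dotp u u in uu *; set q := dotp v v.
set s := dotp u v => H.
have : 0 <= p * (q - s / p * s + ( - (s / p * s) + s / p * (s / p * p))).
  by rewrite mulr_ge0 ?(ltW uu) //; lra.
suff -> : p * (q - s / p * s + (- (s / p * s) + s / p * (s / p * p))) = p * q - s ^+ 2.
  by rewrite subr_ge0.
by field; rewrite gt_eqF.
Qed.

Lemma dotp_le u v : dotp u v <= enorm u * enorm v.
Proof. exact: le_trans (ler_norm _) (cauchy_schwarz u v). Qed.

Lemma enormD u v : enorm (u + v) <= enorm u + enorm v.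
Proof.
rewrite -ler_sqr ?nnegrE ?addr_ge0 ?enorm_ge0 // enorm_sqr sqrrD !enorm_sqr !dotpE (dotpC v u).
by have := dotp_le u v; lra.
Qed.

Lemma enormB u v : enorm (u - v) <= enorm u + enorm v.
Proof. by rewrite -(enormN v); apply: enormD. Qed.

Lemma enorm_dist u v w : enorm (u - w) <= enorm (u - v) + enorm (v - w).
Proof. by rewrite -(subrK v u) -addrA addrK; apply: enormD. Qed.

Lemma enorm_subr_ge u v : enorm u - enorm v <= enorm (u - v).
Proof. by rewrite lerBlDr -{1}(subrK v u); apply: enormD. Qed.

Lemma enorm_sum (I : Type) (r : seq I) (P : pred I) (F : I -> 'rV[R]_n) :
  enorm (\sum_(i <- r | P i) F i) <= \sum_(i <- r | P i) enorm (F i).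
Proof.
elim/big_ind2: _ => [|x1 x2 y1 y2 h1 h2|//]; first by rewrite enorm0.
exact: le_trans (enormD _ _) (lerD _ _).
Qed.

Lemma coord_le_enorm u i : `|u 0 i| <= enorm u.
Proof.
rewrite -ler_sqr ?nnegrE ?enorm_ge0 // enorm_sqr real_normK ?num_real //.
rewrite /dotp (bigD1 i) //= -expr2 lerDl; apply: sumr_ge0 => j _.
by rewrite -expr2 sqr_ge0.
Qed.

Lemma enorm_le_sum u : enorm u <= \sum_i `|u 0 i|.
Proof.
have -> : u = \sum_i u 0 i *: delta_mx 0 i by rewrite -row_sum_delta.
apply: (le_trans (enorm_sum _ _ _)); apply: ler_sum => i _.
rewrite enormZ -row_sum_delta ler_piMr //.
rewrite -ler_sqr ?nnegrE ?enorm_ge0 // enorm_sqr /dotp (bigD1 i) //= big1 => [|j /negPf ji].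
  by rewrite !mxE !eqxx mulr1 addr0 expr1n.
by rewrite !mxE ji andbF mulr0.
Qed.

Lemma enorm_le_bound u b : (forall i, `|u 0 i| <= b) -> enorm u <= b *+ n.
Proof.
move=> ub; apply: (le_trans (enorm_le_sum u)).
by apply: (le_trans (ler_sum _ (fun i _ => ub i))); rewrite sumr_const card_ord.
Qed.

Lemma norm_le_enorm u : `|u| <= enorm u.
Proof.
rewrite /Num.norm/= mx_normrE; apply: bigmax_le => [|[i j] _ /=]; first exact: enorm_ge0.
by rewrite ord1 coord_le_enorm.
Qed.

Lemma enorm_le_norm u : enorm u <= `|u| *+ n.
Proof.
apply: enorm_le_bound => i; rewrite /Num.norm/= mx_normrE.
exact: (le_bigmax _ (fun ij : 'I_1 * 'I_n => `|u ij.1 ij.2|) (0, i)).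
Qed.

Lemma normalize_id u : enorm (normalize u) = (u != 0)%:R.
Proof.
rewrite /normalize enormZ normfV ger0_norm ?enorm_ge0 //.
have [->|u0] := eqVneq u 0; first by rewrite enorm0 mulr0.
by rewrite mulVf // enorm_eq0.
Qed.

Lemma normalize_normalized u : normalize u != 0 -> enorm (normalize u) = 1.
Proof. by rewrite normalize_id -enorm_eq0 normalize_id; case: (u != 0) => //; rewrite eqxx. Qed.

Lemma enorm_ball_nbhs (x : 'rV[R]_n) (A : set 'rV[R]_n) :
  nbhs x A <-> exists2 d, 0 < d & forall y, enorm (y - x) < d -> A y.
Proof.
split=> [/nbhs_ballP[e /= e0 eA]|[d d0 dA]].
  exists e => // y yx; apply: eA; rewrite -ball_normE /= distrC.
  exact: le_lt_trans (norm_le_enorm _) yx.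
apply/nbhs_ballP; exists (d / n.+1%:R) => /=; first by rewrite divr_gt0.
move=> y; rewrite -ball_normE /= distrC => yx; apply: dA.
apply: (le_lt_trans (enorm_le_norm _)).
rewrite -mulr_natr (@le_lt_trans _ _ (`|y - x| * n.+1%:R)) //.
  by rewrite ler_wpM2l // ler_nat.
by rewrite -ltr_pdivlMr.
Qed.

End EuclideanFacts.

(** * Conormal jump of two oppositely oriented orthonormal pairs *)

Section Conormals.
Context {R : realType}.
Implicit Types (u v w n nu t k q : 'rV[R]_4).

(** In R^4 the span of [t1], [t2] is a plane inside the orthogonal complement of [n], [nu], which is
    a plane too. *)
Lemma orthonormal_complement n nu t1 t2 w :
  enorm n = 1 -> enorm nu = 1 -> dotp n nu = 0 ->
  dotp t1 n = 0 -> dotp t1 nu = 0 -> dotp t2 n = 0 -> dotp t2 nu = 0 ->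
  (forall a b, a *: t1 + b *: t2 = 0 -> a = 0 /\ b = 0) ->
  dotp w n = 0 -> dotp w nu = 0 -> exists a b, w = a *: t1 + b *: t2.
Proof.
move=> n1 nu1 nnu t1n t1nu t2n t2nu indep wn wnu.
have nn : dotp n n = 1 by rewrite -enorm_sqr n1 expr1n.
have nunu : dotp nu nu = 1 by rewrite -enorm_sqr nu1 expr1n.
pose N := col_mx n nu; pose B := col_mx t1 t2.
have dot0 (x y : 'rV[R]_4) : dotp x y = 0 -> x *m y^T = 0.
  by move=> xy; apply/matrixP => i j; rewrite !ord1 -dotp_mulmx xy mxE.
have row_freeP (x y : 'rV[R]_4) :
    (forall a b, a *: x + b *: y = 0 -> a = 0 /\ b = 0) -> \rank (col_mx x y) = 2.
  move=> xy; apply/eqP; rewrite -[_ == _]/(row_free _) -kermx_eq0; apply/rowV0P => v.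
  move/sub_kermxP; rewrite -(hsubmxK (v : 'rV_(1 + 1))) mul_row_col.
  rewrite [lsubmx v]mx11_scalar [rsubmx v]mx11_scalar !mul_scalar_mx => /xy[-> ->].
  by rewrite !raddf0 row_mx0.
have rN : \rank N = 2.
  apply: row_freeP => a b /(congr1 (fun z => (dotp z n, dotp z nu))) [].
  by rewrite !dotpE nn nunu nnu (dotpC nu) nnu !mulr1 !mulr0 addr0 add0r.
have rB : \rank B = 2 by apply: row_freeP.
have kerN (x : 'rV[R]_4) : dotp x n = 0 -> dotp x nu = 0 -> (x <= kermx N^T)%MS.
  by move=> xn xnu; apply/sub_kermxP; rewrite tr_col_mx mul_mx_row !dot0 // row_mx0.
have BK : (B <= kermx N^T)%MS by rewrite col_mx_sub !kerN.
have KB : (kermx N^T <= B)%MS.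
  by rewrite -(geq_leqif (mxrank_leqif_sup BK)) mxrank_ker mxrank_tr rN rB.
have /submxP[D ->] : (w <= B)%MS := submx_trans (kerN _ wn wnu) KB.
rewrite -(hsubmxK (D : 'rV_(1 + 1))) mul_row_col.
exists (lsubmx (D : 'rV_(1 + 1)) 0 0), (rsubmx (D : 'rV_(1 + 1)) 0 0).
by rewrite -!mul_scalar_mx -!mx11_scalar.
Qed.

(* In the plane orthogonal to the common edge space [span (t1, t2)] both
   [(n1, nu1)] and [(n2, nu2)] are orthonormal bases.  The covector [k], which
   vanishes on [t1], [t2] and [q], detects that they have opposite
   orientations, so that [nu1 + nu2] is the rotation of [n1 - n2] by a right
   angle, which is a multiple of [n1 + n2]. *)
Lemma conormal_jump n1 n2 nu1 nu2 ns t1 t2 k q w1 w2 (d : R) :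
  enorm n1 = 1 -> enorm n2 = 1 -> enorm nu1 = 1 -> enorm nu2 = 1 ->
  enorm ns = 1 -> dotp n1 nu1 = 0 -> dotp n2 nu2 = 0 ->
  (forall a b, a *: t1 + b *: t2 = 0 -> a = 0 /\ b = 0) ->
  (forall t, t \in [:: t1; t2] ->
     [/\ dotp t n1 = 0, dotp t nu1 = 0, dotp t n2 = 0, dotp t nu2 = 0 & dotp k t = 0]) ->
  dotp k q = 0 -> 0 < dotp q n1 -> 0 < dotp q n2 ->
  dotp w1 n1 = 0 -> dotp w1 nu1 < 0 -> dotp w2 n2 = 0 -> dotp w2 nu2 < 0 ->
  dotp k w1 * dotp k w2 < 0 ->
  enorm (ns - n1) <= d -> enorm (ns - n2) <= d -> d <= 2^-1 ->
  enorm (nu1 + nu2) <= 2 * d /\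
  enorm ((nu1 + nu2) *m (1%:M - ns^T *m ns)) <= 4 * d ^+ 2.
Proof.
move=> un1 un2 unu1 unu2 uns nnu1 nnu2 indep T kq qn1 qn2 w1n w1nu w2n w2nu kw dn1 dn2 d12.
have sq (x : 'rV[R]_4) : enorm x = 1 -> dotp x x = 1.
  by move=> x1; rewrite -enorm_sqr x1 expr1n.
have [t1n1 t1u1 t1n2 t1u2 kt1] := T t1 (mem_head _ _).
have [t2n1 t2u1 t2n2 t2u2 kt2] : [/\ dotp t2 n1 = 0, dotp t2 nu1 = 0, dotp t2 n2 = 0,
   dotp t2 nu2 = 0 & dotp k t2 = 0] by apply: T; rewrite !inE eqxx orbT.
have perp1 w : dotp w n1 = 0 -> dotp w nu1 = 0 ->
    [/\ dotp w n2 = 0, dotp w nu2 = 0 & dotp w k = 0].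
  move=> wn wu; have [a [b ->]] := orthonormal_complement un1 unu1 nnu1 t1n1 t1u1 t2n1 t2u1 indep wn wu.
  by rewrite !dotpE t1n2 t2n2 t1u2 t2u2 !(dotpC _ k) kt1 kt2 !mulr0 !addr0.
have perp2 w : dotp w n2 = 0 -> dotp w nu2 = 0 -> dotp w k = 0.
  move=> wn wu; have [a [b ->]] := orthonormal_complement un2 unu2 nnu2 t1n2 t1u2 t2n2 t2u2 indep wn wu.
  by rewrite !dotpE !(dotpC _ k) kt1 kt2 !mulr0 !addr0.
have nn1 := sq _ un1; have nn2 := sq _ un2; have uu1 := sq _ unu1; have uu2 := sq _ unu2.
have plane w : (forall x, dotp x n1 = 0 -> dotp x nu1 = 0 -> dotp x w = 0) ->
    w = dotp w n1 *: n1 + dotp w nu1 *: nu1.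
  move=> wP; apply/eqP; rewrite -subr_eq0 -dotp_eq0; apply/eqP.
  set r := w - _; have rn : dotp r n1 = 0.
    by rewrite !dotpE nn1 (dotpC nu1) nnu1; lra.
  have ru : dotp r nu1 = 0 by rewrite !dotpE nnu1 uu1; lra.
  by rewrite {2}/r dotpBr wP // dotpDr !dotpZr rn ru; lra.
have en2 : n2 = dotp n2 n1 *: n1 + dotp n2 nu1 *: nu1.
  by apply: plane => x xn xu; have [] := perp1 x xn xu.
have eu2 : nu2 = dotp nu2 n1 *: n1 + dotp nu2 nu1 *: nu1.
  by apply: plane => x xn xu; have [] := perp1 x xn xu.
have ek : k = dotp k n1 *: n1 + dotp k nu1 *: nu1.
  by apply: plane => x xn xu; have [] := perp1 x xn xu.
(* [w1] without its [nu1] component is orthogonal to [n1] and [nu1], hence in the edge space, on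
   which [k] vanishes. *)
have kw1 : dotp k w1 = dotp w1 nu1 * dotp k nu1.
  have := perp1 (w1 - dotp w1 nu1 *: nu1); rewrite !dotpE w1n (dotpC nu1) nnu1 uu1.
  by case; [lra|lra|move=> _ _; rewrite !(dotpC _ k); lra].
have kw2 : dotp k w2 = dotp w2 nu2 * dotp k nu2.
  have := perp2 (w2 - dotp w2 nu2 *: nu2); rewrite !dotpE w2n (dotpC nu2) nnu2 uu2.
  by move=> H; have := H ltac:(lra) ltac:(lra); rewrite !(dotpC _ k); lra.
have ku : dotp k nu1 * dotp k nu2 < 0.
  have ww : 0 < dotp w1 nu1 * dotp w2 nu2 by rewrite nmulr_rgt0.
  by rewrite -(pmulr_rlt0 _ ww); move: kw; rewrite kw1 kw2; congr (_ < _); ring.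
have cq : dotp q n2 = dotp n2 n1 * dotp q n1 + dotp n2 nu1 * dotp q nu1.
  by rewrite {1}en2 !dotpE.
have ck : dotp k nu2 = dotp nu2 n1 * dotp k n1 + dotp nu2 nu1 * dotp k nu1.
  by rewrite {1}eu2 !dotpE.
have ckq : dotp k n1 * dotp q n1 + dotp k nu1 * dotp q nu1 = 0.
  by rewrite -kq {3}ek !dotpE !(dotpC _ q).
have c2 : dotp n2 n1 ^+ 2 + dotp n2 nu1 ^+ 2 = 1.
  by rewrite -nn2 {3}en2 dotpDl !dotpZl !expr2 !(dotpC n2).
have x2 : dotp nu2 n1 ^+ 2 + dotp nu2 nu1 ^+ 2 = 1.
  by rewrite -uu2 {3}eu2 dotpDl !dotpZl !expr2 !(dotpC nu2).
have cx : dotp n2 n1 * dotp nu2 n1 + dotp n2 nu1 * dotp nu2 nu1 = 0.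
  by rewrite -nnu2 {3}en2 dotpDl !dotpZl !(dotpC nu2).
move: en2 eu2 cq ck ckq c2 x2 cx; set c := dotp n2 n1; set s := dotp n2 nu1.
set x := dotp nu2 n1; set y := dotp nu2 nu1.
move=> en2 eu2 cq ck ckq c2 x2 cx.
(* In the basis ([n1], [nu1]) the vector (x, y) is orthogonal to the unit vector (c, s), so it is a
   multiple of (-s, c). The factor is the determinant c y - s x, which is 1 or -1. *)
have x_eq : x = (c * y - s * x) * - s.
  by have := congr1 ( *%R^~ x) c2; have := congr1 ( *%R^~ c) cx; rewrite /=; lra.
have y_eq : y = (c * y - s * x) * c.
  by have := congr1 ( *%R^~ y) c2; have := congr1 ( *%R^~ s) cx; rewrite /=; lra.
have o2 : (c * y - s * x) ^+ 2 = 1.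
  have := congr1 ( *%R^~ ((c * y - s * x) ^+ 2)) c2; rewrite /= mul1r => <-.
  by rewrite -x2 [X in _ = X ^+ 2 + _]x_eq [X in _ = _ + X ^+ 2]y_eq; ring.
(* Determinant 1 is impossible: [k] is orthogonal to [q], so (k.nu1) (k.nu2) (q.n1) would equal
   (k.nu1)^2 (q.n2), which is nonnegative, against the assumed signs. *)
have o_eq : c * y - s * x = -1.
  have /eqP : (c * y - s * x - 1) * (c * y - s * x + 1) = 0 by rewrite -subr_sqr o2 expr1n subrr.
  rewrite mulf_eq0 => /orP[/eqP o1|/eqP]; last by lra.
  have o1' : c * y - s * x = 1 by lra.
  move: x_eq y_eq ck ku; rewrite o1' !mul1r => -> -> -> ku.
  have : 0 < - (dotp k nu1 * (- s * dotp k n1 + c * dotp k nu1) * dotp q n1).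
    by rewrite oppr_gt0 pmulr_llt0.
  have -> : - (dotp k nu1 * (- s * dotp k n1 + c * dotp k nu1) * dotp q n1)
     = - (dotp k nu1 * (- s * (dotp k n1 * dotp q n1) + c * dotp k nu1 * dotp q n1)) by ring.
  have -> : dotp k n1 * dotp q n1 = - (dotp k nu1 * dotp q nu1) by lra.
  have -> : - (dotp k nu1 * (- s * - (dotp k nu1 * dotp q nu1) + c * dotp k nu1 * dotp q n1))
    = - (dotp k nu1 ^+ 2 * (c * dotp q n1 + s * dotp q nu1)) by ring.
  by rewrite -cq oppr_gt0 pmulr_llt0 // ltNge sqr_ge0.
move: x_eq y_eq; rewrite o_eq !mulN1r opprK => xs yc.
have d0 : 0 <= d := le_trans (enorm_ge0 _) dn1.
have dn12 : enorm (n1 - n2) <= 2 * d.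
  apply: (le_trans (enorm_dist _ ns _)); rewrite enorm_distC; lra.
(* Both squared lengths are s^2 + (1 - c)^2. *)
have ejump : enorm (nu1 + nu2) = enorm (n1 - n2).
  congr Num.sqrt; rewrite eu2 en2 xs yc !dotpE nn1 uu1 (dotpC nu1) nnu1.
  by move: c2; nra.
have nsum : 1 <= enorm (n1 + n2).
  have -> : n1 + n2 = (1 + 1) *: ns - ((ns - n1) + (ns - n2)).
    by rewrite scalerDl scale1r addrACA -opprD subKr.
  apply: le_trans (enorm_subr_ge _ _); rewrite enormZ uns ger0_norm //.
  by have := enormD (ns - n1) (ns - n2); lra.
have nsum2 : enorm (n1 + n2) ^+ 2 = 2 * (1 + c).
  by rewrite enorm_sqr !dotpE nn1 nn2 (dotpC n1 n2) -/c; ring.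
have c1 : 0 < 1 + c by have := sqr_ge0 (enorm (n1 + n2) - 1); nra.
have par : nu1 + nu2 = (s / (1 + c)) *: (n1 + n2).
  have s2 : s ^+ 2 = (1 - c) * (1 + c) by lra.
  rewrite eu2 [X in _ *: (_ + X)]en2 xs yc; apply/rowP => i; rewrite !mxE.
  have -> : s / (1 + c) * (n1 0 i + (c * n1 0 i + s * nu1 0 i)) =
      s * n1 0 i + s ^+ 2 / (1 + c) * nu1 0 i by field; rewrite gt_eqF.
  by rewrite s2 mulfK ?gt_eqF //; ring.
split; first by rewrite ejump.
have nsP : ns *m (1%:M - ns^T *m ns) = 0.
  by rewrite mulmxBr mulmx1 mulmxA [ns *m _]mx11_scalar -dotp_mulmx sq // mul1mx subrr.
have Ple (v : 'rV[R]_4) : enorm (v *m (1%:M - ns^T *m ns)) <= enorm v.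
  rewrite mulmxBr mulmx1 mulmxA [v *m _]mx11_scalar -dotp_mulmx mul_scalar_mx.
  rewrite -ler_sqr ?nnegrE ?enorm_ge0 // !enorm_sqr !dotpE (dotpC ns v) (sq _ uns).
  by have := sqr_ge0 (dotp v ns); lra.
(* The projection kills [ns], so [n1 + n2] may be replaced by its deviation from twice [ns], of size
   2 d. The second factor 2 d is the bound on s / (1 + c). *)
have -> : (nu1 + nu2) *m (1%:M - ns^T *m ns)
    = (s / (1 + c)) *: (((n1 - ns) + (n2 - ns)) *m (1%:M - ns^T *m ns)).
  rewrite par -scalemxAl; congr (_ *: _); move: nsP; set Q := _ - _ *m _ => nsP.
  by rewrite !mulmxDl !mulNmx nsP subr0 subr0.
rewrite enormZ.
(* [n1 + n2] has length at least 1, so the coefficient is at most the length of the jump. *)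
have kap : `|s / (1 + c)| <= 2 * d.
  have := dn12; rewrite -ejump par enormZ; apply: le_trans.
  by rewrite ler_peMr.
have pr : enorm (((n1 - ns) + (n2 - ns)) *m (1%:M - ns^T *m ns)) <= 2 * d.
  apply: (le_trans (Ple _)); apply: (le_trans (enormD _ _)).
  by rewrite !(enorm_distC _ ns); lra.
have -> : 4 * d ^+ 2 = (2 * d) * (2 * d) by ring.
by rewrite ler_pM ?enorm_ge0.
Qed.

End Conormals.
(** * Tangent cones *)

Section TangentCones.
Context {R : realType} {n : nat}.
Implicit Types (A B : set 'rV[R]_n) (F : 'rV[R]_n -> R) (u v w x y z p : 'rV[R]_n).

Lemma derive_grad F z v : differentiable F z -> 'D_v F z = dotp (grad F z) v.
Proof.
move=> dF; rewrite deriveE // {1}[v]row_sum_delta linear_sum /=.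
by apply: eq_bigr => i _; rewrite linearZ /= -deriveE // mulrC mxE.
Qed.

Lemma differentiable_grad F z : differentiable F z -> forall e, 0 < e ->
  exists2 d, 0 < d & forall y, enorm (y - z) < d ->
    `|F y - F z - dotp (grad F z) (y - z)| <= e * enorm (y - z).
Proof.
move=> dF e e0; have /eqaddoP H := diff_locally dF.
move: (H e e0) => /(@enorm_ball_nbhs R n 0)[d d0 dP]; exists d => // y yd.
have := dP (y - z); rewrite subr0 => /(_ yd).
have -> : (F \o shift z - (cst (F z) + 'd F z)) (y - z) = F y - F z - dotp (grad F z) (y - z).
  by rewrite -derive_grad // deriveE // !fctE /= subrK opprD addrA.
by move=> H1; apply: (le_trans H1); rewrite ler_wpM2l ?(ltW e0) //; exact: norm_le_enorm.
Qed.

(** Shrinking [e] in the definition also places the approximating point itself within [e] of [z]. *)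
Lemma tangent_cone_approx A z v : tangent_cone A z v -> forall e, 0 < e ->
  exists a s, [/\ A a, 0 < s, s < e, enorm (s^-1 *: (a - z) - v) < e &
    enorm (a - z) <= s * (enorm v + 1) /\ enorm (a - z) < e].
Proof.
move=> Av e e0; pose e' := Num.min 1 (e / (enorm v + 1)).
have v1 : 0 < enorm v + 1 by rewrite ltr_wpDl ?enorm_ge0.
have e'0 : 0 < e' by rewrite lt_min ltr01 divr_gt0.
have e'1 : e' <= 1 by rewrite ge_min lexx.
have e'e : e' * (enorm v + 1) <= e.
  by rewrite -ler_pdivlMr // ge_min lexx orbT.
have e'e2 : e' <= e.
  by apply: le_trans e'e; rewrite ler_peMr ?(ltW e'0) // lerDr enorm_ge0.
have [a [s [Aa s0 se H]]] := Av e' e'0.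
have az : enorm (a - z) <= s * (enorm v + 1).
  have -> : a - z = s *: (s^-1 *: (a - z)) by rewrite scalerA mulfV ?gt_eqF // scale1r.
  rewrite enormZ gtr0_norm // ler_wpM2l ?(ltW s0) //.
  rewrite -[s^-1 *: _](subrK v) addrC; apply: le_trans (enormD _ _) _.
  by rewrite lerD2l; apply: ltW (lt_le_trans H e'1).
exists a, s; split => //; [exact: lt_le_trans se e'e2|exact: lt_le_trans H e'e2|split=> //].
apply: (le_lt_trans az); apply: lt_le_trans e'e; by rewrite ltr_pM2r.
Qed.

Lemma tangent_cone_line A z v : (exists2 d, 0 < d & forall s, 0 < s -> s < d -> A (z + s *: v)) ->
  tangent_cone A z v.
Proof.
move=> [d d0 dA] e e0; exists (z + (Num.min e d / 2) *: v), (Num.min e d / 2).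
have m0 : 0 < Num.min e d by rewrite lt_min e0.
have m2 : 0 < Num.min e d / 2 by rewrite divr_gt0.
have mm : Num.min e d / 2 < Num.min e d by rewrite ltr_pdivrMr // ltr_pMr // ltr1n.
split => //.
- by apply: dA => //; apply: lt_le_trans mm _; rewrite ge_min lexx orbT.
- by apply: lt_le_trans mm _; rewrite ge_min lexx.
- by rewrite (addrC z) addrK scalerA mulVf ?gt_eqF // scale1r subrr enorm0.
Qed.

Lemma tangent_cone_ball A z v d : 0 < d -> tangent_cone A z v ->
  tangent_cone (A `&` [set y | enorm (y - z) < d]) z v.
Proof.
move=> d0 Av e e0.
have m0 : 0 < Num.min e d by rewrite lt_min e0.
have [a [s [Aa s0 se H [_ az]]]] := tangent_cone_approx Av m0.
exists a, s; split => //; [split=> //=| |].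
- by apply: lt_le_trans az _; rewrite ge_min lexx orbT.
- by apply: lt_le_trans se _; rewrite ge_min lexx.
- by apply: lt_le_trans H _; rewrite ge_min lexx.
Qed.

(** The difference quotients converge to [v], so their products with [p] are eventually positive.
    With [p] in the time direction this restricts a cone to one side of a time slice. *)
Lemma tangent_cone_pos A z v p : 0 < dotp p v -> tangent_cone A z v ->
  tangent_cone (A `&` [set y | 0 < dotp p (y - z)]) z v.
Proof.
move=> pv Av e e0; have p1 : 0 < enorm p + 1 by rewrite ltr_wpDl ?enorm_ge0.
have m0 : 0 < Num.min e (dotp p v / (enorm p + 1)) by rewrite lt_min e0 divr_gt0.
have [a [s [Aa s0 se H _]]] := tangent_cone_approx Av m0.
exists a, s; split => //; [split=> //=| |].
- suff : 0 < s^-1 * dotp p (a - z) by rewrite pmulr_rgt0 ?invr_gt0.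
  rewrite -dotpZr -[_ *: _](subrK v) dotpDr.
  suff : enorm p * enorm (s^-1 *: (a - z) - v) < dotp p v.
    by have := cauchy_schwarz p (s^-1 *: (a - z) - v); rewrite ler_norml => /andP[]; lra.
  apply: (@le_lt_trans _ _ ((enorm p) * (dotp p v / (enorm p + 1)))).
    by rewrite ler_wpM2l ?enorm_ge0 // (le_trans (ltW H)) // ge_min lexx orbT.
  by rewrite mulrA ltr_pdivrMr // mulrC ltr_pM2l // ltrDl.
- by apply: lt_le_trans se _; rewrite ge_min lexx.
- by apply: lt_le_trans H _; rewrite ge_min lexx.
Qed.

Lemma tangent_cone_le A z v F : differentiable F z -> (forall y, A y -> F y <= F z) ->
  tangent_cone A z v -> dotp (grad F z) v <= 0.
Proof.
move=> dF FA Av; apply/ler_addgt0Pr => e e0; rewrite add0r; pose g := grad F z.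
have g1 : 0 < enorm g + 1 by rewrite ltr_wpDl ?enorm_ge0.
have v1 : 0 < enorm v + 1 by rewrite ltr_wpDl ?enorm_ge0.
have [d d0 dP] := differentiable_grad dF (divr_gt0 (divr_gt0 e0 (ltr0Sn _ 1)) v1).
have m0 : 0 < Num.min d (e / 2 / (enorm g + 1)) by rewrite lt_min d0 !divr_gt0.
have [a [s [Aa s0 se H [az1 az]]]] := tangent_cone_approx Av m0.
have ad : enorm (a - z) < d by apply: lt_le_trans az _; rewrite ge_min lexx.
have /ler_normlP[D _] := dP a ad; have Fa := FA a Aa.
have D' : dotp g (a - z) <= s * (e / 2).
  have : e / 2 / (enorm v + 1) * enorm (a - z) <= s * (e / 2).
    by rewrite mulrAC ler_pdivrMr // mulrC [leRHS]mulrAC ler_wpM2r // divr_ge0 // ltW.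
  by rewrite -/g in D; lra.
have -> : v = s^-1 *: (a - z) - (s^-1 *: (a - z) - v) by rewrite subKr.
rewrite dotpBr dotpZr -/g.
have : s^-1 * dotp g (a - z) <= e / 2 by rewrite mulrC ler_pdivrMr // mulrC.
have : enorm g * enorm (s^-1 *: (a - z) - v) <= e / 2.
  rewrite -[leRHS](@mulfVK _ (enorm g + 1)) ?gt_eqF // mulrC ler_pM ?enorm_ge0 ?lerDl //.
  by apply: (le_trans (ltW H)); rewrite ge_min lexx orbT.
have /ler_normlP[] := cauchy_schwarz g (s^-1 *: (a - z) - v); lra.
Qed.

Lemma tangent_cone_eq A z v F : differentiable F z -> (forall y, A y -> F y = F z) ->
  tangent_cone A z v -> dotp (grad F z) v = 0.
Proof.
move=> dF FA Av; apply: le_anti; rewrite (tangent_cone_le dF _ Av) => [|y /FA->//].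
have dF' : differentiable (- F) z by apply: differentiableN.
have := @tangent_cone_le A z v (- F) dF' _ Av.
rewrite -derive_grad // deriveN; last exact: diff_derivable.
by rewrite derive_grad // oppr_le0; apply => y /FA /= Fy; rewrite /GRing.opp/= Fy.
Qed.

Lemma tangent_cone_closure A z v d : tangent_cone A z v -> 0 < d ->
  exists2 a, A a & enorm (a - z) < d.
Proof. by move=> Av d0; have [a [s [? _ _ _ []]]] := tangent_cone_approx Av d0; exists a. Qed.

(** Of [w] and [- w] one lies in the half-space, so [nn] is orthogonal to all of the complement of
    [m]. This identifies the unnamed normal in [outer_conormal] with the discrete normal, up to
    sign. *)
Lemma halfspace_normal (m nu nn : 'rV[R]_n) : enorm m = 1 -> enorm nn = 1 ->
  (forall w, dotp w m = 0 -> dotp w nu <= 0 -> dotp w nn = 0) ->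
  nn = dotp nn m *: m /\ dotp nn m != 0.
Proof.
move=> m1 n1 H.
have H2 w : dotp w m = 0 -> dotp w nn = 0.
  move=> wm; case: (leP (dotp w nu) 0) => [/(H _ wm)//|wnu].
  have := H (- w); rewrite !dotpNl wm oppr0 => /(_ erefl); rewrite oppr_le0.
  by move=> /(_ (ltW wnu)) /eqP; rewrite oppr_eq0 => /eqP.
have mm : dotp m m = 1 by rewrite -enorm_sqr m1 expr1n.
have e : nn = dotp nn m *: m.
  apply/eqP; rewrite -subr_eq0 -dotp_eq0; apply/eqP; set r := nn - _.
  have rm : dotp r m = 0 by rewrite /r !dotpE mm; lra.
  by rewrite {2}/r dotpBr H2 // dotpZr rm; lra.
split=> //; apply/eqP => nm; move: e; rewrite nm scale0r => n0.
by move: n1; rewrite n0 enorm0 => /eqP; rewrite eq_sym oner_eq0.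
Qed.

Lemma enorm_mulmx (M : 'M[R]_n) : exists2 C, 0 < C & forall v, enorm (v *m M) <= C * enorm v.
Proof.
exists (1 + (\sum_i \sum_j `|M i j|)).
  by rewrite ltr_pwDl // sumr_ge0 // => i _; rewrite sumr_ge0.
move=> v; rewrite mulrDl mul1r; apply: (le_trans (enorm_le_sum _)).
rewrite -[leLHS]add0r lerD ?enorm_ge0 // exchange_big /= mulr_suml ler_sum // => j _.
rewrite mxE; apply: (le_trans (ler_norm_sum _ _ _)); rewrite mulr_suml ler_sum // => i _.
by rewrite normrM mulrC ler_wpM2l // coord_le_enorm.
Qed.

Lemma differentiable_jac (f : 'rV[R]_n -> 'rV[R]_n) z :
  (forall i, differentiable (fun y => f y 0 i) z) -> forall e, 0 < e ->
  exists2 d, 0 < d & forall y, enorm (y - z) < d ->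
    enorm (f y - f z - (y - z) *m (jac f z)^T) <= e * enorm (y - z).
Proof.
move=> df e e0; pose e' := e / n.+1%:R; have e'0 : 0 < e' by rewrite divr_gt0.
have /fin_all_exists [d dP] i : exists d, 0 < d /\ forall y, enorm (y - z) < d ->
    `|f y 0 i - f z 0 i - dotp (grad (fun y => f y 0 i) z) (y - z)| <= e' * enorm (y - z).
  by have [d ? ?] := differentiable_grad (df i) e'0; exists d.
exists (\big[Num.min/1]_i d i); first by apply: lt_bigmin => // i _; case: (dP i).
move=> y yz; apply: (@le_trans _ _ ((e' * enorm (y - z)) *+ n)); last first.
  rewrite -mulr_natr mulrAC ler_wpM2r ?enorm_ge0 // /e' mulrAC ler_pdivrMr //.
  by rewrite ler_wpM2l ?(ltW e0) // ler_nat.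
apply: enorm_le_bound => i; case: (dP i) => _ /(_ y); rewrite /= !mxE.
have -> : \sum_j (y - z) 0 j * (jac f z)^T j i = dotp (grad (fun y => f y 0 i) z) (y - z).
  by apply: eq_bigr => j _; rewrite !mxE mulrC.
by apply; apply: lt_le_trans yz _; exact: bigmin_le.
Qed.

End TangentCones.

(** * Tangent cones under a map differentiable at a point *)

Section TangentConeImage.
Context {R : realType} {n : nat}.
Variables (f : 'rV[R]_n -> 'rV[R]_n) (z : 'rV[R]_n) (M : 'M[R]_n).
Hypothesis df : forall e, 0 < e -> exists2 d, 0 < d & forall y, enorm (y - z) < d ->
    enorm (f y - f z - (y - z) *m M) <= e * enorm (y - z).

Lemma tangent_cone_image A v : tangent_cone A z v -> tangent_cone (f @` A) (f z) (v *m M).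
Proof.
move=> Av e e0; have [C C0 CP] := enorm_mulmx M.
have v1 : 0 < enorm v + 1 by rewrite ltr_wpDl ?enorm_ge0.
have e2 : 0 < e / 2 by rewrite divr_gt0.
have [d d0 dP] := df (divr_gt0 e2 v1).
have m0 : 0 < Num.min e (Num.min d (e / 2 / C)) by rewrite !lt_min e0 d0 divr_gt0.
have [a [s [Aa s0 se H [az1 az]]]] := tangent_cone_approx Av m0.
exists (f a), s; split => //; [by apply: lt_le_trans se _; rewrite ge_min lexx|].
have -> : s^-1 *: (f a - f z) - v *m M = s^-1 *: (f a - f z - (a - z) *m M)
    + (s^-1 *: (a - z) - v) *m M.
  by rewrite [X in _ = X + _]scalerBr (mulmxBl (s^-1 *: (a - z))) -scalemxAl addrA subrK.
apply: (le_lt_trans (enormD _ _)); rewrite [ltRHS](splitr e); apply: ler_ltD.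
  rewrite enormZ gtr0_norm ?invr_gt0 // mulrC ler_pdivrMr //.
  apply: (le_trans (dP a _)).
    by apply: lt_le_trans az _; rewrite !ge_min lexx orbT.
  by rewrite mulrAC ler_pdivrMr // -mulrA ler_wpM2l // ltW.
apply: (le_lt_trans (CP _)); rewrite mulrC -ltr_pdivlMr //; apply: (lt_le_trans H).
by rewrite !ge_min lexx !orbT.
Qed.

(** Continuity of the inverse at [f z] first brings the preimages close to [z]. There the
    differentiability error is at most half of |a - z| after inversion of [M], so it is absorbed and
    |a - z| is bounded by a multiple of |f a - f z|. *)
Lemma tangent_cone_preimage A w : M \in unitmx ->
  (forall d, 0 < d -> exists2 r, 0 < r & forall y, A y -> enorm (f y - f z) < r -> enorm (y - z) < d) ->
  tangent_cone (f @` A) (f z) w -> tangent_cone A z (w *m invmx M).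
Proof.
move=> Mu inv Aw e e0; have [C C0 CP] := enorm_mulmx (invmx M).
have w1 : 0 < enorm w + 1 by rewrite ltr_wpDl ?enorm_ge0.
have C2 : 0 < (2 * C)^-1 by rewrite invr_gt0 mulr_gt0.
have [d1 d10 d1P] := df C2.
have K0 : 0 < e / 2 / (C * (2 * C * (enorm w + 1))) by rewrite !divr_gt0 // !mulr_gt0.
have [d2 d20 d2P] := df K0.
have dm : 0 < Num.min d1 d2 by rewrite lt_min d10.
have [r r0 rP] := inv _ dm.
have m0 : 0 < Num.min e (Num.min r (e / 2 / C)) by rewrite !lt_min e0 r0 !divr_gt0.
have [b [s [[a Aa <-] s0 se H [az1 az]]]] := tangent_cone_approx Aw m0.
have /(rP _ Aa) ad : enorm (f a - f z) < r by apply: lt_le_trans az _; rewrite !ge_min lexx orbT.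
have ad1 : enorm (a - z) < d1 by apply: lt_le_trans ad _; rewrite ge_min lexx.
have ad2 : enorm (a - z) < d2 by apply: lt_le_trans ad _; rewrite ge_min lexx orbT.
have eaz : a - z = (f a - f z - (f a - f z - (a - z) *m M)) *m invmx M.
  by rewrite subKr mulmxK.
have az2 : enorm (a - z) <= 2 * C * (s * (enorm w + 1)).
  have : enorm (a - z) <= C * (enorm (f a - f z) + (2 * C)^-1 * enorm (a - z)).
    rewrite {1}eaz; apply: (le_trans (CP _)); rewrite ler_wpM2l ?(ltW C0) //.
    by apply: (le_trans (enormB _ _)); rewrite lerD2l d1P.
  have -> : C * (enorm (f a - f z) + (2 * C)^-1 * enorm (a - z))
    = C * enorm (f a - f z) + enorm (a - z) / 2 by field; rewrite gt_eqF.
  have : C * enorm (f a - f z) <= C * (s * (enorm w + 1)) by rewrite ler_wpM2l // ltW.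
  lra.
exists a, s; split => //; first by apply: lt_le_trans se _; rewrite ge_min lexx.
rewrite {1}eaz scalemxAl -mulmxBl; apply: (le_lt_trans (CP _)).
rewrite scalerBr addrAC; apply: (@le_lt_trans _ _ (C * (enorm (s^-1 *: (f a - f z) - w)
   + enorm (s^-1 *: (f a - f z - (a - z) *m M))))).
  by rewrite ler_wpM2l ?(ltW C0) // enormB.
rewrite mulrDr [ltRHS](splitr e) ltr_leD //.
  rewrite mulrC -ltr_pdivlMr //; apply: (lt_le_trans H); by rewrite !ge_min lexx !orbT.
rewrite enormZ gtr0_norm ?invr_gt0 // mulrA mulrAC ler_pdivrMr //.
apply: (@le_trans _ _ (C * (e / 2 / (C * (2 * C * (enorm w + 1))) * (2 * C * (s * (enorm w + 1)))))).
  rewrite ler_wpM2l ?(ltW C0) //; apply: (le_trans (d2P _ ad2)).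
  by rewrite ler_wpM2l // ltW.
rewrite le_eqVlt; apply/orP; left; apply/eqP; field; by rewrite !gt_eqF.
Qed.

End TangentConeImage.
(** * Polynomials and barycentric coordinates *)

Section PolynomialFunctions.
Context {R : realType} {n : nat}.
Implicit Types (p q : 'rV[R]_n -> R) (m : nat).

Lemma poly_fun_mono m (e : 'I_n -> nat) (c : R) : (\sum_i e i <= m)%N ->
  poly_fun m (fun x => c * \prod_i x 0 i ^+ e i).
Proof.
move=> em; have ei i : (e i <= m)%N by apply: leq_trans em; rewrite (bigD1 i) //= leq_addr.
pose a0 := [ffun i => inord (e i)] : {ffun 'I_n -> 'I_m.+1}.
have a0E i : a0 i = e i :> nat by rewrite ffunE inordK ?ltnS.
exists (fun a => if a == a0 then c else 0) => x.
rewrite (bigD1 a0) /= ?eqxx; last by under eq_bigr do rewrite a0E.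
rewrite [X in _ + X]big1 => [|a /andP[_ /negPf ->]]; last by rewrite mul0r.
by rewrite addr0; congr (_ * _); apply: eq_bigr => i _; rewrite a0E.
Qed.

Lemma poly_fun0 m : poly_fun m (fun _ : 'rV[R]_n => 0).
Proof. by exists (fun _ => 0) => x; rewrite big1 // => a _; rewrite mul0r. Qed.

Lemma poly_funD m p q : poly_fun m p -> poly_fun m q -> poly_fun m (fun x => p x + q x).
Proof.
move=> [c cP] [d dP]; exists (fun a => c a + d a) => x.
by rewrite cP dP -big_split; apply: eq_bigr => a _; rewrite mulrDl.
Qed.

Lemma poly_fun_sum m (I : Type) (r : seq I) (P : pred I) (F : I -> 'rV[R]_n -> R) :
  (forall i, P i -> poly_fun m (F i)) -> poly_fun m (fun x => \sum_(i <- r | P i) F i x).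
Proof.
move=> FP; elim: r => [|i r IH].
  by under eq_fun do rewrite big_nil; exact: poly_fun0.
have [Pi|/negPf Pi] := boolP (P i); under eq_fun do rewrite big_cons Pi; last exact: IH.
by apply: poly_funD => //; exact: FP.
Qed.

Lemma poly_funM m1 m2 p q : poly_fun m1 p -> poly_fun m2 q ->
  poly_fun (m1 + m2) (fun x => p x * q x).
Proof.
move=> [c cP] [d dP]; rewrite (_ : (fun x => _) = fun x : 'rV[R]_n =>
  \sum_(a : {ffun 'I_n -> 'I_m1.+1} | (\sum_i a i <= m1)%N)
  \sum_(b : {ffun 'I_n -> 'I_m2.+1} | (\sum_i b i <= m2)%N)
    c a * d b * \prod_i x 0 i ^+ (a i + b i)); last first.
  apply/funext => x; rewrite cP dP mulr_suml; apply: eq_bigr => a _.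
  rewrite mulr_sumr; apply: eq_bigr => b _; rewrite mulrACA -big_split /=.
  by congr (_ * _); apply: eq_bigr => i _; rewrite exprD.
apply: poly_fun_sum => a am; apply: poly_fun_sum => b bm.
by apply: poly_fun_mono; rewrite big_split leq_add.
Qed.

Lemma poly_funW m1 m2 p : (m1 <= m2)%N -> poly_fun m1 p -> poly_fun m2 p.
Proof.
move=> m12 [c cP]; rewrite (funext cP); apply: poly_fun_sum => a am.
by apply: poly_fun_mono; exact: leq_trans am m12.
Qed.

Lemma poly_fun_cst m c : poly_fun m (fun _ : 'rV[R]_n => c).
Proof.
rewrite (_ : (fun x => _) = (fun x : 'rV[R]_n => c * \prod_i x 0 i ^+ 0)).
  by apply: poly_fun_mono; rewrite big1.
by apply/funext => x; rewrite big1 ?mulr1.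
Qed.

Lemma poly_fun_coord i : poly_fun 1 (fun x : 'rV[R]_n => x 0 i).
Proof.
rewrite (_ : (fun x => _) = (fun x : 'rV[R]_n => 1 * \prod_j x 0 j ^+ (j == i))).
  by apply: poly_fun_mono; rewrite (bigD1 i) //= eqxx big1 // => j /negPf ->.
apply/funext => x; rewrite (bigD1 i) //= eqxx expr1 big1 ?mulr1 ?mul1r //.
by move=> j /negPf ->.
Qed.

Lemma poly_funZ m (c : R) p : poly_fun m p -> poly_fun m (fun x => c * p x).
Proof. by move=> pP; apply: (@poly_funM 0 m) => //; exact: poly_fun_cst. Qed.

(* Degrees are not decreased by [pder], which keeps the induction uniform. *)
Let smooth_poly m p := [/\ poly_fun m p, (forall x, differentiable p x)
  & forall i, poly_fun m (pder i p)].

Let smooth_polyD m p q : smooth_poly m p -> smooth_poly m q -> smooth_poly m (fun x => p x + q x).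
Proof.
move=> [pP dp dpP] [qP dq dqP]; split; first exact: poly_funD.
  by move=> x; apply: differentiableD.
move=> i; rewrite (_ : pder i _ = fun x => pder i p x + pder i q x); first exact: poly_funD.
by apply/funext => x; rewrite /pder deriveD //; exact: diff_derivable.
Qed.

Let smooth_polyM m1 m2 p q : smooth_poly m1 p -> smooth_poly m2 q ->
  smooth_poly (m1 + m2) (fun x => p x * q x).
Proof.
move=> [pP dp dpP] [qP dq dqP]; split; first exact: poly_funM.
  by move=> x; apply: differentiableM.
move=> i; rewrite (_ : pder i _ = fun x => p x * pder i q x + pder i p x * q x).
  by apply: poly_funD; apply: poly_funM.
apply/funext => x; rewrite /pder deriveM; try exact: diff_derivable.
by rewrite /GRing.scale /= (mulrC (q x)).
Qed.

Let smooth_poly_cst c : smooth_poly 0 (fun _ => c).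
Proof.
split; [exact: poly_fun_cst|by move=> x; exact: differentiable_cst|move=> i].
rewrite (_ : pder i _ = fun=> 0); first exact: poly_fun_cst.
by apply/funext => x; rewrite /pder derive_cst.
Qed.

Let smooth_poly_coord j : smooth_poly 1 (fun x => x 0 j).
Proof.
split; [exact: poly_fun_coord|by move=> x; exact: differentiable_coord|move=> i].
rewrite (_ : pder i _ = fun=> (i == j)%:R); first exact: poly_fun_cst.
apply/funext => x; rewrite /pder; apply/cvg_lim => //; apply: cvg_near_cst.
near=> h; rewrite /= !mxE addrK eqxx /GRing.scale/= mulrA mulVf ?mul1r //; last first.
  by near: h; exact: nbhs_dnbhs_neq.
by rewrite eq_sym.
Unshelve. all: by end_near. Qed.

Let smooth_polyX m p k : smooth_poly m p -> smooth_poly (k * m) (fun x => p x ^+ k).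
Proof.
move=> pP; elim: k => [|k IH]; first exact: smooth_poly_cst.
by under eq_fun do rewrite exprS; rewrite mulSn; exact: smooth_polyM.
Qed.

Let smooth_poly_mono (r : seq 'I_n) (e : 'I_n -> nat) :
  smooth_poly (\sum_(i <- r) e i) (fun x => \prod_(i <- r) x 0 i ^+ e i).
Proof.
elim: r => [|i r IH].
  rewrite big_nil (_ : (fun x : 'rV[R]_n => _) = fun=> 1); first exact: smooth_poly_cst.
  by apply/funext => x; rewrite big_nil.
rewrite big_cons (_ : (fun x : 'rV[R]_n => _) = fun x => x 0 i ^+ e i * \prod_(j <- r) x 0 j ^+ e j).
  by apply: smooth_polyM => //; have := smooth_polyX (e i) (smooth_poly_coord i); rewrite muln1.
by apply/funext => x; rewrite big_cons.
Qed.

Let smooth_polyW m1 m2 p : (m1 <= m2)%N -> smooth_poly m1 p -> smooth_poly m2 p.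
Proof.
move=> m12 [pP dp dpP]; split=> //; first exact: poly_funW pP.
by move=> i; exact: poly_funW (dpP i).
Qed.

Let poly_fun_smooth m p : poly_fun m p -> smooth_poly m p.
Proof.
move=> [c cP]; rewrite (funext cP).
elim: (index_enum _) => [|a r IH].
  under eq_fun do rewrite big_nil; apply: (@smooth_polyW 0) => //; exact: smooth_poly_cst.
have [am|/negPf am] := boolP (\sum_i a i <= m)%N; under eq_fun do rewrite big_cons am; last exact: IH.
apply: smooth_polyD => //; apply: (@smooth_polyW (0 + \sum_i a i)) => //.
by apply: smooth_polyM; [exact: smooth_poly_cst|exact: smooth_poly_mono].
Qed.

Lemma poly_fun_differentiable m p x : poly_fun m p -> differentiable p x.
Proof. by move=> /poly_fun_smooth[_ dp _]. Qed.

Lemma poly_fun_pder m p i : poly_fun m p -> poly_fun m (pder i p).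
Proof. by move=> /poly_fun_smooth[_ _]. Qed.

Lemma poly_fun1_affine p : poly_fun 1 p ->
  forall (I : finType) (l : I -> R) (y : I -> 'rV[R]_n),
  \sum_i l i = 1 -> p (\sum_i l i *: y i) = \sum_i l i * p (y i).
Proof.
move=> [c cP] I l y l1.
under [RHS]eq_bigr do rewrite cP mulr_sumr.
rewrite cP exchange_big; apply: eq_bigr => a a1 /=.
(* A multi-index of degree at most 1 is zero, where the weights sum to 1, or a unit vector, where
   the monomial is a coordinate. *)
have [a0|[j aj]] : (forall i, a i = 0%N :> nat) \/ exists j, a j != 0%N :> nat.
  case: (pselect (exists j, a j != 0%N :> nat)) => [|H]; [by right|left=> i].
  by apply/eqP; apply/negPn/negP => ai; apply: H; exists i.
  have pr (x : 'rV[R]_n) : \prod_i x 0 i ^+ a i = 1 by rewrite big1 // => i _; rewrite a0.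
  by under [RHS]eq_bigr do rewrite pr mulr1; rewrite pr mulr1 -mulr_suml l1 mul1r.
have [aj1 ai] : a j = 1%N :> nat /\ forall i, i != j -> a i = 0%N :> nat.
  move: a1; rewrite (bigD1 j) //=; case: (nat_of_ord (a j)) aj => // -[|//] _.
  rewrite addSn ltnS leqn0 sum_nat_eq0 => /forallP H; split=> // i ij.
  by apply/eqP; move: (H i); rewrite ij.
have pr (x : 'rV[R]_n) : \prod_i x 0 i ^+ a i = x 0 j.
  by rewrite (bigD1 j) //= aj1 expr1 big1 ?mulr1 // => i /ai ->.
under [RHS]eq_bigr do rewrite pr.
rewrite pr summxE mulr_sumr; apply: eq_bigr => i _.
by rewrite mxE mulrCA.
Qed.

End PolynomialFunctions.

(** * Splitting of space-time vectors into space and time *)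

Section SpaceTimeFacts.
Context {R : realType}.
Implicit Types (x y : 'rV[R]_3) (s t : R) (z : 'rV[R]_(3 + 1)).

Lemma xpart_st x t : xpart (st x t) = x. Proof. exact: row_mxKl. Qed.

Lemma tpart_st x t : tpart (st x t) = t.
Proof. by rewrite /tpart /st row_mxKr mxE eqxx. Qed.

Lemma st_parts z : st (xpart z) (tpart z) = z.
Proof. by rewrite /st /tpart -mx11_scalar hsubmxK. Qed.

Lemma stD x y s t : st (x + y) (s + t) = st x s + st y t.
Proof. by rewrite /st raddfD /= add_row_mx. Qed.

Lemma stZ (a : R) x t : st (a *: x) (a * t) = a *: st x t.
Proof. by rewrite /st scale_row_mx scale_scalar_mx. Qed.

Lemma stN x t : st (- x) (- t) = - st x t.
Proof. by rewrite -(scaleN1r x) -(mulN1r t) stZ scaleN1r. Qed.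

Lemma stB x y s t : st (x - y) (s - t) = st x s - st y t.
Proof. by rewrite stD stN. Qed.

Lemma st0 : st (0 : 'rV[R]_3) 0 = 0.
Proof. by have := stZ 0 0 0; rewrite scaler0 mulr0 scale0r. Qed.

Lemma xpartD z1 z2 : xpart (z1 + z2) = xpart z1 + xpart z2.
Proof. exact: linearD. Qed.

Lemma xpartB z1 z2 : xpart (z1 - z2) = xpart z1 - xpart z2.
Proof. exact: linearB. Qed.

Lemma xpartZ (a : R) z : xpart (a *: z) = a *: xpart z.
Proof. exact: linearZ. Qed.

Lemma tpartD z1 z2 : tpart (z1 + z2) = tpart z1 + tpart z2.
Proof. by rewrite /tpart linearD mxE. Qed.

Lemma tpartN z : tpart (- z) = - tpart z.
Proof. by rewrite /tpart linearN mxE. Qed.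

Lemma tpartB z1 z2 : tpart (z1 - z2) = tpart z1 - tpart z2.
Proof. by rewrite tpartD tpartN. Qed.

Lemma tpartZ (a : R) z : tpart (a *: z) = a * tpart z.
Proof. by rewrite /tpart linearZ mxE. Qed.

Lemma st_xdir x t (i : 'I_3) : st x t 0 (xdir i) = x 0 i.
Proof. by rewrite /st row_mxEl. Qed.

Lemma st_tdir x t : st x t 0 tdir = t.
Proof. by rewrite /st row_mxEr mxE eqxx. Qed.

Lemma dotp_st x y s t : dotp (st x s) (st y t) = dotp x y + s * t.
Proof.
rewrite /dotp big_split_ord /= big_ord1; congr (_ + _).
  by apply: eq_bigr => i _; rewrite !st_xdir.
by rewrite !st_tdir.
Qed.

Lemma enorm_st0 x : enorm (st x 0) = enorm x.
Proof. by congr Num.sqrt; rewrite dotp_st mulr0 addr0. Qed.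

Lemma enorm_xpart z : enorm (xpart z) <= enorm z.
Proof.
rewrite -ler_sqr ?nnegrE ?enorm_ge0 // !enorm_sqr -[in leRHS](st_parts z) dotp_st.
by rewrite lerDl -expr2 sqr_ge0.
Qed.

Lemma enorm_tpart z : `|tpart z| <= enorm z.
Proof. by rewrite -[tpart z](st_tdir (xpart z)) st_parts; exact: coord_le_enorm. Qed.

Lemma st_delta (i : 'I_3) : st (delta_mx 0 i) 0 = delta_mx 0 (xdir i) :> 'rV[R]_(3 + 1).
Proof.
apply/rowP => j; case: (split_ordP j) => k ->.
  by rewrite row_mxEl !mxE eqxx /= /xdir (inj_eq (@lshift_inj _ _)).
by rewrite row_mxEr !mxE mul0rn /xdir eq_rlshift.
Qed.

End SpaceTimeFacts.

(** * Barycentric coordinates of a tetrahedron *)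

Section Barycentric.
Context {R : realType}.
Implicit Types (v : 'I_4 -> 'rV[R]_3) (x y u : 'rV[R]_3).

Definition vertex_mx v : 'M[R]_(3 + 1) := \matrix_(i < 4) st (v i) 1.

Definition nondegenerate v := vertex_mx v \in unitmx.

(** The barycentric coordinates of x are (x, 1) times the inverse of the matrix with rows (v_i, 1).
    The first three entries of column j are the constant gradient of coordinate j, the last is its
    value at 0. *)
Definition bary_grad v (j : 'I_4) : 'rV[R]_3 := \row_i invmx (vertex_mx v) (xdir i) j.

Definition bary v (j : 'I_4) x : R := dotp (bary_grad v j) x + invmx (vertex_mx v) tdir j.

Lemma bary_mulmx v j x : bary v j x = (st x 1 *m invmx (vertex_mx v)) 0 j.
Proof.
rewrite mxE big_split_ord /= big_ord1 st_tdir mul1r; congr (_ + _).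
by apply: eq_bigr => i _; rewrite mxE st_xdir mulrC.
Qed.

Lemma baryD v j x u : bary v j (x + u) = bary v j x + dotp (bary_grad v j) u.
Proof. by rewrite /bary dotpDr addrAC. Qed.

Lemma baryB v j x y : bary v j x - bary v j y = dotp (bary_grad v j) (x - y).
Proof. by have := baryD v j y (x - y); rewrite (addrC y) subrK => ->; rewrite addrAC subrr add0r. Qed.

Lemma bary_st v (P : 'I_4 -> R) :
  (\row_j P j : 'rV_(3 + 1)) *m vertex_mx v = st (\sum_j P j *: v j) (\sum_j P j).
Proof.
rewrite mulmx_sum_row (eq_bigr (fun i => st (P i *: v i) (P i))) => [|i _].
  by elim/big_ind3 : _ => //; [rewrite st0|move=> ? ? ? ? ? ? -> ->; rewrite stD].
by rewrite rowK mxE -{3}[P i]mulr1 stZ.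
Qed.

Lemma bary_combine v x : nondegenerate v ->
  \sum_j bary v j x = 1 /\ \sum_j bary v j x *: v j = x.
Proof.
move=> vu; have : st x 1 = st (\sum_j bary v j x *: v j) (\sum_j bary v j x).
  rewrite -bary_st -{1}[st x 1](mulmxKV vu); congr (_ *m _).
  by apply/rowP => j; rewrite [RHS]mxE bary_mulmx.
by move=> e; have := congr1 xpart e; have := congr1 tpart e; rewrite !xpart_st !tpart_st.
Qed.

Lemma bary_unique v x (l : 'I_4 -> R) : nondegenerate v ->
  \sum_j l j = 1 -> x = \sum_j l j *: v j -> forall j, bary v j x = l j.
Proof.
move=> vu l1 xl j; rewrite bary_mulmx xl -{1}l1 -bary_st mulmxK // mxE //.
Qed.

Lemma bary_vertex v i j : nondegenerate v -> bary v j (v i) = (i == j)%:R.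
Proof.
move=> vu; apply: (bary_unique (l := fun j => (i == j)%:R)) => //.
  by rewrite (bigD1 i) //= eqxx big1 ?addr0 // => k; rewrite eq_sym => /negPf ->.
rewrite (bigD1 i) //= eqxx scale1r big1 ?addr0 // => k; rewrite eq_sym => /negPf ->.
by rewrite scale0r.
Qed.

Lemma bary_grad_sum v : nondegenerate v -> \sum_j bary_grad v j = 0.
Proof.
move=> vu; apply/eqP; rewrite -dotp_eq0; apply/eqP; set g := \sum_j _.
have e u : dotp g u = 0.
  have [s1 _] := bary_combine u vu; have [s0 _] := bary_combine 0 vu.
  have : \sum_j (bary v j u - bary v j 0) = 0 by rewrite sumrB s1 s0 subrr.
  rewrite (eq_bigr (fun j => dotp (bary_grad v j) u)) => [|j _]; last by rewrite baryB subr0.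
  by move=> <-; rewrite /g dotp_suml.
exact: e.
Qed.

Lemma bary_grad_combine v u : nondegenerate v -> \sum_j dotp (bary_grad v j) u *: v j = u.
Proof.
move=> vu; have [_ s1] := bary_combine u vu; have [_ s0] := bary_combine 0 vu.
transitivity (\sum_j bary v j u *: v j - \sum_j bary v j 0 *: v j); last by rewrite s1 s0 subr0.
rewrite -sumrB; apply: eq_bigr => j _.
by rewrite -scalerBl baryB subr0.
Qed.

Lemma poly_fun_bary v j : poly_fun 1 (bary v j).
Proof.
rewrite /bary /dotp; apply: poly_funD; last exact: poly_fun_cst.
by apply: poly_fun_sum => i _; apply: poly_funZ; exact: poly_fun_coord.
Qed.

(** A kernel vector (a, b) is an affine function a.y + b vanishing at all vertices, hence on the
    whole ball, hence identically. *)
Lemma nondegenerate_ball v x (r : R) : 0 < r ->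
  (forall y, enorm (y - x) <= r -> exists l : 'I_4 -> R, \sum_i l i = 1 /\ y = \sum_i l i *: v i) ->
  nondegenerate v.
Proof.
move=> r0 H; rewrite /nondegenerate -unitmx_tr -row_free_unit -kermx_eq0; apply/rowV0P => k.
move/sub_kermxP => kv; rewrite -(st_parts k); set a := xpart k; set b := tpart k.
have va i : dotp a (v i) + b = 0.
  have := congr1 (fun M : 'rV_4 => M 0 i) kv; rewrite !mxE => <-.
  rewrite -[LHS]/(_) -{1}[b]mulr1 -dotp_st st_parts; apply: eq_bigr => j _.
  by rewrite !mxE.
have vy y : enorm (y - x) <= r -> dotp a y + b = 0.
  move=> /H[l [l1 ->]]; transitivity (\sum_i l i * (dotp a (v i) + b)).
    rewrite -{1}[b]mul1r -l1 mulr_suml; under [RHS]eq_bigr do rewrite mulrDr.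
    rewrite big_split /= dotp_sumr; congr (_ + _).
    by apply: eq_bigr => i _; rewrite dotpZr.
  by rewrite big1 // => i _; rewrite va mulr0.
have x0 : dotp a x + b = 0 by apply: vy; rewrite subrr enorm0 ltW.
have a0 : a = 0.
  apply/eqP/negPn/negP => a0; have na : 0 < enorm a by rewrite enorm_gt0.
  have := vy (x + (r / enorm a) *: a); rewrite addrAC subrr add0r enormZ.
  rewrite ger0_norm ?divr_ge0 ?(ltW r0) ?(ltW na) // mulfVK ?gt_eqF // => /(_ (lexx _)).
  rewrite dotpDr dotpZr addrAC x0 add0r => /eqP; rewrite mulf_eq0 dotp_eq0 (negPf a0) orbF.
  by rewrite mulf_eq0 invr_eq0 !gt_eqF.
by move: x0; rewrite a0 dotp0l add0r => ->; rewrite st0.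
Qed.

(** The values at the centre and at distance [r] along the gradient g differ by r |g|, and both lie
    in [0, 1]. Shape regularity enters all later estimates in this form. *)
Lemma bary_grad_ball v j x (r : R) : 0 < r ->
  (forall y, enorm (y - x) <= r -> 0 <= bary v j y <= 1) ->
  enorm (bary_grad v j) <= r^-1.
Proof.
move=> r0 H; set g := bary_grad v j.
have [->|g0] := eqVneq g 0; first by rewrite enorm0 invr_ge0 ltW.
have ng : 0 < enorm g by rewrite enorm_gt0.
have nr : enorm ((r / enorm g) *: g) <= r.
  by rewrite enormZ ger0_norm ?divr_ge0 ?(ltW r0) ?(ltW ng) // mulfVK // gt_eqF.
have /H /andP[_] : enorm (x + (r / enorm g) *: g - x) <= r by rewrite addrAC subrr add0r.
have /H /andP[x0 _] : enorm (x - x) <= r by rewrite subrr enorm0 ltW.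
rewrite baryD dotpZr -/g -enorm_sqr expr2 mulrA mulfVK ?gt_eqF // => H1.
by rewrite -[leRHS]mul1r ler_pdivlMr // mulrC; lra.
Qed.

End Barycentric.

(** * Lagrange interpolation of degree k on a tetrahedron *)

Section Lagrange.
Context {R : realType} (k : nat).
Hypothesis k0 : (0 < k)%N.

(** Degree exactly [k] in four barycentric coordinates: the same index type serves for the nodes
    and, after dropping the last exponent, for the monomials of degree at most [k] in three
    variables. *)
Definition lag_index : finType := {a : {ffun 'I_4 -> 'I_k.+1} | (\sum_i (a i : nat) == k)%N}.
Implicit Types a b : lag_index.

Definition lag_exp a (i : 'I_4) : nat := val a i.

Lemma lag_exp_sum a : (\sum_i lag_exp a i = k)%N.
Proof. exact/eqP/(valP a). Qed.

Lemma lag_index_of (e : 'I_4 -> nat) : (\sum_i e i = k)%N -> exists a, forall i, lag_exp a i = e i.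
Proof.
move=> ek; have ei i : (e i < k.+1)%N by rewrite ltnS -ek (bigD1 i) //= leq_addr.
pose f := [ffun i => inord (e i)] : {ffun 'I_4 -> 'I_k.+1}.
have fk : (\sum_i (f i : nat) == k)%N.
  by apply/eqP; rewrite -[RHS]ek; apply: eq_bigr => i _; rewrite ffunE inordK.
by exists (Sub f fk : lag_index) => i; rewrite /lag_exp /= ffunE inordK.
Qed.

(** Nodal basis function as a product of linear factors in the barycentric coordinates. The factors
    of coordinate i vanish at the lattice values j / k below the value a_i / k at the node. *)
Definition lag_basis a (l : 'I_4 -> R) : R :=
  \prod_i \prod_(j < lag_exp a i) ((k%:R * l i - j%:R) / ((lag_exp a i)%:R - j%:R)).

Lemma lag_basis_node a b :
  lag_basis a (fun i => (lag_exp b i)%:R / k%:R) = (a == b)%:R.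
Proof.
have kR : k%:R != 0 :> R by rewrite pnatr_eq0 -lt0n.
have [<-|ab] := eqVneq a b.
  rewrite /lag_basis big1 // => i _; rewrite big1 // => j _.
  rewrite (mulrC k%:R) divfK // divff // subr_eq0 eqr_nat; apply/eqP => e.
  by have := ltn_ord j; rewrite -e ltnn.
(* Both multi-indices sum to [k], so if they differ, [b] is smaller than [a] in some entry, and one
   factor vanishes. *)
have [i ba] : exists i, (lag_exp b i < lag_exp a i)%N.
  apply/existsP; rewrite -[X in is_true X]negbK; apply/negP; rewrite negb_exists.
  move/forallP => H; have {}H i : (lag_exp a i <= lag_exp b i)%N by rewrite leqNgt H.
  have [_] := leqif_sum (P := xpredT) (fun i _ => leqif_eq (H i)).
  rewrite !lag_exp_sum eqxx => /esym/forallP ei.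
  by case/eqP: ab; apply/val_inj/ffunP => i; apply/val_inj; exact/eqP/(ei i).
rewrite /lag_basis (bigD1 i) //= (bigD1 (Ordinal ba)) //= (mulrC k%:R) divfK // subrr.
by rewrite !mul0r.
Qed.

Definition lag_node (v : 'I_4 -> 'rV[R]_3) a : 'rV[R]_3 :=
  \sum_i ((lag_exp a i)%:R / k%:R) *: v i.

Lemma bary_lag_node v a i : nondegenerate v -> bary v i (lag_node v a) = (lag_exp a i)%:R / k%:R.
Proof.
move=> vu; apply: (bary_unique (l := fun i => (lag_exp a i)%:R / k%:R)) => //; rewrite -mulr_suml -natr_sum lag_exp_sum.
by rewrite divff // pnatr_eq0 -lt0n.
Qed.

Lemma poly_fun_lag_basis v a : poly_fun k (fun x => lag_basis a (fun i => bary v i x)).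
Proof.
have prodP (I : Type) (r : seq I) (m : I -> nat) (F : I -> 'rV[R]_3 -> R) :
    (forall i, poly_fun (m i) (F i)) ->
    poly_fun (\sum_(i <- r) m i) (fun x => \prod_(i <- r) F i x).
  move=> FP; elim: r => [|i r IH].
    rewrite big_nil (_ : (fun x : 'rV[R]_3 => _) = fun=> 1); first exact: poly_fun_cst.
    by apply/funext => x; rewrite big_nil.
  rewrite big_cons (_ : (fun x : 'rV[R]_3 => _) = fun x => F i x * \prod_(j <- r) F j x).
    exact: poly_funM.
  by apply/funext => x; rewrite big_cons.
rewrite -{1}(lag_exp_sum a); apply: (@prodP _ _ _ _ _) => i.
have e1 : lag_exp a i = (\sum_(j < lag_exp a i) 1)%N by rewrite sum_nat_const card_ord muln1.
rewrite {1}e1; apply: (@prodP _ _ (fun=> 1%N) _ _) => j.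
rewrite (_ : (fun x : 'rV[R]_3 => _) =
   fun x => (((lag_exp a i)%:R - j%:R)^-1 * k%:R) * bary v i x +
            - (((lag_exp a i)%:R - j%:R)^-1 * j%:R)).
  apply: poly_funD; last exact: poly_fun_cst.
  by apply: poly_funZ; exact: poly_fun_bary.
by apply/funext => x; ring.
Qed.

Let mono a (x : 'rV[R]_3) : R := \prod_(i < 3) x 0 i ^+ lag_exp a (widen_ord (leqnSn 3) i).

Let mono_span p : poly_fun k p -> exists c : lag_index -> R, forall x, p x = \sum_a c a * mono a x.
Proof.
move=> [c cP]; have [d dP] : exists d : lag_index -> R,
    forall x : 'rV[R]_3, \sum_(a : {ffun 'I_3 -> 'I_k.+1} | (\sum_i a i <= k)%N) c a * \prod_i x 0 i ^+ a i
      = \sum_a d a * mono a x.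
  elim: (index_enum _) => [|e r [d IH]].
    by exists (fun=> 0) => x; rewrite big_nil big1 // => a _; rewrite mul0r.
  case: (boolP (\sum_i e i <= k)%N) => ek; last first.
    by exists d => x; rewrite big_cons (negPf ek).
  pose e' (i : 'I_4) := if unlift ord_max i is Some j then e j : nat else (k - \sum_i e i)%N.
  have e'w i : e' (widen_ord (leqnSn 3) i) = e i.
    by rewrite /e' (_ : widen_ord _ _ = lift ord_max i) ?liftK //; apply/val_inj; rewrite /= /bump leqNgt ltn_ord.
  have e'm : e' ord_max = (k - \sum_i e i)%N by rewrite /e' unlift_none.
  have e'k : (\sum_i e' i = k)%N.
    by rewrite big_ord_recr /= e'm (eq_bigr (fun i => e i : nat) (fun i _ => e'w i)) subnKC.
  have [a aP] := lag_index_of e'k.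
  exists (fun b => d b + (if b == a then c e else 0)) => x.
  rewrite big_cons ek IH; under [RHS]eq_bigr do rewrite mulrDl.
  rewrite big_split /= addrC; congr (_ + _).
  rewrite [RHS](bigD1 a) //= eqxx [X in _ = _ + X]big1 => [|b /negPf ->]; last by rewrite mul0r.
  by rewrite addr0; congr (_ * _); apply: eq_bigr => i _; rewrite aP e'w.
by exists d => x; rewrite cP dP.
Qed.

(** Basis functions expanded in monomials and evaluated at the nodes give [CM *m EM = 1]. Both
    matrices are square, so also [EM *m CM = 1], which says that interpolation reproduces every
    monomial. *)
Lemma lag_expand v p x : nondegenerate v -> poly_fun k p ->
  p x = \sum_a p (lag_node v a) * lag_basis a (fun i => bary v i x).
Proof.
move=> vu pP.
have /fin_all_exists[C CP] a := mono_span (poly_fun_lag_basis v a).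
pose N := #|lag_index|.
pose CM : 'M[R]_N := \matrix_(i, j) C (enum_val i) (enum_val j).
pose EM : 'M[R]_N := \matrix_(i, j) mono (enum_val i) (lag_node v (enum_val j)).
have sumE (F : lag_index -> R) : \sum_a F a = \sum_(i < N) F (enum_val i).
  by rewrite -(big_enum_val F); apply: eq_bigl => a; rewrite inE.
have CE : CM *m EM = 1%:M.
  apply/matrixP => i j; rewrite !mxE; under eq_bigr do rewrite !mxE.
  rewrite -(sumE (fun b => C (enum_val i) b * mono b (lag_node v (enum_val j)))) -CP.
  rewrite (_ : (fun i => _) = fun i => (lag_exp (enum_val j) i)%:R / k%:R).
    by rewrite lag_basis_node (inj_eq enum_val_inj).
  by apply/funext => l; rewrite bary_lag_node.
have /mulmx1C EC := CE.
have monoE b : mono b x = \sum_a mono b (lag_node v a) * lag_basis a (fun i => bary v i x).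
  under eq_bigr do rewrite CP mulr_sumr.
  rewrite exchange_big /= [RHS](bigD1 b) //= [X in _ = _ + X]big1 ?addr0 => [|c cb].
    under eq_bigr do rewrite mulrA; rewrite -mulr_suml -[LHS]mul1r; congr (_ * _).
    have := congr1 (fun M : 'M[R]_N => M (enum_rank b) (enum_rank b)) EC.
    rewrite !mxE eqxx mulr1n => <-; rewrite sumE; apply: eq_bigr => i _.
    by rewrite !mxE !enum_rankK.
  under eq_bigr do rewrite mulrA; rewrite -mulr_suml.
  have := congr1 (fun M : 'M[R]_N => M (enum_rank b) (enum_rank c)) EC.
  rewrite !mxE (inj_eq enum_rank_inj) eq_sym (negPf cb) => e.
  rewrite sumE (_ : \sum_(i < N) _ = 0) ?mul0r // -[RHS]e; apply: eq_bigr => i _.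
  by rewrite !mxE !enum_rankK.
have [c cP] := mono_span pP.
rewrite cP; under [RHS]eq_bigr do rewrite cP mulr_suml.
rewrite exchange_big; apply: eq_bigr => b _ /=; rewrite monoE mulr_sumr.
by apply: eq_bigr => a _; rewrite mulrA.
Qed.

End Lagrange.

(** * Mean value theorem and second-order Taylor bound *)

Section MeanValue.
Context {R : realType} {n : nat}.
Implicit Types (p : 'rV[R]_n -> R) (x w : 'rV[R]_n).

Lemma derive_along_line p x w s : differentiable p (x + s *: w) ->
  is_derive s 1 (fun r : R => p (x + r *: w)) (dotp (grad p (x + s *: w)) w).
Proof.
move=> dp; have dl : differentiable (fun r : R => x + r *: w) s.
  apply: differentiableD; first exact: differentiable_cst.
  exact: differentiableZl.
apply: DeriveDef; first by apply/derivable1_diffP; exact: (differentiable_comp dl dp).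
rewrite -derive_grad // /derive; set f1 := (fun h : R => h^-1 *: (((fun r : R => _) \o shift s) (h *: 1) - _)); set f2 := (fun h : R => h^-1 *: ((p \o shift (x + s *: w)) (h *: w) - _)).
suff -> : f1 = f2 by [].
apply/funext => h; rewrite /f1 /f2 /=; congr (_ *: (p _ - _)).
by rewrite (_ : h *: (1 : R) = h) ?scalerDl 1?addrCA //; exact: mulr1.
Qed.

Lemma mean_value_line p x w : (forall y, differentiable p y) ->
  exists2 th, 0 < th < 1 & p (x + w) - p x = dotp (grad p (x + th *: w)) w.
Proof.
move=> dp; have D (s : R) : is_derive s 1 (fun r : R => p (x + r *: w)) (dotp (grad p (x + s *: w)) w).
  exact: derive_along_line.
have cont : continuous (fun r : R => p (x + r *: w)).
  move=> s; apply: differentiable_continuous; apply/derivable1_diffP.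
  exact: (@ex_derive _ _ _ _ _ _ _ (D s)).
have [th] := MVT (@ltr01 R) (fun s _ => D s) (continuous_subspaceT cont).
rewrite in_itv /= => ht; rewrite scale1r scale0r addr0 subr0 mulr1 => e.
by exists th.
Qed.

(** The mean value theorem is used for [p] and for each component of its gradient. The factors [n]
    and [n * n] come from bounding Euclidean norms by sums of coordinates. *)
Lemma taylor2_bound p x w (b : R) : (forall y, differentiable p y) ->
  (forall j y, differentiable (pder j p) y) -> 0 <= b ->
  (forall i j s, 0 <= s <= 1 -> `|pder i (pder j p) (x + s *: w)| <= b) ->
  (forall j, `|pder j p (x + w) - pder j p x| <= b * enorm w *+ n) /\
  `|p (x + w) - p x - dotp (grad p x) w| <= b * enorm w ^+ 2 *+ (n * n).
Proof.
move=> dp d2p b0 bP.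
have gl s j : 0 <= s <= 1 -> `|pder j p (x + s *: w) - pder j p x| <= b * enorm w *+ n.
  move=> /andP[s0 s1]; have [th /andP[th0 th1] ->] := mean_value_line x (s *: w) (d2p j).
  rewrite dotpZr /dotp normrM.
  apply: (@le_trans _ _ (\sum_(i < n) b * enorm w)); last by rewrite sumr_const card_ord.
  apply: le_trans (ler_wpM2l (normr_ge0 _) (ler_norm_sum _ _ _)) _; rewrite mulr_sumr.
  apply: ler_sum => i _; rewrite !mxE scalerA normrM (ger0_norm s0).
  rewrite -[leRHS]mul1r ler_pM ?mulr_ge0 // ler_pM ?coord_le_enorm //.
  by apply: bP; apply/andP; split; [rewrite mulr_ge0 // ltW|rewrite mulr_ile1 // ltW].
split; first by move=> j; have := gl 1 j; rewrite scale1r; apply; rewrite ler01 lexx.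
have [th /andP[th0 th1] ->] := mean_value_line x w dp.
rewrite -dotpBl; apply: le_trans (cauchy_schwarz _ _) _.
rewrite expr2 mulrA -mulrnAl ler_wpM2r ?enorm_ge0 // mulrnA.
by apply: enorm_le_bound => j; rewrite !mxE gl // !ltW.
Qed.

End MeanValue.

(** * Bounds of a polynomial by its values at the Lagrange nodes *)

Section LagrangeBounds.
Context {R : realType} (k : nat).
Hypothesis k0 : (0 < k)%N.

Let lipschitz_on_box (B : R) (F : ('I_4 -> R) -> R) := exists2 M : R, 0 < M &
  forall l l' : 'I_4 -> R, (forall i, `|l i| <= B) -> (forall i, `|l' i| <= B) ->
  `|F l| <= M /\ `|F l - F l'| <= M * \sum_i `|l i - l' i|.

Let lipschitz_prod (B : R) (I : Type) (r : seq I) (F : I -> ('I_4 -> R) -> R) :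
  (forall i, lipschitz_on_box B (F i)) -> lipschitz_on_box B (fun l => \prod_(i <- r) F i l).
Proof.
move=> FP; elim: r => [|i r [M M0 MP]].
  exists 1 => // l l' _ _; rewrite !big_nil subrr normr0 normr1 mul1r.
  by split=> //; rewrite sumr_ge0.
have [N N0 NP] := FP i; exists (2 * M * N + M * N); first by rewrite addr_gt0 ?mulr_gt0.
move=> l l' lB lB'; rewrite !big_cons; have [p1 p2] := MP l l' lB lB'.
have [q1 q2] := NP l l' lB lB'; have [q3 _] := NP l' l lB' lB.
have MN : 0 <= M * N by rewrite mulr_ge0 ?ltW.
split.
  rewrite normrM; apply: (@le_trans _ _ (N * M)); first exact: ler_pM.
  by rewrite mulrC; lra.
set S := \sum_i _ in p2 q2 *; have S0 : 0 <= S by rewrite sumr_ge0.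
set P := \prod_(j <- r) F j l in p1 p2 *; set P' := \prod_(j <- r) F j l' in p2 *.
have -> : F i l * P - F i l' * P' = (F i l - F i l') * P + F i l' * (P - P') by ring.
apply: (le_trans (ler_normD _ _)); rewrite !normrM.
have h1 : `|F i l - F i l'| * `|P| <= (N * S) * M by apply: ler_pM.
have h2 : `|F i l'| * `|P - P'| <= N * (M * S) by apply: ler_pM.
have : 0 <= M * N * S by rewrite mulr_ge0.
lra.
Qed.

Let lag_basis_lipschitz (B : R) : 0 <= B -> exists2 M : R, 0 < M &
  forall (a : lag_index k) (l l' : 'I_4 -> R), (forall i, `|l i| <= B) -> (forall i, `|l' i| <= B) ->
  `|lag_basis a l| <= M /\ `|lag_basis a l - lag_basis a l'| <= M * \sum_i `|l i - l' i|.
Proof.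
move=> B0; have H a : lipschitz_on_box B (@lag_basis R k a).
  apply: lipschitz_prod => i; apply: lipschitz_prod => j.
  set d := (lag_exp a i)%:R - j%:R; pose M : R := (k%:R * B + j%:R + k%:R) * `|d^-1| + 1.
  have M0 : 0 <= k%:R * B + j%:R :> R by rewrite addr_ge0 // mulr_ge0.
  exists M; first by rewrite ltr_wpDl // mulr_ge0 // addr_ge0.
  move=> l l' lB lB'; split.
    rewrite normrM /M; apply: (@le_trans _ _ ((k%:R * B + j%:R) * `|d^-1|)); last first.
      by rewrite -[leLHS]addr0 lerD // ler_wpM2r // lerDl.
    rewrite ler_wpM2r //; apply: (le_trans (ler_normB _ _)); rewrite normrM !normr_nat.
    by rewrite lerD2r ler_wpM2l.
  have -> : (k%:R * l i - j%:R) / d - (k%:R * l' i - j%:R) / d = k%:R * d^-1 * (l i - l' i) by ring.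
  rewrite normrM ler_pM //; last by rewrite (bigD1 i) //= lerDl sumr_ge0.
  rewrite normrM normr_nat /M -[leLHS]addr0 lerD // ler_wpM2r //; lra.
have /fin_all_exists[M MP] : forall a : lag_index k, exists M, 0 < M /\ forall l l' : 'I_4 -> R,
    (forall i, `|l i| <= B) -> (forall i, `|l' i| <= B) ->
    `|lag_basis a l| <= M /\ `|lag_basis a l - lag_basis a l'| <= M * \sum_i `|l i - l' i|.
  by move=> a; have [M ? ?] := H a; exists M.
exists (1 + \sum_a M a).
  by rewrite ltr_pwDl // sumr_ge0 // => a _; apply/ltW; case: (MP a).
have Ma a : M a <= 1 + \sum_a M a.
  rewrite (bigD1 a) //= addrCA lerDl addr_ge0 //.
  by rewrite sumr_ge0 // => b _; apply/ltW; case: (MP b).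
move=> a l l' lB lB'; have [_ /(_ l l' lB lB')[h1 h2]] := MP a.
split; first exact: le_trans h1 (Ma a).
by apply: (le_trans h2); rewrite ler_wpM2r // sumr_ge0.
Qed.

(* The box [`|bary v i x| <= B] contains a neighbourhood of the tetrahedron, so
   that polynomials are controlled slightly outside of it as well. *)
Lemma lagrange_bound (B : R) : 0 <= B -> exists2 M : R, 0 < M &
  forall v (r : R) p (b : R), nondegenerate v -> 0 < r ->
  (forall j, enorm (bary_grad v j) <= r^-1) -> poly_fun k p ->
  (forall a : lag_index k, `|p (lag_node v a)| <= b) -> forall x, (forall i, `|bary v i x| <= B) ->
  `|p x| <= M * b /\
  forall y, (forall i, `|bary v i y| <= B) -> `|p x - p y| <= M * b / r * enorm (x - y).
Proof.
move=> B0; have [M M0 MP] := lag_basis_lipschitz B0.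
(* [N] counts the nodes, [M] bounds the basis functions and their Lipschitz constants, and 4 counts
   the barycentric coordinates. [N + 1] makes positivity immediate. *)
pose N : R := #|lag_index k|%:R; exists ((N + 1) * (M * 4)).
  by rewrite !mulr_gt0 // ltr_wpDl // ler0n.
move=> v r p b vu r0 gr pP pb x xB.
have [a0 _] : exists a : lag_index k, forall i, lag_exp a i = if i == ord0 then k else 0%N.
  by apply: lag_index_of; rewrite -big_mkcond big_pred1_eq.
have b0 : 0 <= b := le_trans (normr_ge0 _) (pb a0).
have Mb : 0 <= M * b by rewrite mulr_ge0 // ltW.
have N0 : 0 <= N by [].
have sumN (c : R) : \sum_(a : lag_index k) c = N * c by rewrite sumr_const mulr_natl.
split.
  rewrite (lag_expand k0 x vu pP); apply: (le_trans (ler_norm_sum _ _ _)).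
  apply: (@le_trans _ _ (\sum_(a : lag_index k) (b * M))).
    apply: ler_sum => a _; rewrite normrM ler_pM //; by case: (MP a _ _ xB xB).
  rewrite sumN -mulrA mulrDl mul1r (mulrC b) -!mulrA; have := mulr_ge0 N0 Mb; lra.
move=> y yB; rewrite (lag_expand k0 x vu pP) (lag_expand k0 y vu pP) -sumrB.
apply: (le_trans (ler_norm_sum _ _ _)).
have lipg i : `|bary v i x - bary v i y| <= enorm (x - y) / r.
  rewrite baryB; apply: le_trans (cauchy_schwarz _ _) _.
  by rewrite mulrC ler_wpM2l ?enorm_ge0.
apply: (@le_trans _ _ (\sum_(a : lag_index k) (b * (M * (4 * (enorm (x - y) / r)))))).
  apply: ler_sum => a _; rewrite -mulrBr normrM ler_pM //.
  have [_ h] := MP a _ _ xB yB; apply: (le_trans h); rewrite ler_wpM2l ?(ltW M0) //.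
  apply: (le_trans (ler_sum _ (fun i _ => lipg i))).
  by rewrite sumr_const card_ord [leRHS]mulr_natl.
rewrite sumN (_ : b * _ = M * b * 4 * (enorm (x - y) / r)); last by ring.
rewrite (_ : (N + 1) * _ * b / r * enorm (x - y) =
  N * (M * b * 4 * (enorm (x - y) / r)) + M * b * 4 * (enorm (x - y) / r)); last by ring.
by rewrite lerDl !mulr_ge0 ?enorm_ge0 ?invr_ge0 // ltW.
Qed.

End LagrangeBounds.

(** * Null sets and non-null sets of two-dimensional Hausdorff measure *)

Section HausdorffNull.
Context {R : realType} {n : nat}.

Lemma hausdorff_null_sub d (A B : set 'rV[R]_n) : A `<=` B -> hausdorff_null d B -> hausdorff_null d A.
Proof.
move=> AB H e /H[C [r [BC r0 rC sr]]]; exists C, r; split => //.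
exact: subset_trans AB BC.
Qed.

(** M curves cut into N0 arcs each are covered by sets of diameter L / N0, whose squares sum to M
    L^2 / N0. *)
Lemma hausdorff_null_curves (I : finType) (f : I -> R -> 'rV[R]_n) (L : R) :
  (forall i s t, 0 <= s <= 1 -> 0 <= t <= 1 -> enorm (f i s - f i t) <= L * `|s - t|) ->
  hausdorff_null 2 [set y | exists i s, 0 <= s <= 1 /\ y = f i s].
Proof.
move=> fL e e0; pose M := #|I|.
have L0 : 0 <= L \/ M = 0%N.
  case: (posnP M) => [->|/card_gt0P[i _]]; [by right|left].
  have := fL i 0 1; rewrite !lexx ler01 /= => /(_ isT isT).
  by rewrite sub0r normrN1 mulr1; apply: le_trans; exact: enorm_ge0.
have {L0} [L' [L'0 fL']] : exists L', 0 <= L' /\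
    forall i s t, 0 <= s <= 1 -> 0 <= t <= 1 -> enorm (f i s - f i t) <= L' * `|s - t|.
  case: L0 => [L0|M0]; first by exists L.
  by exists 0; split=> // i; have := card0_eq M0 i; rewrite inE.
have [N0 N0P] : exists N : nat, M%:R * L' ^+ 2 / e < N%:R.
  by exists (Num.truncn (M%:R * L' ^+ 2 / e)).+1; rewrite truncnS_gt.
have q0 : 0 <= M%:R * L' ^+ 2 / e by rewrite !mulr_ge0 ?sqr_ge0 // invr_ge0 ltW.
have N00 : (0 < N0)%N by rewrite -(ltr0n R); exact: le_lt_trans q0 N0P.
have N0R : 0 < N0%:R :> R by rewrite ltr0n.
pose r (k : nat) : R := if (k < M * N0)%N then L' / N0%:R else 0.
pose B (k : nat) : set 'rV[R]_n := [set y | exists i s,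
  [/\ enum_rank i = (k %/ N0)%N :> nat, (k %% N0)%:R / N0%:R <= s <= (k %% N0).+1%:R / N0%:R,
   0 <= s <= 1, (k < M * N0)%N & y = f i s]].
have r0 k : 0 <= r k by rewrite /r; case: ifP => // _; rewrite divr_ge0.
exists B, r; split => //.
- move=> y /= [i [s [/andP[s0 s1] ->]]].
  (* The minimum puts the end point s = 1 into the last arc. *)
  pose j := minn (Num.truncn (s * N0%:R)) N0.-1.
  have jN : (j < N0)%N by rewrite (leq_ltn_trans (geq_minr _ _)) // prednK.
  have sN : 0 <= s * N0%:R by rewrite mulr_ge0.
  have /andP[t1 t2] := truncn_itv sN.
  have kM : ((enum_rank i) * N0 + j < M * N0)%N.
    apply: (@leq_trans ((enum_rank i).+1 * N0)); last by rewrite leq_mul2r ltn_ord orbT.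
    by rewrite mulSn addnC ltn_add2r.
  exists ((enum_rank i) * N0 + j)%N => //=; exists i, s.
  rewrite divnMDl // divn_small // addn0 modnMDl modn_small //; split => //; last by rewrite s0.
  apply/andP; split.
    by rewrite ler_pdivrMr //; apply: le_trans t1; rewrite ler_nat geq_minl.
  rewrite ler_pdivlMr // /j; case: (leqP (Num.truncn (s * N0%:R)) N0.-1) => _; first exact: ltW.
  by rewrite prednK // -[leRHS]mul1r ler_wpM2r // ltW.
- move=> k x y [i [s [ik /andP[s1 s2] s01 kM ->]]] [i' [s' [ik' /andP[s1' s2'] s01' _ ->]]].
  have <- : i = i' by apply: enum_rank_inj; apply: val_inj; rewrite /= ik ik'.
  apply: (le_trans (fL' _ _ _ s01 s01')); rewrite /r kM ler_wpM2l //.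
  have : (k %% N0).+1%:R / N0%:R = (k %% N0)%:R / N0%:R + N0%:R^-1 :> R.
    by rewrite -natr1 mulrDl mul1r.
  by move=> E; rewrite E in s2 s2'; rewrite ler_norml; apply/andP; split; lra.
- apply: lime_le; first by apply: is_cvg_nneseries => k _ _; rewrite lee_fin exprn_ge0.
  apply: nearW => m; rewrite sumEFin lee_fin.
  have bnd : \sum_(0 <= k < m) r k ^+ 2 <= (M * N0)%:R * (L' / N0%:R) ^+ 2.
    rewrite (bigID (fun k => (k < M * N0)%N)) /= [X in _ + X]big1 ?addr0 => [|k /negPf kM]; last first.
      by rewrite /r kM expr0n.
    rewrite (eq_bigr (fun=> (L' / N0%:R) ^+ 2)) => [|k kM]; last by rewrite /r kM.
    rewrite big_const_seq iter_addr addr0 -[leLHS]mulr_natl.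
    rewrite ler_wpM2r ?sqr_ge0 // ler_nat.
    apply: (@leq_trans (count (fun k => k < M * N0)%N (iota 0 (M * N0 + m)))).
      rewrite /index_iota subn0 addnC iotaD count_cat leq_addr //.
    rewrite iotaD count_cat add0n [X in (_ + X)%N](_ : _ = 0%N) ?addn0.
      by rewrite -[X in (_ <= X)%N](size_iota 0 (M * N0)) count_size.
    apply/eqP; rewrite -leqn0 leqNgt -has_count; apply/hasPn => k.
    by rewrite mem_iota -leqNgt => /andP[].
  apply: (le_trans bnd); rewrite natrM expr_div_n expr2 invfM.
  have -> : M%:R * N0%:R * (L' ^+ 2 * (N0%:R^-1 / N0%:R)) = M%:R * L' ^+ 2 / N0%:R.
    by field; rewrite gt_eqF.
  by rewrite ler_pdivrMr // [leRHS]mulrC -ler_pdivrMr // ltW.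
Qed.

(* The two dual coordinates of the triangle are Lipschitz, so a cover of it by
   sets of diameter [r k] yields a cover of a square by squares of side of
   order [r k], whose Lebesgue measures add up to at least that of the square. *)
Lemma triangle_not_null (S : set 'rV[R]_n) (a u w p q : 'rV[R]_n) :
  dotp p u = 1 -> dotp p w = 0 -> dotp q u = 0 -> dotp q w = 1 ->
  (forall s t, 0 <= s -> 0 <= t -> s + t <= 1 -> S (a + s *: u + t *: w)) ->
  ~ hausdorff_null 2 S.
Proof.
move=> pu pw qu qw SP nullS; pose C : R := enorm p + enorm q + 1.
have C0 : 0 < C by rewrite ltr_wpDl // addr_ge0 ?enorm_ge0.
have pC : enorm p <= C by rewrite /C; have := enorm_ge0 q; lra.
have qC : enorm q <= C by rewrite /C; have := enorm_ge0 p; lra.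
(* The covering squares have side 2 C r_k, hence total area at most (2 C)^2 e = 1/8, less than the
   area 1/4 of the square of side 1/2 in the parameter triangle. *)
pose e : R := (2 * C) ^- 2 / 8.
have e0 : 0 < e by rewrite divr_gt0 // invr_gt0 exprn_gt0 // mulr_gt0.
have [B [r [SB r0 rB sr]]] := nullS e e0.
pose pt (s t : R) := a + s *: u + t *: w.
have ptp s t s' t' : dotp p (pt s t - pt s' t') = s - s'.
  by rewrite /pt !dotpE pu pw; lra.
have ptq s t s' t' : dotp q (pt s t - pt s' t') = t - t'.
  by rewrite /pt !dotpE qu qw; lra.
(* The parameters of some point of [B k] in the plane of the triangle serve as centre; if there is
   none, any centre will do. *)
have /choice[c cP] (k : nat) : exists c : R * R, forall s t, 0 <= s <= 2^-1 -> 0 <= t <= 2^-1 ->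
    B k (pt s t) -> `|s - c.1| <= C * r k /\ `|t - c.2| <= C * r k.
  have [[[s t] st]|H] := pselect (exists c : R * R, B k (pt c.1 c.2)).
    exists (s, t) => s' t' _ _ st'; split.
      rewrite /= -(ptp s' t' s t); apply: le_trans (cauchy_schwarz _ _) _.
      by rewrite ler_pM ?enorm_ge0 // (rB k).
    rewrite /= -(ptq s' t' s t); apply: le_trans (cauchy_schwarz _ _) _.
    by rewrite ler_pM ?enorm_ge0 // (rB k).
  by exists (0, 0) => s t _ _ st; exfalso; apply: H; exists (s, t).
pose T := measurableTypeR R; pose J (x y : R) : set T := [set` `[x, y]].
pose E (k : nat) : set (T * T) := J ((c k).1 - C * r k) ((c k).1 + C * r k) `*`
   J ((c k).2 - C * r k) ((c k).2 + C * r k).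
pose Q : set (T * T) := J 0 2^-1 `*` J 0 2^-1.
have mJ x y : measurable (J x y) by exact: measurable_itv.
have lJ x d : 0 <= d -> lebesgue_measure (J (x - d) (x + d)) = (2 * d)%:E.
  move=> d0; rewrite lebesgue_measure_itv /= lte_fin.
  have [dd|] := ltP; first by rewrite -EFinB; congr _%:E; lra.
  by move=> dd; congr _%:E; lra.
have QE : Q `<=` \bigcup_k E k.
  move=> [s t] [/=]; rewrite /J /= !in_itv /= => /andP[s0 s1] /andP[t0 t1].
  have [k _ Bk] : (\bigcup_k B k) (pt s t) by apply: SB; apply: SP => //; lra.
  exists k => //; have [] := cP k s t _ _ Bk; rewrite ?s0 ?t0 //.
  rewrite !ler_norml => /andP[h1 h2] /andP[h3 h4].
  by split; rewrite /J /= in_itv /=; apply/andP; split; lra.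
pose mu2 : {measure set (T * T)%type -> \bar R} := (@lebesgue_measure R \x @lebesgue_measure R)%E.
have mu2E x y x' y' : mu2 (J x y `*` J x' y') = (lebesgue_measure (J x y) * lebesgue_measure (J x' y'))%E.
  by apply: product_measure1E.
have mu := measure_sigma_subadditive mu2
   (fun k => measurableX (mJ _ _) (mJ _ _)) (measurableX (mJ 0 2^-1) (mJ 0 2^-1)) QE.
move: mu; rewrite mu2E lebesgue_measure_itv /= lte_fin invr_gt0 ltr0Sn.
rewrite oppr0 adde0 -EFinM.
rewrite (_ : \sum_(0 <= k <oo) _ = ((2 * C) ^+ 2)%:E * \sum_(0 <= k <oo) (r k ^+ 2)%:E)%E; last first.
  rewrite -nneseriesZl => [|k _]; last by rewrite lee_fin sqr_ge0.
  apply: eq_eseriesr => k _; rewrite mu2E !lJ ?mulr_ge0 ?(ltW C0) //.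
  by rewrite -!EFinM; congr _%:E; ring.
apply/negP; rewrite -ltNge.
apply: (@le_lt_trans _ _ (((2 * C) ^+ 2)%:E * e%:E)%E).
  by rewrite lee_wpmul2l // lee_fin sqr_ge0.
rewrite -EFinM lte_fin /e mulrA mulfV ?gt_eqF ?exprn_gt0 ?mulr_gt0 //; lra.
Qed.

End HausdorffNull.
(** * The mesh and the piecewise linear interpolant *)

Section Tetrahedra.
Context {R : realType} (D : discretization R) (Om : set 'rV[R]_3) (c : R).
Hypothesis mesh : triangulation D Om c.
Implicit Types (K L : 'I_(ntet D)) (x y : 'rV[R]_3).

Lemma tet_nondegenerate K : nondegenerate (vert K).
Proof.
have [x [r [r0 H _]]] := tri_regular mesh K.
apply: (nondegenerate_ball r0 (x := x)) => y /H [l [_ _ l1 yl]].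
by exists l.
Qed.
Local Notation nd := (tet_nondegenerate _).

Lemma tetP K x : tet K x <-> forall j, 0 <= bary (vert K) j x.
Proof.
split=> [[l [l0 _ l1 xl]] j|H].
  by rewrite (bary_unique (tet_nondegenerate K) l1 xl).
have [s1 s2] := bary_combine x (tet_nondegenerate K).
by exists (fun j => bary (vert K) j x); split.
Qed.

Lemma bary_le1 K x j : tet K x -> bary (vert K) j x <= 1.
Proof.
move=> /tetP H; have [<- _] := bary_combine x (tet_nondegenerate K).
by rewrite (bigD1 j) //= lerDl sumr_ge0.
Qed.

Lemma bary_norm_le1 K x j : tet K x -> `|bary (vert K) j x| <= 1.
Proof. by move=> Kx; rewrite ger0_norm ?bary_le1 //; move/tetP: Kx. Qed.

Lemma vert_tet K i : tet K (vert K i).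
Proof. by apply/tetP => j; rewrite (bary_vertex _ _ nd). Qed.

Lemma tet_convex K x y (s : R) : 0 <= s <= 1 -> tet K x -> tet K y -> tet K (x + s *: (y - x)).
Proof.
move=> /andP[s0 s1] /tetP Kx /tetP Ky; apply/tetP => j.
rewrite baryD dotpZr -baryB (_ : _ + _ = (1 - s) * bary (vert K) j x + s * bary (vert K) j y); last by ring.
by rewrite addr_ge0 // mulr_ge0 // subr_ge0.
Qed.

Lemma tet_diam K x y : tet K x -> tet K y -> enorm (x - y) <= diam (tet K).
Proof.
move=> Kx Ky; apply: ub_le_sup; last by exists x => //; exists y.
exists (\sum_i enorm (vert K i) + \sum_i enorm (vert K i)) => _ [a Ka [b Kb <-]].
have bd a' : tet K a' -> enorm a' <= \sum_i enorm (vert K i).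
  move=> Ka'; have [_ <-] := bary_combine a' (tet_nondegenerate K).
  apply: (le_trans (enorm_sum _ _ _)); apply: ler_sum => i _.
  by rewrite enormZ ler_piMl ?enorm_ge0 // bary_norm_le1.
by apply: (le_trans (enormB _ _)); apply: lerD; apply: bd.
Qed.

Lemma diam_ge0 K : 0 <= diam (tet K).
Proof. by apply: le_trans (tet_diam (vert_tet K ord0) (vert_tet K ord0)); exact: enorm_ge0. Qed.

Lemma diam_le_mesh K : diam (tet K) <= mesh_size D.
Proof. exact: (le_bigmax _ (fun K => diam (tet K))). Qed.

Lemma tet_radius K : exists r, [/\ 0 < r, forall j, enorm (bary_grad (vert K) j) <= r^-1
  & diam (tet K) <= c * r].
Proof.
have [x [r [r0 H dr]]] := tri_regular mesh K; exists r; split=> // j.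
apply: (bary_grad_ball r0 (x := x)) => y /H Ky; rewrite bary_le1 // andbT; by move/tetP: Ky.
Qed.

Lemma bary_interior K x : (forall j, 0 < bary (vert K) j x) -> (tet K)^° x.
Proof.
move=> H; apply/enorm_ball_nbhs; have [r [r0 gr _]] := tet_radius K.
exists (\big[Num.min/1]_j (bary (vert K) j x * r)).
  by apply: lt_bigmin => // j _; rewrite mulr_gt0.
move=> y yx; apply/tetP => j; have := baryB (vert K) j y x.
have /ler_normlP[+ _] := cauchy_schwarz (bary_grad (vert K) j) (y - x).
suff : enorm (bary_grad (vert K) j) * enorm (y - x) <= bary (vert K) j x by lra.
have {}yx : enorm (y - x) <= bary (vert K) j x * r.
  by apply/ltW/(lt_le_trans yx); exact: bigmin_le.
apply: (le_trans (ler_pM (enorm_ge0 _) (enorm_ge0 _) (gr j) yx)).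
by rewrite mulrC mulfK // gt_eqF.
Qed.

Definition centroid K : 'rV[R]_3 := \sum_j (4%:R^-1 : R) *: vert K j.

Lemma bary_centroid K j : bary (vert K) j (centroid K) = 4%:R^-1.
Proof.
apply: (bary_unique (l := fun=> 4%:R^-1) nd) => //.
by rewrite sumr_const card_ord -[LHS]mulr_natl mulfV // pnatr_eq0.
Qed.

Lemma towards_centroid_interior K x (s : R) : tet K x -> 0 < s <= 1 ->
  (tet K)^° (x + s *: (centroid K - x)).
Proof.
move=> /tetP Kx /andP[s0 s1]; apply: bary_interior => j.
rewrite baryD dotpZr -baryB bary_centroid.
rewrite (_ : _ + _ = (1 - s) * bary (vert K) j x + s * 4%:R^-1); last by ring.
by rewrite ltr_wpDl ?mulr_gt0 ?invr_gt0 // mulr_ge0 // subr_ge0.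
Qed.

(** From a point of [L] in the interior of [K], a short step towards the centroid of [L] reaches a
    point interior to both, which a triangulation excludes. *)
Lemma interior_tet_disjoint K L x : K != L -> (tet K)^° x -> ~ tet L x.
Proof.
move=> KL /enorm_ball_nbhs[d d0 dK] Lx.
have [_ H] := tri_conforming mesh KL.
pose u := centroid L - x; pose s := Num.min 1 (d / (enorm u + 1) / 2).
have u1 : 0 < enorm u + 1 by rewrite ltr_wpDl ?enorm_ge0.
have s0 : 0 < s by rewrite lt_min ltr01 !divr_gt0.
have s1 : s <= 1 by rewrite ge_min lexx.
have sd : enorm (s *: u) < d.
  rewrite enormZ gtr0_norm //; apply: (@le_lt_trans _ _ (d / 2)); last by lra.
  have s2 : s <= d / (enorm u + 1) / 2 by rewrite ge_min lexx orbT.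
  apply: (le_trans (ler_wpM2r (enorm_ge0 u) s2)).
  have -> : d / (enorm u + 1) / 2 * enorm u = d / 2 * (enorm u / (enorm u + 1)) by ring.
  by rewrite ler_piMr ?divr_ge0 ?(ltW d0) // ler_pdivrMr // mul1r lerDl.
have : ((tet K)^° `&` (tet L)^°) (x + s *: u).
  split; last by apply: towards_centroid_interior => //; rewrite s0.
  apply/enorm_ball_nbhs; exists (d - enorm (s *: u)); first by rewrite subr_gt0.
  move=> y yx; apply: dK; apply: le_lt_trans (enorm_dist _ (x + s *: u) _) _.
  by rewrite [x + _ - x]addrAC subrr add0r -ltrBrDr.
by rewrite H.
Qed.

Lemma common_vertex K L x j : K != L -> tet K x -> tet L x -> 0 < bary (vert K) j x ->
  exists i, vert L i = vert K j.
Proof.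
move=> KL Kx Lx xj; have [H _] := tri_conforming mesh KL.
have : (tet K `&` tet L) x by [].
rewrite H => -[l [_ lc l1 xl]]; move: xj; rewrite (bary_unique (tet_nondegenerate K) l1 xl) => lj.
case: (boolP (common_vert K L j)) => [/existsP[i /eqP]|/lc l0]; first by exists i.
by move: lj; rewrite l0 ltxx.
Qed.

Lemma tet_subset_closure K x : tet K x -> closure Om x.
Proof. by move=> Kx; rewrite -(tri_cover mesh); exists K. Qed.

(** Coordinate i changes by 1 along the edge, with slope at most 1 / r. *)
Lemma vertex_dist K i j (r : R) : 0 < r -> (forall j, enorm (bary_grad (vert K) j) <= r^-1) ->
  vert K i != vert K j -> r <= enorm (vert K i - vert K j).
Proof.
move=> r0 gr vij; have ij : i != j by apply: contraNneq vij => ->.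
have : bary (vert K) i (vert K i) - bary (vert K) i (vert K j) = 1.
  by rewrite !(bary_vertex _ _ nd) eqxx eq_sym (negPf ij) subr0.
rewrite baryB => e; have := dotp_le (bary_grad (vert K) i) (vert K i - vert K j).
rewrite e => H; have := le_trans H (ler_wpM2r (enorm_ge0 _) (gr i)).
by rewrite mulrC ler_pdivlMr // mul1r.
Qed.

Lemma vert_inj K : injective (vert K).
Proof.
move=> i j vij; have := bary_vertex i i (tet_nondegenerate K).
rewrite vij (bary_vertex _ _ nd) eqxx; case: eqVneq => // _ /eqP.
by rewrite eq_sym oner_eq0.
Qed.

End Tetrahedra.

(** * Polynomials in time *)

Section UnivariatePolynomials.
Context {R : realType}.

Lemma poly_eq_itv (p q : {poly R}) (a b : R) : a < b ->
  (forall t, a <= t <= b -> p.[t] = q.[t]) -> p = q.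
Proof.
move=> ab pq; apply/eqP; rewrite -subr_eq0; apply/negPn/negP => d0.
pose N := size (p - q); pose s := [seq a + (b - a) / k.+1%:R | k <- iota 0 N].
have : (size s < N)%N.
  apply: max_poly_roots d0 _ _.
    apply/allP => _ /mapP[k _ ->]; rewrite rootE hornerD hornerN pq ?subrr //.
    have k1 : 0 < k.+1%:R :> R by [].
    have kk : k.+1%:R^-1 <= 1 :> R by rewrite invf_le1 // ler1n.
    have kk0 : 0 <= k.+1%:R^-1 :> R by [].
    have h1 : 0 <= (b - a) * (1 - k.+1%:R^-1) by rewrite mulr_ge0 // subr_ge0 // ltW.
    have h2 : 0 <= (b - a) * k.+1%:R^-1 by rewrite mulr_ge0 // subr_ge0 ltW.
    by move: h1 h2; set e := k.+1%:R^-1 => h1 h2; apply/andP; split; nra.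
  have ba : b - a != 0 by rewrite subr_eq0 gt_eqF.
  rewrite map_inj_uniq ?iota_uniq // => i j /addrI /(mulfI ba) /invr_inj /eqP.
  by rewrite eqr_nat => /eqP[].
by rewrite size_map size_iota ltnn.
Qed.

Lemma poly_finite_roots (p : {poly R}) : p != 0 -> exists s : seq R, forall t, root p t -> t \in s.
Proof.
have [n] := ubnP (size p); elim: n p => // n IH p pn p0.
have [[a /factor_theorem[q pq]]|H] := pselect (exists a, root p a); last first.
  by exists [::] => t pt; exfalso; apply: H; exists t.
have q0 : q != 0 by apply: contraNneq p0 => q0; rewrite pq q0 mul0r.
have [|s sP] := IH q _ q0.
  by move: pn; rewrite pq size_Mmonic ?monicXsubC // size_XsubC addn2.
exists (a :: s) => t; rewrite pq rootM root_XsubC inE => /orP[/sP->|->] //.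
by rewrite orbT.
Qed.

Lemma poly_differentiable_tpart (p : {poly R}) (z : 'rV[R]_(3 + 1)) :
  differentiable (fun y => p.[tpart y]) z.
Proof.
have dt : differentiable (@tpart R) z.
  rewrite (_ : @tpart R = fun y => y 0 tdir); first exact: differentiable_coord.
  by apply/funext => y; rewrite -{2}(st_parts y) st_tdir.
by apply: (differentiable_comp dt); apply/derivable1_diffP; exact: derivable_horner.
Qed.

Lemma differentiable_sum_fun (m : nat) (n : nat) (F : 'I_n -> 'rV[R]_m -> R) (z : 'rV[R]_m) :
  (forall i, differentiable (F i) z) -> differentiable (fun y => \sum_i F i y) z.
Proof.
move=> dF; rewrite (_ : (fun y => _) = \sum_i F i); first exact: differentiable_sum.
by apply/funext => y; rewrite fct_sumE.
Qed.

Lemma differentiable_xpart (f : 'rV[R]_3 -> R) (z : 'rV[R]_(3 + 1)) :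
  differentiable f (xpart z) -> differentiable (fun y => f (xpart y)) z.
Proof.
by move=> df; apply: (@differentiable_comp _ _ _ _ (@xpart R) f) => //; exact: differentiable_lsubmx.
Qed.

End UnivariatePolynomials.

(** * The interpolant on one slab and its vertex polynomials *)

Section SlabPolynomials.
Context {R : realType} (ks kq : nat) (D : discretization R) (Om : set 'rV[R]_3) (c : R).
Hypothesis mesh : triangulation D Om c.
Hypothesis phih_fe : st_fe_space D Om ks kq (phih D).
Hypothesis incr : forall n : 'I_(nslab D), tnode D n < tnode D n.+1.
Implicit Types (K L : 'I_(ntet D)) (x y : 'rV[R]_3) (t : R) (n : 'I_(nslab D)) (z : 'rV[R]_(3 + 1)).
Local Notation phihK := (phihK ks kq).
Local Notation phihatK := (phihatK ks kq).
Local Notation nd := (tet_nondegenerate mesh _).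

Lemma prism_st n K x t : prism n K (st x t) <-> tet K x /\ slab n t.
Proof. by rewrite /prism /cyl /= xpart_st tpart_st. Qed.

Lemma phihKP n K : st_poly ks kq (phihK n K) /\ forall z, prism n K z -> phih D z = phihK n K z.
Proof.
apply: (@xgetPex _ (fun=> 0) [set p | st_poly ks kq p /\ forall z, prism n K z -> phih D z = p z]).
have [q [qfe qP]] := phih_fe n.
have /fin_all_exists[p pP] i : exists p, poly_fun ks p /\ forall x, tet K x -> q i x = p x.
  by have [_] := qfe i; apply.
exists (fun z => \sum_(i < kq.+1) tpart z ^+ i * p i (xpart z)); split.
  by exists p; split=> // i; case: (pP i).
move=> z [Kx It]; rewrite -{1}(st_parts z) qP //; last exact: (tet_subset_closure mesh Kx).
by apply: eq_bigr => i _; case: (pP i) => _ ->.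
Qed.

Lemma phihK_st n K : exists q : 'I_kq.+1 -> 'rV[R]_3 -> R, (forall i, poly_fun ks (q i)) /\
  forall x t, phihK n K (st x t) = \sum_(i < kq.+1) t ^+ i * q i x.
Proof.
have [[q [qP qE]] _] := phihKP n K; exists q; split=> // x t.
by rewrite qE xpart_st tpart_st.
Qed.

Lemma phihK_eq n K x t : tet K x -> slab n t -> phihK n K (st x t) = phih D (st x t).
Proof. by move=> Kx It; have [_ ->] := phihKP n K; last by apply/prism_st. Qed.

Lemma poly_fun_phihK n K t : poly_fun ks (fun x => phihK n K (st x t)).
Proof.
have [q [qP qE]] := phihK_st n K; under eq_fun do rewrite qE.
by apply: poly_fun_sum => i _; apply: poly_funZ.
Qed.

Lemma affine_interpE K f x :
  affine_interp K f x = \sum_j bary (vert K) j x * f (vert K j).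
Proof.
set p := affine_interp K f; have [p1 pv] : poly_fun 1 p /\ forall i, p (vert K i) = f (vert K i).
  apply: (@xgetPex _ (fun=> 0) [set p | poly_fun 1 p /\ forall i, p (vert K i) = f (vert K i)]).
  exists (fun x => \sum_j bary (vert K) j x * f (vert K j)); split.
    apply: poly_fun_sum => j _; rewrite (_ : (fun x => _) = fun x => f (vert K j) * bary (vert K) j x).
      by apply: poly_funZ; exact: poly_fun_bary.
    by apply/funext => y; rewrite mulrC.
  move=> i; rewrite (bigD1 i) //= (bary_vertex _ _ nd) eqxx mul1r big1 ?addr0 // => j.
  by rewrite (bary_vertex _ _ nd) eq_sym => /negPf ->; rewrite mul0r.
have [s1 s2] := bary_combine x (tet_nondegenerate mesh K).
rewrite -{1}s2 (poly_fun1_affine p1) //; apply: eq_bigr => j _.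
by rewrite pv.
Qed.

Definition vertex_poly n K j : {poly R} :=
  xget 0 [set p : {poly R} | forall t, phihK n K (st (vert K j) t) = p.[t]].

Lemma vertex_polyE n K j t : (vertex_poly n K j).[t] = phihK n K (st (vert K j) t).
Proof.
rewrite /vertex_poly; case: xgetP => [p _ /= ->//|H]; exfalso.
have [q [_ qE]] := phihK_st n K; apply: (H (\poly_(i < kq.+1) q (inord i) (vert K j))) => /= s.
rewrite qE horner_poly; apply: eq_bigr => i _; rewrite mulrC; congr (q _ _ * _).
by apply: val_inj; rewrite /= inordK.
Qed.

Lemma phihatK_bary n K z :
  phihatK n K z = \sum_j bary (vert K) j (xpart z) * (vertex_poly n K j).[tpart z].
Proof. by rewrite /Defs.phihatK affine_interpE; apply: eq_bigr => j _; rewrite vertex_polyE. Qed.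

Lemma phihatK_st n K x t :
  phihatK n K (st x t) = \sum_j bary (vert K) j x * (vertex_poly n K j).[t].
Proof. by rewrite phihatK_bary xpart_st tpart_st. Qed.

(** Both polynomials agree with [phih D] on the slab, an interval of positive length, and so
    coincide. *)
Lemma vertex_poly_shared n K L i j : vert K i = vert L j -> vertex_poly n K i = vertex_poly n L j.
Proof.
move=> e; apply: (poly_eq_itv (incr n)) => t It.
have It' : slab n t by rewrite /slab /= in_itv.
rewrite !vertex_polyE !phihK_eq ?e //; first exact: vert_tet mesh _ _.
by rewrite -e; exact: vert_tet mesh _ _.
Qed.

Lemma phihatK_affine n K t (I : finType) (l : I -> R) (y : I -> 'rV[R]_3) : \sum_i l i = 1 ->
  phihatK n K (st (\sum_i l i *: y i) t) = \sum_i l i * phihatK n K (st (y i) t).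
Proof.
move=> l1; apply: (@poly_fun1_affine _ _ (fun x => phihatK n K (st x t))) => //.
under eq_fun do rewrite phihatK_st; apply: poly_fun_sum => j _.
under eq_fun do rewrite mulrC; apply: poly_funZ; exact: poly_fun_bary.
Qed.

Lemma phihatK_vertex n K j t : phihatK n K (st (vert K j) t) = (vertex_poly n K j).[t].
Proof.
rewrite phihatK_st (bigD1 j) //= (bary_vertex _ _ nd) eqxx mul1r big1 ?addr0 // => i.
by rewrite (bary_vertex _ _ nd) eq_sym => /negPf ->; rewrite mul0r.
Qed.

(** The vertices with nonzero weight at [x] are shared, and so are their polynomials. Times outside
    the slab are included. *)
Lemma phihatK_consistent n K L x t : tet K x -> tet L x ->
  phihatK n K (st x t) = phihatK n L (st x t).
Proof.
have [->//|KL Kx Lx] := eqVneq K L.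
have [s1 s2] := bary_combine x (tet_nondegenerate mesh K).
rewrite phihatK_st -[in RHS]s2 phihatK_affine //; apply: eq_bigr => j _.
have [->|xj] := eqVneq (bary (vert K) j x) 0; first by rewrite !mul0r.
have [|i e] := common_vertex mesh (j := j) KL Kx Lx.
  by rewrite lt_def xj /=; move/(tetP mesh): Kx.
by rewrite -e phihatK_vertex (vertex_poly_shared n e).
Qed.

Lemma phihatK_differentiable n K z : differentiable (phihatK n K) z.
Proof.
rewrite (funext (phihatK_bary n K)); apply: differentiable_sum_fun => j.
apply: differentiableM; last exact: poly_differentiable_tpart.
by apply: differentiable_xpart; exact: poly_fun_differentiable (poly_fun_bary _ _).
Qed.

(* Gradient of the affine function [phihatK n K (., t)] *)
Definition hat_grad n K t : 'rV[R]_3 := \sum_j (vertex_poly n K j).[t] *: bary_grad (vert K) j.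

Lemma dotp_hat_grad n K t u :
  dotp (hat_grad n K t) u = \sum_j dotp (bary_grad (vert K) j) u * (vertex_poly n K j).[t].
Proof.
by rewrite /hat_grad dotp_suml; apply: eq_bigr => j _; rewrite dotpZl mulrC.
Qed.

Lemma phihatKD n K x u t : phihatK n K (st (x + u) t) = phihatK n K (st x t) + dotp (hat_grad n K t) u.
Proof.
rewrite !phihatK_st dotp_hat_grad -big_split; apply: eq_bigr => j _ /=.
by rewrite baryD mulrDl.
Qed.

Lemma grad_phihatK_x n K z (u : 'rV[R]_3) :
  dotp (grad (phihatK n K) z) (st u 0) = dotp (hat_grad n K (tpart z)) u.
Proof.
rewrite -{1}(st_parts z); move: (xpart z) (tpart z) => x t.
rewrite -derive_grad; last exact: phihatK_differentiable.
apply/cvg_lim => //; apply: cvg_near_cst; near=> h.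
have h0 : h != 0 by near: h; exact: nbhs_dnbhs_neq.
rewrite /= -[h *: st u 0]stZ mulr0 -stD add0r (addrC _ x) phihatKD dotpZr.
by rewrite addrAC subrr add0r /GRing.scale/= mulrA mulVf // mul1r.
Unshelve. all: by end_near. Qed.

End SlabPolynomials.
Lemma norm_le_sub (R : realType) (a b d e : R) : `|a - b| <= d -> `|b| <= e -> `|a| <= d + e.
Proof. by move=> h1 h2; have := ler_normD (a - b) b; rewrite subrK; lra. Qed.

(** * Accuracy of the interpolant and of the deformation *)

Section Accuracy.
Context {R : realType} (P : problem R) (ks kq : nat) (c : R).
Hypothesis ks_ge1 : (1 <= ks)%N.
Hypothesis cont : continuous_setting P ks kq c.
Context (D : discretization R).
Hypothesis ds : discrete_setting ks kq D P c.
Hypotheses (h_le1 : mesh_size D <= 1) (dt_le1 : time_step D <= 1).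
Implicit Types (K L : 'I_(ntet D)) (x y u : 'rV[R]_3) (t : R) (n : 'I_(nslab D)) (z : 'rV[R]_(3 + 1)).
Local Notation cut := (Defs.cut ks kq).
Local Notation phihK := (phihK ks kq).
Local Notation phihatK := (phihatK ks kq).
Let mesh := ds_mesh ds.
Let incr := tg_incr (ds_time ds).

Lemma mesh_size_ge0 : 0 <= mesh_size D.
Proof. exact: bigmax_ge_id. Qed.

Lemma time_step_ge0 : 0 <= time_step D.
Proof. exact: bigmax_ge_id. Qed.

Lemma cut_nbhd n K x t : cut n K -> tet K x -> slab n t -> nbhd P (st x t).
Proof.
move=> cK Kx It; apply: (ds_QS ds (n := n)).
by rewrite /QS /cyl /= xpart_st tpart_st; split=> //; exists K.
Qed.

Lemma prism_interior_approx n K z (d : R) : prism n K z -> 0 < d ->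
  exists x t, [/\ (tet K)^° x, tnode D n < t < tnode D n.+1 & enorm (st x t - z) < d].
Proof.
move=> [Kx It] d0; have := incr n => tt.
pose m := (tnode D n + tnode D n.+1) / 2; pose w := st (centroid K - xpart z) (m - tpart z).
have w1 : 0 < enorm w + 1 by rewrite ltr_wpDl ?enorm_ge0.
pose s := Num.min 1 (d / (enorm w + 1) / 2).
have s0 : 0 < s by rewrite lt_min ltr01 !divr_gt0.
have s1 : s <= 1 by rewrite ge_min lexx.
exists (xpart z + s *: (centroid K - xpart z)), (tpart z + s * (m - tpart z)); split.
- by apply: (towards_centroid_interior mesh) => //; rewrite s0.
- move: It; rewrite /slab /= in_itv /= => /andP[t1 t2].
  rewrite (_ : _ + _ = (1 - s) * tpart z + s * m); last by ring.
  have hm1 : 0 < s * (m - tnode D n) by rewrite mulr_gt0 // /m; lra.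
  have hm2 : 0 < s * (tnode D n.+1 - m) by rewrite mulr_gt0 // /m; lra.
  have h1 : 0 <= (1 - s) * (tpart z - tnode D n) by rewrite mulr_ge0 // subr_ge0.
  have h2 : 0 <= (1 - s) * (tnode D n.+1 - tpart z) by rewrite mulr_ge0 // subr_ge0.
  by apply/andP; split; lra.
- rewrite stD stZ st_parts addrAC subrr add0r enormZ gtr0_norm //.
  apply: (@le_lt_trans _ _ (d / (enorm w + 1) / 2 * (enorm w + 1))).
    by rewrite ler_pM ?enorm_ge0 ?(ltW s0) // ?lerDl // ge_min lexx orbT.
  by rewrite mulrAC mulfVK ?gt_eqF //; lra.
Qed.

(** The accuracy assumptions concern the open prisms, whereas faces lie on prism boundaries;
    continuity carries bounds over to the closed prisms. *)
Lemma prism_closure_bound n K (G : 'rV[R]_(3 + 1) -> R) z (b : R) : prism n K z ->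
  {for z, continuous G} ->
  (forall x t, (tet K)^° x -> tnode D n < t < tnode D n.+1 -> `|G (st x t)| <= b) -> `|G z| <= b.
Proof.
move=> Kz cG Gb; apply/ler_addgt0Pr => e e0.
have /cvgrPdist_lt/(_ e e0)/enorm_ball_nbhs[d d0 dP] := cG.
have [x [t [Kx It /dP]]] := prism_interior_approx Kz d0.
by have := Gb x t Kx It; have := ler_normD (G (st x t)) (G z - G (st x t)); rewrite addrC subrK; lra.
Qed.

Lemma prism_interior_near n K x t : (tet K)^° x -> tnode D n < t < tnode D n.+1 ->
  \forall z \near st x t, prism n K z.
Proof.
move=> /enorm_ball_nbhs[d d0 dK] /andP[t1 t2]; apply/enorm_ball_nbhs.
exists (Num.min d (Num.min (t - tnode D n) (tnode D n.+1 - t))).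
  by rewrite !lt_min d0 !subr_gt0 t1.
move=> z; rewrite !lt_min => /andP[zd /andP[zt1 zt2]]; split.
  apply: dK; rewrite -(xpart_st x t) -xpartB; exact: le_lt_trans (enorm_xpart _) zd.
have := enorm_tpart (z - st x t); rewrite tpartB tpart_st ler_norml => /andP[h1 h2].
by rewrite /slab /= in_itv /=; apply/andP; split; lra.
Qed.

Lemma pder_near (m : nat) (i : 'I_m) (f g : 'rV[R]_m -> R) (z : 'rV[R]_m) :
  (\forall y \near z, f y = g y) -> pder i f z = pder i g z.
Proof.
by move=> fg; rewrite /pder; exact: near_eq_derive.
Qed.

Lemma pder_xdir (F : 'rV[R]_(3 + 1) -> R) (j : 'I_3) x t :
  pder (xdir j) F (st x t) = pder j (fun y => F (st y t)) x.
Proof.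
rewrite /pder /derive; set f1 := (fun h : R => _); set f2 := (fun h : R => h^-1 *: (((fun y => F (st y t)) \o shift x) _ - _)).
suff -> : f1 = f2 by [].
apply/funext => h; rewrite /f1 /f2 /=; congr (_ *: (F _ - _)).
by rewrite -st_delta -stZ mulr0 -stD add0r.
Qed.

Lemma pder_sum (m k : nat) (i : 'I_m) (a : 'I_k -> R) (q : 'I_k -> 'rV[R]_m -> R) (w : 'rV[R]_m) :
  (forall j (v : 'rV[R]_m), differentiable (q j) v) ->
  pder i (fun v => \sum_j a j * q j v) w = \sum_j a j * pder i (q j) w.
Proof.
move=> dq; rewrite (_ : (fun v => _) = \sum_j (a j \*: q j)); last first.
  by apply/funext => v; rewrite fct_sumE.
have dz j : derivable (a j \*: q j) w (delta_mx 0 i).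
  by apply: derivableZ; exact: diff_derivable.
rewrite /pder derive_sum //; apply: eq_bigr => j _; rewrite deriveZ //; exact: diff_derivable.
Qed.

Lemma pder_phihK n K (j : 'I_3) : exists q : 'I_kq.+1 -> 'rV[R]_3 -> R,
  [/\ forall i, poly_fun ks (q i),
    forall x t, phihK n K (st x t) = \sum_(i < kq.+1) t ^+ i * q i x
  & forall x t, pder (xdir j) (phihK n K) (st x t) = \sum_(i < kq.+1) t ^+ i * pder j (q i) x].
Proof.
have [q [qP qE]] := phihK_st mesh (ds_phih ds) n K; exists q; split=> // x t.
rewrite pder_xdir; under eq_fun do rewrite qE.
by rewrite pder_sum // => i y; exact: poly_fun_differentiable (qP i).
Qed.

Lemma differentiable_st_poly (q : 'I_kq.+1 -> 'rV[R]_3 -> R) (F : 'rV[R]_(3 + 1) -> R) z :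
  (forall i, poly_fun ks (q i)) ->
  (forall x t, F (st x t) = \sum_(i < kq.+1) t ^+ i * q i x) -> differentiable F z.
Proof.
move=> qP FE; rewrite (_ : F = fun z => \sum_(i < kq.+1) tpart z ^+ i * q i (xpart z)); last first.
  by apply/funext => y; rewrite -{1}(st_parts y) FE.
apply: differentiable_sum_fun => i; apply: differentiableM.
  have := poly_differentiable_tpart 'X^i z.
  by under eq_fun do rewrite hornerXn.
by apply: differentiable_xpart; exact: poly_fun_differentiable (qP i).
Qed.

Lemma phihK_differentiable n K z : differentiable (phihK n K) z.
Proof.
have [q [qP qE]] := phihK_st mesh (ds_phih ds) n K.
exact: differentiable_st_poly qP qE.
Qed.

Lemma pder_phihK_differentiable n K j z : differentiable (pder (xdir j) (phihK n K)) z.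
Proof.
have [q [qP _ qE]] := pder_phihK n K j.
by apply: (differentiable_st_poly _ _ qE) => i; exact: poly_fun_pder.
Qed.

Lemma pder2_phihK_continuous n K i j : continuous (pder (xdir i) (pder (xdir j) (phihK n K))).
Proof.
have [q [qP _ qE]] := pder_phihK n K j => z.
apply: differentiable_continuous.
apply: (@differentiable_st_poly (fun k => pder i (pder j (q k)))).
  by move=> k; do 2 apply: poly_fun_pder.
move=> x t; rewrite pder_xdir; under eq_fun do rewrite qE.
rewrite pder_sum // => k y; exact: poly_fun_differentiable (poly_fun_pder _ (qP k)).
Qed.

Lemma phi_pders_continuous n K z l : cut n K -> prism n K z -> (size l <= 2)%N ->
  {for z, continuous (pders l (phi P))}.
Proof.
move=> cK [Kx It] sl; have [U [oU NU HU]] := cs_phi2 cont.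
have Uz : U z by apply: NU; rewrite -(st_parts z); apply: cut_nbhd Kx It.
by case: l sl (HU l sl) => [|i l] _ [H _]; exact: H.
Qed.

Lemma phi_pders_derivable n K z i l : cut n K -> prism n K z -> (size l < 2)%N ->
  \forall y \near z, derivable (pders l (phi P)) y (delta_mx 0 i).
Proof.
move=> cK [Kx It] sl; have [U [oU NU HU]] := cs_phi2 cont.
have Uz : U z by apply: NU; rewrite -(st_parts z); apply: cut_nbhd Kx It.
have near_U : \forall y \near z, U y by exact: open_nbhs_nbhs.
by have [_ [_ H]] := HU (i :: l) sl; apply: filterS near_U.
Qed.

Lemma grad_phihK_accuracy n K z i : cut n K -> prism n K z ->
  `|pder (xdir i) (phihK n K) z - pder (xdir i) (phi P) z| <= c * (mesh_size D + time_step D).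
Proof.
move=> cK Kz; apply: (prism_closure_bound (G := fun z => pder (xdir i) (phihK n K) z - pder (xdir i) (phi P) z) Kz).
  apply: continuousB; first by apply: differentiable_continuous; exact: pder_phihK_differentiable.
  exact: (@phi_pders_continuous n K z [:: xdir i] cK Kz isT).
move=> x t Kx It; have := ds_accuracy ds (n := n) (s := [:: i]) (mq := 0).
move=> /(_ (or_introl (conj isT isT)) K x t cK Kx It) /= H.
have Kz' : prism n K (st x t) by exact: nbhs_singleton (prism_interior_near Kx It).
have dphi := @phi_pders_derivable n K (st x t) (xdir i) [::] cK Kz' isT.
have e : pder (xdir i) (fun z => phih D z - phi P z) (st x t)
    = pder (xdir i) (phihK n K) (st x t) - pder (xdir i) (phi P) (st x t).
  rewrite (@pder_near _ _ _ (phihK n K - phi P)).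
    rewrite /pder deriveB //; first by apply: diff_derivable; exact: phihK_differentiable.
    exact: nbhs_singleton dphi.
  by apply: filterS (prism_interior_near Kx It) => y /(phihKP mesh (ds_phih ds) n K).2 ->.
rewrite -e; apply: (le_trans H); rewrite ler_wpM2l ?(ltW (cs_const cont)) // /rate !subSS !subn0.
by apply: lerD; [rewrite ler_iXnr ?mesh_size_ge0|rewrite ler_iXnr ?time_step_ge0].
Qed.

Lemma hess_phihK_bound n K z i j : cut n K -> prism n K z ->
  `|pder (xdir i) (pder (xdir j) (phihK n K)) z| <= 3 * c.
Proof.
move=> cK Kz; apply: (prism_closure_bound Kz); first exact: pder2_phihK_continuous.
move=> x t Kx It; have := ds_accuracy ds (n := n) (s := [:: i; j]) (mq := 0).
have o2 : accuracy_orders ks kq (size [:: i; j]) 0 by left; rewrite /= ltnS.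
move=> /(_ o2 K x t cK Kx It) /= H.
have Kz' : prism n K (st x t) by exact: nbhs_singleton (prism_interior_near Kx It).
have dphi := @phi_pders_derivable n K (st x t) (xdir j) [::] cK Kz' isT.
have d2phi := @phi_pders_derivable n K (st x t) (xdir i) [:: xdir j] cK Kz' isT.
have e : pder (xdir i) (pder (xdir j) (fun z => phih D z - phi P z)) (st x t)
    = pder (xdir i) (pder (xdir j) (phihK n K)) (st x t) - pder (xdir i) (pder (xdir j) (phi P)) (st x t).
  rewrite (@pder_near _ _ _ (pder (xdir j) (phihK n K) - pder (xdir j) (phi P))).
    rewrite {1}/pder deriveB //; first by apply: diff_derivable; exact: pder_phihK_differentiable.
    exact: nbhs_singleton d2phi.
  have n2 := near_join (prism_interior_near Kx It).
  apply: filterS2 dphi n2 => y dy ny; rewrite (@pder_near _ _ _ (phihK n K - phi P)).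
    by rewrite {1}/pder deriveB //; apply: diff_derivable; exact: phihK_differentiable.
  by apply: filterS ny => y0 /(phihKP mesh (ds_phih ds) n K).2 ->.
have hess := cs_hess cont (z := st x t) i j.
have {hess} hess : `|pders [:: xdir i; xdir j] (phi P) (st x t)| <= c.
  by apply: hess; case: Kz' => Kx' It'; have := cut_nbhd cK Kx' It'; rewrite st_parts.
move: H; rewrite e => H; set a := pder _ _ _ in H *; set b := pder _ _ _ in H.
rewrite (_ : pders _ _ _ = b) // in hess.
(* For [ks = 1] the mesh size has exponent 0, so the second derivatives of the error are only
   bounded, by 2 c. The Hessian of [phi P] contributes the third c. *)
have r2 : c * rate ks kq D 2 0 <= c * 2.
  rewrite ler_wpM2l ?(ltW (cs_const cont)) // /rate -[leRHS]/(1 + 1) lerD //.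
    by rewrite exprn_ile1 // mesh_size_ge0.
  by rewrite exprn_ile1 // time_step_ge0.
apply: le_trans (norm_le_sub (le_trans H r2) hess) _.
by rewrite -[X in _ + X]mulr1 -mulrDr mulrC natr1.
Qed.

End Accuracy.

(** * Errors of the piecewise linear interpolant and of its gradient *)

Section Interpolation.
Context {R : realType} (P : problem R) (ks kq : nat) (c : R).
Hypothesis ks_ge1 : (1 <= ks)%N.
Hypothesis cont : continuous_setting P ks kq c.
Context (D : discretization R).
Hypothesis ds : discrete_setting ks kq D P c.
Hypotheses (h_le1 : mesh_size D <= 1) (dt_le1 : time_step D <= 1).
Implicit Types (K L : 'I_(ntet D)) (x y u w : 'rV[R]_3) (t : R) (n : 'I_(nslab D)) (z : 'rV[R]_(3 + 1)).
Local Notation cut := (Defs.cut ks kq).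
Local Notation phihK := (phihK ks kq).
Local Notation phihatK := (phihatK ks kq).
Local Notation vertex_poly := (vertex_poly ks kq).
Local Notation hat_grad := (hat_grad ks kq).
Let mesh := ds_mesh ds.
Let c0 := cs_const cont.

Lemma grad_slice n K x t : grad (fun y => phihK n K (st y t)) x = gradx (phihK n K) (st x t).
Proof. by apply/rowP => i; rewrite !mxE pder_xdir. Qed.

Lemma pder2_slice n K x t i j : pder i (pder j (fun y => phihK n K (st y t))) x
  = pder (xdir i) (pder (xdir j) (phihK n K)) (st x t).
Proof.
have -> : pder j (fun y => phihK n K (st y t)) = fun y => pder (xdir j) (phihK n K) (st y t).
  by apply/funext => y; rewrite (pder_xdir (phihK n K)).
by rewrite (pder_xdir (pder (xdir j) (phihK n K))).
Qed.

Lemma diam_gt0 K : 0 < diam (tet K).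
Proof.
have [r [r0 gr _]] := tet_radius mesh K.
have v01 : vert K ord0 != vert K ord_max by apply/eqP => /(vert_inj mesh).
have vd := vertex_dist mesh r0 gr v01; apply: (lt_le_trans r0); apply: (le_trans vd).
by apply: (tet_diam mesh); exact: vert_tet mesh _ _.
Qed.

Lemma phihK_taylor n K x y t : cut n K -> tet K x -> tet K y -> slab n t ->
  `|phihK n K (st y t) - phihK n K (st x t) - dotp (gradx (phihK n K) (st x t)) (y - x)|
    <= 27%:R * c * diam (tet K) ^+ 2.
Proof.
move=> cK Kx Ky It; pose q := fun y => phihK n K (st y t).
have qP : poly_fun ks q by exact: poly_fun_phihK mesh (ds_phih ds) n K t.
have c3 : 0 <= 3 * c by rewrite mulr_ge0 // ltW.
have [||//|i j s s01|_] := @taylor2_bound R 3 q x (y - x) (3 * c).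
- by move=> w; exact: poly_fun_differentiable qP.
- by move=> j w; exact: poly_fun_differentiable (poly_fun_pder _ qP).
- rewrite pder2_slice; apply: (hess_phihK_bound ks_ge1 cont ds) => //.
  by apply/prism_st; split=> //; exact: (tet_convex mesh s01 Kx Ky).
rewrite (addrC x) subrK grad_slice => H; apply: (le_trans H).
have -> : 3 * c * enorm (y - x) ^+ 2 *+ (3 * 3) = 27%:R * c * enorm (y - x) ^+ 2.
  by rewrite -mulr_natr natrM; ring.
rewrite ler_wpM2l ?mulr_ge0 ?(ltW c0) // lerXn2r ?nnegrE ?enorm_ge0 ?(diam_ge0 mesh) //.
exact: (tet_diam mesh).
Qed.

(** The error is the barycentric average of the Taylor remainders at the vertices, since the
    averages of v_j - x cancel. *)
Lemma phihat_error n K x t : cut n K -> tet K x -> slab n t ->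
  `|phihatK n K (st x t) - phihK n K (st x t)| <= 27%:R * c * diam (tet K) ^+ 2.
Proof.
move=> cK Kx It; have [s1 s2] := bary_combine x (tet_nondegenerate mesh K).
set g := gradx (phihK n K) (st x t).
have -> : phihatK n K (st x t) - phihK n K (st x t) = \sum_j bary (vert K) j x *
   (phihK n K (st (vert K j) t) - phihK n K (st x t) - dotp g (vert K j - x)).
  have e0 : \sum_j bary (vert K) j x * dotp g (vert K j - x) = 0.
    transitivity (dotp g (\sum_j bary (vert K) j x *: (vert K j - x))).
      by rewrite dotp_sumr; apply: eq_bigr => j _; rewrite dotpZr.
    rewrite (eq_bigr _ (fun j _ => scalerBr _ _ _)) sumrB s2 -scaler_suml s1 scale1r subrr.
    by rewrite dotp0r.
  transitivity (\sum_j bary (vert K) j x * (vertex_poly n K j).[t]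
     - \sum_j bary (vert K) j x * phihK n K (st x t)
     - \sum_j bary (vert K) j x * dotp g (vert K j - x)).
    rewrite e0 subr0 (phihatK_st mesh (ds_phih ds)); congr (_ - _).
    by rewrite -mulr_suml s1 mul1r.
  rewrite -!sumrB; apply: eq_bigr => j _.
  rewrite (vertex_polyE mesh (ds_phih ds)); ring.
apply: (le_trans (ler_norm_sum _ _ _)).
apply: (@le_trans _ _ (\sum_j bary (vert K) j x * (27%:R * c * diam (tet K) ^+ 2))).
  apply: ler_sum => j _; have bj : 0 <= bary (vert K) j x by move/(tetP mesh): Kx.
  rewrite normrM ger0_norm // ler_wpM2l //; apply: phihK_taylor => //; exact: vert_tet mesh _ _.
by rewrite -mulr_suml s1 mul1r.
Qed.

(** The barycentric gradients annihilate constants and reproduce linear functions, so only the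
    Taylor remainders at the four vertices are left, each multiplied by a gradient of size 1 / r;
    diam / r is at most [c]. The constant is 4 times 27. *)
Lemma hat_grad_error n K x t : cut n K -> tet K x -> slab n t ->
  enorm (hat_grad n K t - gradx (phihK n K) (st x t)) <= 108%:R * c ^+ 2 * mesh_size D.
Proof.
move=> cK Kx It; have nd := tet_nondegenerate mesh K.
set g := gradx (phihK n K) (st x t); pose q y := phihK n K (st y t).
have -> : hat_grad n K t - g =
    \sum_j (q (vert K j) - q x - dotp g (vert K j - x)) *: bary_grad (vert K) j.
  have e u : dotp (hat_grad n K t - g) u =
      dotp (\sum_j (q (vert K j) - q x - dotp g (vert K j - x)) *: bary_grad (vert K) j) u.
    have dsum (F : 'I_4 -> R) (v : 'I_4 -> 'rV[R]_3) : dotp (\sum_j F j *: v j) u = \sum_j F j * dotp (v j) u.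
      by rewrite dotp_suml; apply: eq_bigr => j _; rewrite dotpZl.
    rewrite dsum dotpBl dotp_hat_grad.
    have s0 : \sum_j dotp (bary_grad (vert K) j) u = 0.
      have := dsum (fun=> 1) (bary_grad (vert K)).
      under eq_bigr do rewrite scale1r; rewrite bary_grad_sum // dotp0l.
      by under eq_bigr do rewrite mul1r.
    have eg : dotp g u = \sum_j dotp g (vert K j - x) * dotp (bary_grad (vert K) j) u.
      rewrite -{1}(bary_grad_combine u nd).
      transitivity (\sum_j dotp (bary_grad (vert K) j) u * dotp g (vert K j)).
        by rewrite dotp_sumr; apply: eq_bigr => j _; rewrite dotpZr.
      apply/eqP; rewrite -subr_eq0 -sumrB; apply/eqP.
      transitivity (\sum_j dotp g x * dotp (bary_grad (vert K) j) u); last by rewrite -mulr_sumr s0 mulr0.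
      by apply: eq_bigr => j _; rewrite dotpBr; ring.
    transitivity (\sum_j dotp (bary_grad (vert K) j) u * (vertex_poly n K j).[t]
       - \sum_j dotp g (vert K j - x) * dotp (bary_grad (vert K) j) u
       - \sum_j q x * dotp (bary_grad (vert K) j) u).
      by rewrite -eg -mulr_sumr s0 mulr0 subr0.
    rewrite -!sumrB; apply: eq_bigr => j _.
    rewrite (vertex_polyE mesh (ds_phih ds)) -/(q _); ring.
  apply/eqP; rewrite -subr_eq0 -dotp_eq0; apply/eqP.
  by rewrite {1}dotpBl e subrr.
apply: (le_trans (enorm_sum _ _ _)).
have [r [r0 gr dr]] := tet_radius mesh K.
apply: (@le_trans _ _ (\sum_(j < 4) 27%:R * c ^+ 2 * diam (tet K))).
  apply: ler_sum => j _; rewrite enormZ.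
  apply: (le_trans (ler_pM (normr_ge0 _) (enorm_ge0 _) (phihK_taylor cK Kx (vert_tet mesh K j) It) (gr j))).
  have dr' : diam (tet K) / r <= c by rewrite ler_pdivrMr.
  have -> : 27%:R * c * diam (tet K) ^+ 2 * r^-1 = 27%:R * c * diam (tet K) * (diam (tet K) / r) by ring.
  have -> : 27%:R * c ^+ 2 * diam (tet K) = 27%:R * c * diam (tet K) * c by ring.
  by rewrite ler_wpM2l // !mulr_ge0 ?(diam_ge0 mesh) // ltW.
rewrite sumr_const card_ord -[leLHS]mulr_natl.
have -> : 108%:R * c ^+ 2 * mesh_size D = 4%:R * (27%:R * c ^+ 2 * mesh_size D) by ring.
by rewrite ler_wpM2l // ler_wpM2l ?diam_le_mesh // mulr_ge0 // sqr_ge0.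
Qed.

Lemma gradx_error n K x t : cut n K -> tet K x -> slab n t ->
  enorm (gradx (phihK n K) (st x t) - gradx (phi P) (st x t)) <= 3 * c * (mesh_size D + time_step D).
Proof.
move=> cK Kx It; have -> : 3 * c * (mesh_size D + time_step D) = c * (mesh_size D + time_step D) *+ 3.
  by rewrite -mulr_natr; ring.
apply: enorm_le_bound => i; rewrite !mxE.
by apply: (grad_phihK_accuracy ks_ge1 cont ds) => //; apply/prism_st.
Qed.

Lemma hat_grad_accuracy n K x t : cut n K -> tet K x -> slab n t ->
  enorm (hat_grad n K t - gradx (phi P) (st x t)) <= (108%:R * c ^+ 2 + 3 * c) * (mesh_size D + time_step D).
Proof.
move=> cK Kx It; apply: (le_trans (enorm_dist _ (gradx (phihK n K) (st x t)) _)).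
apply: (le_trans (lerD (hat_grad_error cK Kx It) (gradx_error cK Kx It))).
rewrite [leRHS]mulrDl; apply: lerD => //; apply: ler_wpM2l; first by rewrite mulr_ge0 // sqr_ge0.
by rewrite lerDl; exact: time_step_ge0.
Qed.

Lemma phi_grad_bounds n K x t : cut n K -> tet K x -> slab n t ->
  c^-1 <= enorm (gradx (phi P) (st x t)) <= c.
Proof. by move=> cK Kx It; apply: (cs_grad cont); exact: (cut_nbhd ds cK). Qed.

End Interpolation.

(** * The deformation is close to the identity in space *)

Lemma norm_near_bounds (R : realType) (i c a b d : R) : 0 < i -> i <= b -> b <= c ->
  a - b <= d -> b - a <= d -> d <= 4^-1 * i -> 2^-1 * i <= a <= 2 * c.
Proof. by move=> *; apply/andP; split; lra. Qed.

Lemma perturbed_sign (R : realType) (T A E B X : R) : `|T| <= A -> `|E| <= B ->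
  A <= X / 2 -> B <= X / 2 -> 0 <= T + E + X /\ T + E - X <= 0.
Proof. by move=> /ler_normlP[? ?] /ler_normlP[? ?] *; split; lra. Qed.

Section Deformation.
Context {R : realType} (P : problem R) (ks kq : nat) (c : R).
Hypothesis ks_ge1 : (1 <= ks)%N.
Hypothesis cont : continuous_setting P ks kq c.
Context (D : discretization R).
Hypothesis ds : discrete_setting ks kq D P c.
Hypotheses (h_le1 : mesh_size D <= 1) (dt_le1 : time_step D <= 1).
Variable M : R.
Hypothesis M0 : 0 < M.
Hypothesis lagM : forall v (r : R) p (b : R), nondegenerate v -> 0 < r ->
  (forall j, enorm (bary_grad v j) <= r^-1) -> poly_fun ks p ->
  (forall a : lag_index ks, `|p (lag_node v a)| <= b) -> forall x, (forall i, `|bary v i x| <= 1 + c) ->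
  `|p x| <= M * b /\
  forall y, (forall i, `|bary v i y| <= 1 + c) -> `|p x - p y| <= M * b / r * enorm (x - y).
Implicit Types (K L : 'I_(ntet D)) (x y u w : 'rV[R]_3) (t : R) (n : 'I_(nslab D)) (z : 'rV[R]_(3 + 1)).
Local Notation cut := (Defs.cut ks kq).
Local Notation phihK := (phihK ks kq).
Local Notation phihatK := (phihatK ks kq).
Local Notation ThetaNode := (@ThetaNode R ks kq D).
Let mesh := ds_mesh ds.
Let c0 := cs_const cont.

(** A step of length diam <= c r changes a coordinate by at most [c]. Hence the box bound [1 + c] in
    [lagM]. *)
Lemma near_tet_box K x y : tet K x -> enorm (y - x) <= diam (tet K) ->
  forall i, `|bary (vert K) i y| <= 1 + c.
Proof.
move=> Kx yx i; have [r [r0 gr dr]] := tet_radius mesh K.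
rewrite -[y](subrK x) addrC baryD; apply: (le_trans (ler_normD _ _)).
apply: lerD; first exact: (bary_norm_le1 mesh).
apply: (le_trans (cauchy_schwarz _ _)).
apply: (le_trans (ler_pM (enorm_ge0 _) (enorm_ge0 _) (gr i) (le_trans yx dr))).
by rewrite mulrC mulfK // gt_eqF.
Qed.

Lemma tet_lag_node K (a : lag_index ks) : tet K (lag_node (vert K) a).
Proof.
by apply/(tetP mesh) => j; rewrite (bary_lag_node ks_ge1 _ _ (tet_nondegenerate mesh K)) divr_ge0.
Qed.

Lemma lagrange_nodeP K x : lagrange_node ks K x -> exists a : lag_index ks, x = lag_node (vert K) a.
Proof.
move=> [e [ek ->]]; have [a aP] := lag_index_of ek.
by exists a; apply: eq_bigr => i _; rewrite aP.
Qed.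

Lemma lag_node_lagrange K (a : lag_index ks) : lagrange_node ks K (lag_node (vert K) a).
Proof. by exists (lag_exp a); split=> //; exact: lag_exp_sum. Qed.

(** [x + w] may leave [L], where no accuracy is assumed. The second derivatives are polynomials
    bounded at the Lagrange nodes of [L], and [lagM] extends this bound to the box. *)
Lemma phihK_taylor_near n L x w t : cut n L -> tet L x -> slab n t -> enorm w <= diam (tet L) ->
  `|phihK n L (st (x + w) t) - phihK n L (st x t) - dotp (gradx (phihK n L) (st x t)) w|
    <= 27%:R * c * M * enorm w ^+ 2.
Proof.
move=> cL Lx It wd; pose q := fun y => phihK n L (st y t).
have qP : poly_fun ks q by exact: poly_fun_phihK mesh (ds_phih ds) n L t.
have nd := tet_nondegenerate mesh L.
have c3 : 0 <= M * (3 * c) by rewrite !mulr_ge0 // ltW.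
have [||//|i j s /andP[s0 s1]|_] := @taylor2_bound R 3 q x w (M * (3 * c)).
- by move=> y; exact: poly_fun_differentiable qP.
- by move=> j y; exact: poly_fun_differentiable (poly_fun_pder _ qP).
- have [r [r0 gr _]] := tet_radius mesh L.
  have d2P : poly_fun ks (pder i (pder j q)) by do 2 apply: poly_fun_pder.
  have nb (a : lag_index ks) : `|pder i (pder j q) (lag_node (vert L) a)| <= 3 * c.
    rewrite pder2_slice; apply: (hess_phihK_bound ks_ge1 cont ds) => //.
    by apply/prism_st; split=> //; exact: tet_lag_node.
  have box k : `|bary (vert L) k (x + s *: w)| <= 1 + c.
    apply: (near_tet_box Lx); rewrite addrAC subrr add0r enormZ ger0_norm //.
    by apply: le_trans wd; rewrite ler_piMl ?enorm_ge0.
  by have [] := lagM nd r0 gr d2P nb box.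
rewrite grad_slice => H; apply: (le_trans H).
suff -> : M * (3 * c) * enorm w ^+ 2 *+ (3 * 3) = 27%:R * c * M * enorm w ^+ 2 by [].
by rewrite -mulr_natr natrM; ring.
Qed.

Lemma gradx_phihK_bounds n L x t : 12%:R * c ^+ 2 * (mesh_size D + time_step D) <= 1 ->
  cut n L -> tet L x -> slab n t ->
  (2 * c)^-1 <= enorm (gradx (phihK n L) (st x t)) <= 2 * c.
Proof.
move=> small cL Lx It; have := gradx_error ks_ge1 cont ds h_le1 dt_le1 cL Lx It.
have /andP[] := phi_grad_bounds cont ds cL Lx It.
set g := gradx (phihK n L) _; set f := gradx (phi P) _ => f1 f2 gf.
(* The error is at most a quarter of the lower bound 1 / c of the exact gradient; this is the origin
   of 12 c^2. *)
have e1 : 3 * c * (mesh_size D + time_step D) <= (4 * c)^-1.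
  rewrite -[leRHS]mul1r ler_pdivlMr ?mulr_gt0 //; apply: le_trans small.
  by rewrite le_eqVlt; apply/orP; left; apply/eqP; ring.
have h1 := enorm_subr_ge g f; have h2 := enorm_subr_ge f g.
rewrite (enorm_distC f) in h2; move: e1; rewrite !invfM => e1.
by apply: (norm_near_bounds _ f1 f2 h1 h2 (le_trans gf e1)); rewrite ?invr_gt0.
Qed.

(* Constant of the bound [|dh| <= displacement * diam ^ 2] *)
Definition displacement := 216%:R * c ^+ 3.
Local Notation disp := displacement.

Lemma displacement_gt0 : 0 < disp.
Proof. by apply: mulr_gt0 => //; exact: exprn_gt0. Qed.

Let disp0 := displacement_gt0.

(** At distance [del] along the gradient g the increment del |g|^2 outweighs the Taylor remainder
    and the interpolation error, each at most half of it. So there is a root in [- del, del], and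
    [dh] is no larger. *)
Lemma dh_bound n m L x : 12%:R * c ^+ 2 * (mesh_size D + time_step D) <= 1 ->
  disp * (2 * c) * mesh_size D <= 1 -> 54%:R * c * M * disp * mesh_size D <= 1 ->
  cut n L -> tet L x -> `|@dh R ks kq D n m L x| <= disp * diam (tet L) ^+ 2.
Proof.
move=> s1 s2 s3 cL Lx; set t := tau D n m.
have It : slab n t := ds_tau ds n m.
set g := gradx (phihK n L) (st x t).
have /andP[g1 g2] : (2 * c)^-1 <= enorm g <= 2 * c by exact: gradx_phihK_bounds.
set dL := diam (tet L).
have dL0 : 0 < dL by exact: (diam_gt0 ds).
have dLh : dL <= mesh_size D by exact: diam_le_mesh.
pose del := disp * dL ^+ 2.
have del0 : 0 < del by rewrite mulr_gt0 // exprn_gt0.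
pose F (d : R) := phihK n L (st (x + d *: g) t) - phihatK n L (st x t).
have cF : continuous F.
  have qP : poly_fun ks (fun y => phihK n L (st y t)) by exact: poly_fun_phihK mesh (ds_phih ds) n L t.
  move=> d; have [dG _] := @derive_along_line R 3 (fun y => phihK n L (st y t)) x g d (poly_fun_differentiable _ qP).
  have cG := differentiable_continuous ((derivable1_diffP _ _).1 dG).
  exact: (continuousB cG (@cst_continuous _ _ (phihatK n L (st x t)) d)).
have e0 := phihat_error ks_ge1 cont ds h_le1 dt_le1 cL Lx It.
have g_sq : (4 * c ^+ 2)^-1 <= enorm g ^+ 2.
  rewrite (_ : (4 * c ^+ 2)^-1 = (2 * c)^-1 ^+ 2); last by field; rewrite gt_eqF.
  by rewrite lerXn2r // ?nnegrE ?enorm_ge0 // invr_ge0 mulr_ge0 // ltW.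
have dL1 : dL <= 1 := le_trans dLh h_le1.
have delh : del <= disp * mesh_size D.
  rewrite /del ler_wpM2l ?(ltW disp0) // expr2; apply: le_trans dLh.
  by rewrite ler_piMr // ltW.
have wL : del * (2 * c) <= dL.
  have -> : del * (2 * c) = dL * (disp * (2 * c) * dL) by rewrite /del; ring.
  rewrite ler_piMr ?(ltW dL0) //; apply: le_trans s2.
  by rewrite ler_wpM2l // !mulr_ge0 // ltW.
have key (e : R) : `|e| = 1 ->
    exists T E, [/\ F (e * del) = T + E + e * (del * enorm g ^+ 2),
      `|T| <= del * enorm g ^+ 2 / 2 & `|E| <= del * enorm g ^+ 2 / 2].
  move=> e1; exists (phihK n L (st (x + (e * del) *: g) t) - phihK n L (st x t)
     - dotp g ((e * del) *: g)), (phihK n L (st x t) - phihatK n L (st x t)).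
  have nw : enorm ((e * del) *: g) = del * enorm g.
    by rewrite enormZ normrM e1 mul1r gtr0_norm.
  split.
  - by rewrite dotpZr -enorm_sqr /F; ring.
  - have wd : enorm ((e * del) *: g) <= dL.
      by rewrite nw; apply: le_trans wL; rewrite ler_wpM2l // ltW.
    apply: (le_trans (phihK_taylor_near cL Lx It wd)); rewrite nw.
    have -> : 27%:R * c * M * (del * enorm g) ^+ 2 =
      54%:R * c * M * del * (del * enorm g ^+ 2 / 2) by field.
    have p0 : 0 <= del * enorm g ^+ 2 / 2.
      by apply: divr_ge0 => //; apply: mulr_ge0; [exact: ltW|exact: sqr_ge0].
    have q0 : 0 <= 54%:R * c * M by rewrite !mulr_ge0 // ltW.
    apply: ler_piMl => //; apply: (@le_trans _ _ (54%:R * c * M * (disp * mesh_size D))).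
      exact: ler_wpM2l.
    by rewrite mulrA.
  - rewrite distrC; apply: (le_trans e0); rewrite -/dL.
    (* This fixes [displacement]: 216 c^3 / (8 c^2) = 27 c. *)
    have -> : 27%:R * c * dL ^+ 2 = del * (4 * c ^+ 2)^-1 / 2.
      by rewrite /del /disp; field; rewrite gt_eqF.
    by rewrite ler_wpM2r // ler_wpM2l // ltW.
have Fp : 0 <= F del.
  have [T [E []]] := key 1 (normr1 _); rewrite !mul1r => -> h1 h2.
  by have [] := perturbed_sign h1 h2 (lexx _) (lexx _).
have Fm : F (- del) <= 0.
  have [T [E []]] := key (-1) (normrN1 _); rewrite !mulN1r => -> h1 h2.
  by have [] := perturbed_sign h1 h2 (lexx _) (lexx _).
have [d0 d0I Fd0] : exists2 d0, d0 \in `[- del, del] & F d0 = 0.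
  apply: IVT.
  - by apply: (@le_trans _ _ 0); [rewrite oppr_le0 ltW|exact: ltW].
  - exact: continuous_subspaceT.
  - by rewrite ge_min le_max Fm Fp orbT.
have d0d : `|d0| <= del by move: d0I; rewrite in_itv /= ler_norml.
(* If no root of smallest absolute value exists, [dh] is 0 by default. *)
rewrite /dh; case: xgetP => [d _ [_ /(_ d0) dmin]|_]; last by rewrite normr0 ltW.
by apply: le_trans d0d; apply: dmin; apply/eqP; rewrite -subr_eq0 -[_ - _]/(F d0) Fd0.
Qed.

Lemma dh_vertex n m L i : @dh R ks kq D n m L (vert L i) = 0.
Proof.
rewrite /dh; case: xgetP => [d _ [_ /(_ 0)]|//].
rewrite scale0r addr0 normr0 normr_le0 => /(_ _)/eqP; apply.
by rewrite (phihatK_vertex mesh (ds_phih ds)) (vertex_polyE mesh (ds_phih ds)).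
Qed.

(** 2 c bounds the discrete gradient; 1 + c^2 allows for an owner of the node whose diameter is up
    to c times that of [K]. *)
Definition node_displacement := disp * (2 * c) * (1 + c ^+ 2).
Local Notation disp2 := node_displacement.

Lemma node_displacement_ge0 : 0 <= disp2.
Proof.
have := displacement_gt0; rewrite /disp2 => d0.
by apply: mulr_ge0; [do 2 (apply: mulr_ge0 => //; try exact: ltW)|apply: addr_ge0 => //; exact: sqr_ge0].
Qed.
Let disp20 := node_displacement_ge0.
Hypotheses (s1 : 12%:R * c ^+ 2 * (mesh_size D + time_step D) <= 1)
  (s2 : disp * (2 * c) * mesh_size D <= 1) (s3 : 54%:R * c * M * disp * mesh_size D <= 1).

(** An owner [L] of the node may be larger than [K]. At vertices of [L] the displacement is 0; at
    any other node [L] and [K] share two vertices, and shape regularity bounds the diameter of [L]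
    by [c] times their distance. *)
Lemma node_image_bound n m K L (a : lag_index ks) : cut n K -> cut n L -> tet L (lag_node (vert K) a) ->
  enorm (@node_image R ks kq D n m L (lag_node (vert K) a) - lag_node (vert K) a)
    <= disp2 * diam (tet K) ^+ 2.
Proof.
set x := lag_node _ a => cK cL Lx.
have It : slab n (tau D n m) := ds_tau ds n m.
have Kx : tet K x by exact: tet_lag_node.
have nd := tet_nondegenerate mesh K.
rewrite /node_image addrAC subrr add0r enormZ.
have /andP[_ g2] := gradx_phihK_bounds s1 cL Lx It.
have base d : `|@dh R ks kq D n m L x| <= disp * d -> 0 <= d ->
   d <= (1 + c ^+ 2) * diam (tet K) ^+ 2 -> `|@dh R ks kq D n m L x| * enorm (gradx (phihK n L) (st x (tau D n m))) <= disp2 * diam (tet K) ^+ 2.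
  move=> h1 d0 h2; apply: (le_trans (ler_pM (normr_ge0 _) (enorm_ge0 _) h1 g2)).
  have -> : disp * d * (2 * c) = disp * (2 * c) * d by ring.
  have -> : disp2 * diam (tet K) ^+ 2 = disp * (2 * c) * ((1 + c ^+ 2) * diam (tet K) ^+ 2) by rewrite /disp2; ring.
  by rewrite ler_wpM2l // !mulr_ge0 // ltW.
have dK := diam_ge0 mesh K.
have [[i xi]|nvert] := pselect (exists i, x = vert L i).
  by apply: (base 0); rewrite ?xi ?dh_vertex ?normr0 ?mulr0 // mulr_ge0 ?sqr_ge0 // addr_ge0 ?sqr_ge0.
apply: (base (diam (tet L) ^+ 2)); [exact: dh_bound|exact: sqr_ge0|].
have [<-|KL] := eqVneq K L; first by rewrite ler_peMl ?sqr_ge0 // lerDl sqr_ge0.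
have LK : diam (tet L) <= c * diam (tet K).
  have [r [r0 gr dr]] := tet_radius mesh L; apply: (le_trans dr); rewrite ler_wpM2l ?(ltW c0) //.
  have [b1 b2] := bary_combine x nd.
  have pos i : bary (vert K) i x != 0 -> exists j, vert L j = vert K i.
    by move=> bi; apply: (common_vertex mesh KL Kx Lx); rewrite lt_def bi /=; move/(tetP mesh): Kx.
  have [i bi] : exists i, bary (vert K) i x != 0.
    apply: contrapT => H; have : \sum_j bary (vert K) j x = 0.
      by apply: big1 => j _; apply/eqP/negPn/negP => bj; apply: H; exists j.
    by rewrite b1 => /eqP; rewrite oner_eq0.
  have [j ji bj] : exists2 j, j != i & bary (vert K) j x != 0.
    apply: contrapT => H; have H0 j : j != i -> bary (vert K) j x = 0.
      by move=> ji; apply/eqP/negPn/negP => bj; apply: H; exists j.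
    apply: nvert; have [k ek] := pos i bi; exists k; rewrite ek.
    rewrite -{1}b2 (bigD1 i) //= big1 ?addr0 => [|j ji]; last by rewrite H0 // scale0r.
    move: b1; rewrite (bigD1 i) //= big1 ?addr0 => [->|j ji]; last by rewrite H0.
    by rewrite scale1r.
  have [i' ei] := pos i bi; have [j' ej] := pos j bj.
  have vv : vert L i' != vert L j'.
    by rewrite ei ej; apply/eqP => /(vert_inj mesh) ij; rewrite ij eqxx in ji.
  have vd := vertex_dist mesh r0 gr vv; apply: (le_trans vd).
  by rewrite ei ej; apply: (tet_diam mesh); exact: vert_tet mesh _ _.
apply: (@le_trans _ _ ((c * diam (tet K)) ^+ 2)).
  by rewrite lerXn2r ?nnegrE ?(diam_ge0 mesh) // mulr_ge0 // ltW.
by rewrite exprMn ler_wpM2r ?sqr_ge0 // lerDr.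
Qed.

Lemma node_average_bound n m K (a : lag_index ks) : cut n K ->
  enorm (@node_average R ks kq D n m (lag_node (vert K) a) - lag_node (vert K) a)
    <= disp2 * diam (tet K) ^+ 2.
Proof.
move=> cK; rewrite /node_average; set x := lag_node _ a; set ow := [pred L | _].
have owK : ow K by apply/andP; split; apply/mem_set => //; exact: tet_lag_node.
have N0 : (0 < #|ow|)%N by apply/card_gt0P; exists K.
have N0R : 0 < #|ow|%:R :> R by rewrite ltr0n.
have -> : #|ow|%:R^-1 *: (\sum_(L | ow L) @node_image R ks kq D n m L x) - x
    = #|ow|%:R^-1 *: \sum_(L | ow L) (@node_image R ks kq D n m L x - x).
  rewrite sumrB scalerBr sumr_const -[x *+ _]scaler_nat scalerA mulVf ?gt_eqF // scale1r //.
rewrite enormZ gtr0_norm ?invr_gt0 // mulrC ler_pdivrMr //.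
apply: (le_trans (enorm_sum _ _ _)).
apply: (@le_trans _ _ (\sum_(L | ow L) (disp2 * diam (tet K) ^+ 2))).
  by apply: ler_sum => L /andP[/set_mem cL /set_mem Lx]; exact: node_image_bound.
by rewrite sumr_const mulr_natr.
Qed.

Lemma ThetaNodeP n m K :
  (forall i, poly_fun ks (fun x => ThetaNode n m K x 0 i)) /\
  forall a : lag_index ks, ThetaNode n m K (lag_node (vert K) a) = @node_average R ks kq D n m (lag_node (vert K) a).
Proof.
have [p1 p2] : (forall i, poly_fun ks (fun x => ThetaNode n m K x 0 i)) /\
    forall x, lagrange_node ks K x -> ThetaNode n m K x = @node_average R ks kq D n m x.
  apply: (@xgetPex _ (fun=> 0 : 'rV[R]_3) [set p : 'rV[R]_3 -> 'rV[R]_3 |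
             (forall i, poly_fun ks (fun x => p x 0 i)) /\
             forall x, lagrange_node ks K x -> p x = @node_average R ks kq D n m x]).
  exists (fun x => \sum_(a : lag_index ks) lag_basis a (fun i => bary (vert K) i x) *: @node_average R ks kq D n m (lag_node (vert K) a)).
  split=> [i|_ /lagrange_nodeP[a ->]].
    rewrite (_ : (fun x => _) = fun x => \sum_(a : lag_index ks) (@node_average R ks kq D n m (lag_node (vert K) a)) 0 i *
       lag_basis a (fun i => bary (vert K) i x)).
      by apply: poly_fun_sum => a _; apply: poly_funZ; exact: poly_fun_lag_basis.
    by apply/funext => x; rewrite summxE; apply: eq_bigr => a _; rewrite mxE mulrC.
  have nb b : lag_basis b (fun i => bary (vert K) i (lag_node (vert K) a)) = (b == a)%:R.
    rewrite -(lag_basis_node _ b a) //; congr lag_basis; apply/funext => i.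
    by rewrite bary_lag_node //; exact: tet_nondegenerate mesh K.
  rewrite (bigD1 a) //= nb eqxx scale1r big1 ?addr0 // => b /negPf ba.
  by rewrite nb ba scale0r.
by split=> // a; apply: p2; exact: lag_node_lagrange.
Qed.

(** Each component of the deviation from the identity is a polynomial of degree [ks] with nodal
    values of order diam^2. Its Lipschitz bound costs 1 / r, and diam / r <= c leaves one power of
    the mesh size. *)
Lemma ThetaNode_near_id n m K x y : cut n K -> tet K x -> enorm (y - x) <= diam (tet K) ->
  enorm (ThetaNode n m K y - ThetaNode n m K x - (y - x))
    <= 3 * (M * disp2 * c * mesh_size D) * enorm (y - x).
Proof.
move=> cK Kx yx; have [pP pN] := ThetaNodeP n m K.
have -> : 3 * (M * disp2 * c * mesh_size D) * enorm (y - x) = (M * disp2 * c * mesh_size D * enorm (y - x)) *+ 3.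
  by rewrite -mulr_natr; ring.
apply: enorm_le_bound => i.
pose p w : R := ThetaNode n m K w 0 i + -1 * w 0 i.
have pp : poly_fun ks p.
  by apply: poly_funD => //; apply: poly_funZ; apply: poly_funW (poly_fun_coord _).
have [r [r0 gr dr]] := tet_radius mesh K.
have nb (a : lag_index ks) : `|p (lag_node (vert K) a)| <= disp2 * diam (tet K) ^+ 2.
  have := node_average_bound m a cK; apply: le_trans; rewrite -pN /p mulN1r.
  have := coord_le_enorm (ThetaNode n m K (lag_node (vert K) a) - lag_node (vert K) a) i.
  by rewrite !mxE.
have yB := near_tet_box Kx yx.
have xB : forall k, `|bary (vert K) k x| <= 1 + c.
  by apply: (near_tet_box Kx); rewrite subrr enorm0 (diam_ge0 mesh).
have [_ /(_ x xB) H] := lagM (tet_nondegenerate mesh K) r0 gr pp nb yB.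
have -> : (ThetaNode n m K y - ThetaNode n m K x - (y - x)) 0 i = p y - p x.
  by rewrite /p !mxE; ring.
apply: (le_trans H); rewrite ler_wpM2r ?enorm_ge0 //.
have dr' : diam (tet K) / r <= c by rewrite ler_pdivrMr.
have -> : M * (disp2 * diam (tet K) ^+ 2) / r = M * disp2 * ((diam (tet K) / r) * diam (tet K)) by ring.
rewrite -[leRHS]mulrA; apply: ler_wpM2l; first by apply: mulr_ge0 => //; exact: ltW.
apply: ler_pM => //; [|exact: (diam_ge0 mesh)|exact: diam_le_mesh].
by apply: divr_ge0; [exact: (diam_ge0 mesh)|exact: ltW].
Qed.

(** The difference has degree at most [kq] and [kq.+1] roots. It allows the identity to be
    subtracted separately at each time node. *)
Lemma time_basis_sum n t : \sum_(m < kq.+1) @time_basis R kq D n m t = 1.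
Proof.
have tinj (i j : 'I_kq.+1) : tau D n i = tau D n j -> i = j := @ds_tau_inj _ _ _ _ _ _ ds n i j.
pose ell (m : 'I_kq.+1) : {poly R} :=
  \prod_(j < kq.+1 | j != m) ((tau D n m - tau D n j)^-1 *: ('X - (tau D n j)%:P)).
have ellE m s : (ell m).[s] = time_basis n m s.
  rewrite /ell horner_prod; apply: eq_bigr => j _.
  by rewrite hornerZ hornerXsubC mulrC.
pose p := \sum_m ell m - 1.
suff : p = 0.
  move=> p0; have : p.[t] = 0 by rewrite p0 horner0.
  rewrite /p hornerD hornerN hornerC horner_sum => /eqP; rewrite subr_eq0 => /eqP <-.
  by apply: eq_bigr => m _; rewrite ellE.
apply/eqP/negPn/negP => p0.
have sz : (size p <= kq.+1)%N.
  apply: (leq_trans (size_polyD _ _)); rewrite size_polyN size_poly1 geq_max /= andbT.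
  apply: (leq_trans (size_sum _ _ _)); apply/bigmax_leqP => m _.
  apply: (leq_trans (size_prod_leq _ _)); rewrite leq_subLR.
  apply: (@leq_trans (\sum_(j < kq.+1 | j != m) 2).+1).
    by rewrite ltnS; apply: leq_sum => j _; apply: (leq_trans (size_scale_leq _ _)); rewrite size_XsubC.
  rewrite sum_nat_const muln2 -addnn -addSn addnC; apply: leq_add => //.
  by rewrite ltnS cardC1 card_ord leqnn.
pose s := map (fun m : 'I_kq.+1 => tau D n m) (enum 'I_kq.+1).
have : (size s < size p)%N.
  apply: max_poly_roots p0 _ _.
    apply/allP => _ /mapP[k _ ->]; rewrite rootE /p hornerD hornerN hornerC horner_sum.
    rewrite (bigD1 k) //= big1 => [|j jk].
      rewrite addr0 /ell horner_prod big1 ?subrr // => j jk.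
      rewrite hornerZ hornerXsubC mulVf // subr_eq0; by apply: contraNneq jk => /tinj ->.
    rewrite /ell horner_prod (bigD1 k) /=; last by rewrite eq_sym.
    by rewrite hornerZ hornerXsubC subrr mulr0 mul0r.
  by rewrite map_inj_uniq ?enum_uniq // => i j /tinj.
by rewrite size_map size_enum_ord ltnNge sz.
Qed.

Lemma Theta_near_id n K x y t : cut n K -> tet K x -> slab n t -> enorm (y - x) <= diam (tet K) ->
  enorm (xpart (@ThetaK R ks kq D n K (st y t)) - xpart (@ThetaK R ks kq D n K (st x t)) - (y - x))
    <= kq.+1%:R * c * (3 * (M * disp2 * c)) * mesh_size D * enorm (y - x).
Proof.
move=> cK Kx It yx; rewrite /ThetaK !xpart_st !tpart_st.
have -> : \sum_(m < kq.+1) @time_basis R kq D n m t *: ThetaNode n m K y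
   - \sum_(m < kq.+1) @time_basis R kq D n m t *: ThetaNode n m K x - (y - x)
   = \sum_(m < kq.+1) @time_basis R kq D n m t *: (ThetaNode n m K y - ThetaNode n m K x - (y - x)).
  rewrite -[y - x in LHS]scale1r -(time_basis_sum n t) scaler_suml -!sumrB.
  by apply: eq_bigr => m _; rewrite -!scalerBr.
apply: (le_trans (enorm_sum _ _ _)).
apply: (@le_trans _ _ (\sum_(m < kq.+1) c * (3 * (M * disp2 * c * mesh_size D) * enorm (y - x)))).
  apply: ler_sum => m _; rewrite enormZ; apply: ler_pM => //; first exact: enorm_ge0.
    exact: (ds_tau_bound ds).
  exact: ThetaNode_near_id.
rewrite sumr_const card_ord -[leLHS]mulr_natl le_eqVlt; apply/orP; left; apply/eqP; ring.
Qed.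

End Deformation.

(** * Orthogonality in three dimensions *)

Section LinearAlgebra.
Context {R : realType}.

Lemma kernel_nontrivial (n k : nat) (A : 'M[R]_(n, k)) : (k < n)%N ->
  exists2 v : 'rV[R]_n, v != 0 & v *m A = 0.
Proof.
move=> kn; have : kermx A != 0.
  rewrite -mxrank_eq0 mxrank_ker -lt0n subn_gt0.
  exact: leq_ltn_trans (rank_leq_col A) kn.
by move=> /rowV0Pn[v /sub_kermxP vA v0]; exists v.
Qed.

Lemma perp_parallel (e f p q : 'rV[R]_3) :
  (forall a b, a *: e + b *: f = 0 -> a = 0 /\ b = 0) -> p != 0 ->
  dotp p e = 0 -> dotp p f = 0 -> dotp q e = 0 -> dotp q f = 0 ->
  q = (dotp q p / dotp p p) *: p.
Proof.
move=> ef p0 pe pf qe qf; have pp : dotp p p != 0 by rewrite dotp_eq0.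
pose N : 'M[R]_(1 + 1 + 1) := col_mx (col_mx e f) p.
have Nu : N \in unitmx.
  rewrite -row_free_unit -kermx_eq0; apply/rowV0P => v /sub_kermxP.
  rewrite -(hsubmxK (v : 'rV_((1 + 1) + 1))) -(hsubmxK (lsubmx (v : 'rV_((1 + 1) + 1)))) !mul_row_col.
  set a := lsubmx (lsubmx _); set b := rsubmx (lsubmx _); set d := rsubmx _.
  rewrite [a]mx11_scalar [b]mx11_scalar [d]mx11_scalar !mul_scalar_mx => v0.
  have d0 : d 0 0 = 0.
    have := congr1 (dotp p) v0; rewrite !dotpE pe pf !mulr0 !add0r => /eqP.
    by rewrite mulf_eq0 (negPf pp) orbF => /eqP.
  move: v0; rewrite d0 scale0r addr0 => /ef[-> ->].
  by rewrite !raddf0 !row_mx0.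
apply/eqP; rewrite -subr_eq0; set r := q - _.
have rp : dotp r p = 0 by rewrite dotpBl dotpZl mulfVK // subrr.
have re : dotp r e = 0 by rewrite dotpBl dotpZl qe pe mulr0 subr0.
have rf : dotp r f = 0 by rewrite dotpBl dotpZl qf pf mulr0 subr0.
have dot0 (x : 'rV[R]_3) : dotp r x = 0 -> r *m x^T = 0.
  by move=> rx; apply/matrixP => i j; rewrite !ord1 -dotp_mulmx rx mxE.
have rN : r *m N^T = 0.
  by rewrite !tr_col_mx !mul_mx_row !dot0 // !row_mx0.
have NTu : N^T \in unitmx by rewrite unitmx_tr.
by have := mulmxK NTu r; rewrite rN mul0mx => <-.
Qed.

Lemma independent_perp (e f : 'rV[R]_3) : e != 0 -> f != 0 -> dotp e f = 0 ->
  forall a b, a *: e + b *: f = 0 -> a = 0 /\ b = 0.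
Proof.
move=> e0 f0 ef a b h; have := congr1 (dotp e) h; have := congr1 (dotp f) h.
rewrite !dotpE (dotpC f e) ef !mulr0 add0r addr0 => /eqP + /eqP.
by rewrite !mulf_eq0 !dotp_eq0 (negPf e0) (negPf f0) !orbF => /eqP -> /eqP ->.
Qed.

End LinearAlgebra.

(** * Choice of the mesh threshold *)

Section MeshEstimates.
Context {R : realType}.

Lemma small_step (C c : R) : 0 < C -> 0 < c -> exists2 h : R, 0 < h & h <= 1 /\ C * h <= c.
Proof.
move=> C0 c0; exists (Num.min 1 (c / C)); first by rewrite lt_min ltr01 divr_gt0.
split; first by rewrite ge_min lexx.
by rewrite mulrC -ler_pdivlMr // ge_min lexx orbT.
Qed.

Lemma mesh_estimates (P : problem R) (ks kq : nat) (c eta : R) : (1 <= ks)%N -> (1 <= kq)%N ->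
  continuous_setting P ks kq c -> 0 < eta ->
  exists2 h0 : R, 0 < h0 & forall D : discretization R, discrete_setting ks kq D P c ->
    mesh_size D <= h0 -> time_step D <= h0 ->
    c * (mesh_size D ^+ ks + time_step D ^+ kq) <= 2^-1 /\
    forall n K x t, Defs.cut ks kq n K -> tet K x -> slab n t ->
      let f := gradx (phi P) (st x t) in
      [/\ 0 < enorm f, enorm (hat_grad ks kq n K t - f) <= eta * enorm f
      & forall y, enorm (y - x) <= diam (tet K) ->
        enorm (xpart (@ThetaK R ks kq D n K (st y t)) - xpart (@ThetaK R ks kq D n K (st x t)) - (y - x))
          <= eta * enorm (y - x)].
Proof.
move=> ks1 kq1 cont eta0; have c0 := cs_const cont.
have [|M M0 lagM] := @lagrange_bound R ks ks1 (1 + c); first by rewrite addr_ge0 // ltW.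
set disp := displacement c; have disp0 : 0 < disp by exact: displacement_gt0 cont.
set disp2 := node_displacement c.
have disp20 : 0 < disp2 by apply: mulr_gt0; [do 2 (apply: mulr_gt0 => //)|rewrite ltr_wpDr ?sqr_ge0].
(* Constants that multiply the sum of mesh size and time step carry an extra factor 2, because each
   of the two is bounded by the same threshold. *)
have C10 : 0 < 24%:R * c ^+ 2 by rewrite mulr_gt0 // exprn_gt0.
have C20 : 0 < disp * (2 * c) by do 2 (apply: mulr_gt0 => //).
have C30 : 0 < 54%:R * c * M * disp by do 3 (apply: mulr_gt0 => //).
have C40 : 0 < 2 * (108%:R * c ^+ 2 + 3 * c) by rewrite mulr_gt0 // addr_gt0 // mulr_gt0 // exprn_gt0.
have C50 : 0 < kq.+1%:R * c * (3 * (M * disp2 * c)).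
  apply: mulr_gt0; first by apply: mulr_gt0 => //; exact: ltr0Sn.
  by apply: mulr_gt0 => //; apply: mulr_gt0 => //; exact: mulr_gt0.
have C60 : 0 < 2 * c by rewrite mulr_gt0.
have ec : 0 < eta * c^-1 by rewrite mulr_gt0 // invr_gt0.
have i2 : 0 < 2^-1 :> R by [].
have [h1 h10 [h11 H1]] := small_step C10 ltr01.
have [h2 h20 [h21 H2]] := small_step C20 ltr01.
have [h3 h30 [h31 H3]] := small_step C30 ltr01.
have [h4 h40 [h41 H4]] := small_step C40 ec.
have [h5 h50 [h51 H5]] := small_step C50 eta0.
have [h6 h60 [h61 H6]] := small_step C60 i2.
exists (Num.min h1 (Num.min h2 (Num.min h3 (Num.min h4 (Num.min h5 h6))))).
  by rewrite !lt_min h10 h20 h30 h40 h50 h60.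
move=> D ds; rewrite !le_min => /and5P[m1 m2 m3 m4 /andP[m5 m6]] /and5P[t1 t2 t3 t4 /andP[t5 t6]].
have mm1 : mesh_size D <= 1 := le_trans m1 h11.
have tt1 : time_step D <= 1 := le_trans t1 h11.
have mg := mesh_size_ge0 D; have tg := time_step_ge0 D.
have two (C h b : R) : 0 <= C -> 2 * C * h <= b -> mesh_size D <= h -> time_step D <= h ->
    C * (mesh_size D + time_step D) <= b.
  move=> C0 Cb mh th; apply: le_trans Cb; rewrite -mulrA mulrCA ler_wpM2l //.
  by rewrite mulr_natl mulr2n lerD.
have one (C h b : R) : 0 <= C -> C * h <= b -> mesh_size D <= h -> C * mesh_size D <= b.
  by move=> C0 Cb mh; apply: le_trans Cb; rewrite ler_wpM2l.
have s1 : 12%:R * c ^+ 2 * (mesh_size D + time_step D) <= 1.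
  apply: (two _ h1) => //; first by rewrite mulr_ge0 // sqr_ge0.
  by apply: le_trans H1; rewrite !mulrA -natrM.
have s2 := one _ _ _ (ltW C20) H2 m2; have s3 := one _ _ _ (ltW C30) H3 m3.
split.
  apply: (@le_trans _ _ (c * (mesh_size D + time_step D))); last by apply: (two _ h6) => //; exact: ltW.
  by rewrite ler_wpM2l ?(ltW c0) // lerD // ler_iXnr.
move=> n K x t cK Kx It f.
have /andP[f1 f2] := phi_grad_bounds cont ds cK Kx It.
split.
- by apply: lt_le_trans f1; rewrite invr_gt0.
- apply: (le_trans (hat_grad_accuracy ks1 cont ds mm1 tt1 cK Kx It)).
  apply: (@le_trans _ _ (eta * c^-1)); last by rewrite ler_wpM2l // ltW.
  by apply: (two _ h4) => //; rewrite addr_ge0 // mulr_ge0 ?sqr_ge0 // ltW.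
- move=> y yx; apply: (le_trans (Theta_near_id ks1 cont ds mm1 tt1 M0 lagM s1 s2 s3 cK Kx It yx)).
  rewrite ler_wpM2r ?enorm_ge0 //; exact: one (ltW C50) H5 m5.
Qed.

End MeshEstimates.
(** * Pieces and their zero sets *)

Section LocalDeformation.
Context {R : realType} (P : problem R) (ks kq : nat) (c eta : R).
Hypothesis ks_ge1 : (1 <= ks)%N.
Context (D : discretization R).
Hypothesis ds : discrete_setting ks kq D P c.
Variable n : 'I_(nslab D).
Hypothesis eta_lt1 : eta < 1.
Implicit Types (K L : 'I_(ntet D)) (x u : 'rV[R]_3) (t : R) (w y z v : 'rV[R]_(3 + 1)).
Local Notation cut := (Defs.cut ks kq n).
Local Notation phihK := (phihK ks kq n).
Local Notation phihatK := (phihatK ks kq n).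
Local Notation ThetaK := (@ThetaK R ks kq D n).
Local Notation Theta := (@Theta R ks kq D n).
Hypothesis Theta_id : forall K x (y : 'rV[R]_3) t, cut K -> tet K x -> slab n t -> enorm (y - x) <= diam (tet K) ->
  enorm (xpart (ThetaK K (st y t)) - xpart (ThetaK K (st x t)) - (y - x)) <= eta * enorm (y - x).
Hypothesis hat_grad_neq0 : forall K x t, cut K -> tet K x -> slab n t -> hat_grad ks kq n K t != 0.
Let mesh := ds_mesh ds.
Let incr := tg_incr (ds_time ds).

Lemma time_basis_poly (m : 'I_kq.+1) : exists p : {poly R}, forall t, @time_basis R kq D n m t = p.[t].
Proof.
exists (\prod_(j < kq.+1 | j != m) ((tau D n m - tau D n j)^-1 *: ('X - (tau D n j)%:P))) => t.
rewrite horner_prod; apply: eq_bigr => j _.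
by rewrite hornerZ hornerXsubC mulrC.
Qed.

Lemma tpart_differentiable z : differentiable (@tpart R) z.
Proof.
have := poly_differentiable_tpart 'X z.
by rewrite (_ : (fun y => _) = @tpart R) //; apply/funext => y; rewrite hornerX.
Qed.

Lemma ThetaK_differentiable K z i : differentiable (fun y => ThetaK K y 0 i) z.
Proof.
case: (split_ordP i) => j ->; last first.
  rewrite (_ : (fun y => _) = @tpart R); first exact: tpart_differentiable.
  by apply/funext => y; rewrite /Defs.ThetaK ord1 -[rshift 3 _]/tdir st_tdir.
rewrite (_ : (fun y => _) = fun y => \sum_(m < kq.+1) @time_basis R kq D n m (tpart y) *
    @ThetaNode R ks kq D n m K (xpart y) 0 j); last first.
  apply/funext => y; rewrite /Defs.ThetaK -[lshift 1 j]/(xdir j) st_xdir summxE.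
  by apply: eq_bigr => m _; rewrite mxE.
apply: differentiable_sum_fun => m; apply: differentiableM.
  have [p pP] := time_basis_poly m; rewrite (_ : (fun y => _) = fun y => p.[tpart y]).
    exact: poly_differentiable_tpart.
  by apply/funext => y; rewrite pP.
apply: (@differentiable_xpart _ (fun x => @ThetaNode R ks kq D n m K x 0 j)).
have [pT _] := ThetaNodeP ks_ge1 ds n m K.
exact: poly_fun_differentiable (pT j).
Qed.

Definition jac_tr K z : 'M[R]_(3 + 1) := (jac (ThetaK K) z)^T.

Lemma jac_trP K z e : 0 < e -> exists2 d, 0 < d & forall y : 'rV[R]_(3 + 1), enorm (y - z) < d ->
  enorm (ThetaK K y - ThetaK K z - (y - z) *m jac_tr K z) <= e * enorm (y - z).
Proof. by apply: differentiable_jac => i; exact: ThetaK_differentiable. Qed.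

Lemma tpart_jac_tr K z v : tpart (v *m jac_tr K z) = tpart v.
Proof.
have tE y : tpart y = y 0 tdir by rewrite -{2}(st_parts y) st_tdir.
have -> : tpart (v *m jac_tr K z) = dotp (grad (fun y => ThetaK K y 0 tdir) z) v.
  by rewrite tE mxE; apply: eq_bigr => j _; rewrite !mxE mulrC.
rewrite -derive_grad; last exact: ThetaK_differentiable.
rewrite (_ : (fun y => _) = @tpart R); last by apply/funext => y; rewrite st_tdir.
apply/cvg_lim => //; apply: cvg_near_cst; near=> h.
have h0 : h != 0 by near: h; exact: nbhs_dnbhs_neq.
by rewrite /= tpartD addrK tpartZ /GRing.scale/= mulrA mulVf // mul1r.
Unshelve. all: by end_near. Qed.

Lemma jac_tr_near_id K x t u : cut K -> tet K x -> slab n t ->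
  enorm (xpart (st u 0 *m jac_tr K (st x t)) - u) <= eta * enorm u.
Proof.
move=> cK Kx It; have [->|u0] := eqVneq u 0.
  by rewrite st0 mul0mx subr0 -[xpart 0]/(lsubmx 0) raddf0 enorm0 mulr0.
have nu : 0 < enorm u by rewrite enorm_gt0.
apply/ler_addgt0Pr => e e0; have eu : 0 < e / enorm u by rewrite divr_gt0.
have [d d0 dP] := jac_trP K (st x t) eu.
have dK0 : 0 < diam (tet K) by exact: (diam_gt0 ds).
pose s := Num.min d (diam (tet K)) / 2 / enorm u.
have m0 : 0 < Num.min d (diam (tet K)) by rewrite lt_min d0.
have s0 : 0 < s by rewrite !divr_gt0.
have su : s * enorm u = Num.min d (diam (tet K)) / 2 by rewrite /s mulfVK ?gt_eqF.
have su1 : s * enorm u < Num.min d (diam (tet K)) by rewrite su ltr_pdivrMr // ltr_pMr // ltr1n.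
have nsu : enorm (s *: u) = s * enorm u by rewrite enormZ gtr0_norm.
have xs : st (x + s *: u) t - st x t = s *: st u 0.
  by rewrite -stB addrAC subrr add0r subrr -stZ mulr0.
have h1 : enorm (ThetaK K (st (x + s *: u) t) - ThetaK K (st x t) - s *: st u 0 *m jac_tr K (st x t))
    <= e / enorm u * (s * enorm u).
  have := dP (st (x + s *: u) t); rewrite xs enormZ gtr0_norm // enorm_st0; apply.
  by apply: lt_le_trans su1 _; rewrite ge_min lexx.
have h2 : enorm (xpart (ThetaK K (st (x + s *: u) t)) - xpart (ThetaK K (st x t)) - s *: u)
    <= eta * (s * enorm u).
  have := Theta_id (y := x + s *: u) cK Kx It; rewrite addrAC subrr add0r nsu; apply.
  by apply/ltW/(lt_le_trans su1); rewrite ge_min lexx orbT.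
have h3 := le_trans (enorm_xpart _) h1.
rewrite !xpartB -scalemxAl xpartZ in h3.
rewrite -(ler_pM2l s0) -{1}(gtr0_norm s0) -enormZ scalerBr.
set A := xpart (ThetaK K (st (x + s *: u) t)) - xpart (ThetaK K (st x t)) in h2 h3.
set B := s *: xpart _ in h3 *.
have -> : B - s *: u = (A - s *: u) - (A - B).
  by rewrite opprB [RHS]addrC addrA subrK.
apply: (le_trans (enormB _ _)); apply: (le_trans (lerD h2 h3)).
rewrite le_eqVlt; apply/orP; left; apply/eqP; field.
by rewrite enorm_eq0.
Qed.

(** The deformation preserves time, so a kernel vector is spatial, and in space the matrix differs
    from the identity by less than 1. *)
Lemma jac_tr_unit K x t : cut K -> tet K x -> slab n t -> jac_tr K (st x t) \in unitmx.
Proof.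
move=> cK Kx It; rewrite -row_free_unit -kermx_eq0; apply/rowV0P => v /sub_kermxP vM.
have tv : tpart v = 0 by rewrite -(tpart_jac_tr K (st x t)) vM /tpart linear0 mxE.
rewrite -(st_parts v) tv; apply/eqP; rewrite -enorm_eq0 enorm_st0.
have H := jac_tr_near_id (xpart v) cK Kx It; rewrite -{1}tv st_parts vM in H.
rewrite -[xpart 0]/(lsubmx 0) raddf0 sub0r enormN in H.
have : (1 - eta) * enorm (xpart v) <= 0 by lra.
by rewrite pmulr_rle0 ?subr_gt0 // => h; apply/eqP/le_anti/andP; split=> //; exact: enorm_ge0.
Qed.

Lemma ThetaK_lipschitz K z : exists2 C, 0 < C & exists2 d, 0 < d &
  forall y, enorm (y - z) < d -> enorm (ThetaK K y - ThetaK K z) <= C * enorm (y - z).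
Proof.
have [C C0 CP] := enorm_mulmx (jac_tr K z); have [d d0 dP] := jac_trP K z ltr01.
exists (1 + C); first by rewrite addr_gt0.
exists d => // y /dP H; rewrite mulrDl -[ThetaK K y - _](subrK ((y - z) *m jac_tr K z)).
by apply: (le_trans (enormD _ _)); apply: lerD.
Qed.

Lemma within_continuous_eps (m k : nat) (A : set 'rV[R]_m) (f : 'rV[R]_m -> 'rV[R]_k) (a : 'rV[R]_m) e :
  {within A, continuous f} -> A a -> 0 < e ->
  exists2 d, 0 < d & forall b : 'rV[R]_m, A b -> enorm (b - a) < d -> enorm (f b - f a) < e.
Proof.
move=> /subspace_continuousP H Az e0; have ek : 0 < e / k.+1%:R by rewrite divr_gt0.
have /cvgrPdist_lt/(_ _ ek) := H _ Az; rewrite near_withinE.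
move=> /enorm_ball_nbhs[d d0 dP]; exists d => // y Ay yd.
apply: (le_lt_trans (enorm_le_norm _)); rewrite distrC.
apply: (@le_lt_trans _ _ (`|f a - f y| * k.+1%:R)).
  by rewrite -[leLHS]mulr_natr ler_wpM2l // ler_nat.
by rewrite -ltr_pdivlMr //; exact: dP.
Qed.

Lemma QS_prism K z : cut K -> prism n K z -> QS ks kq n z.
Proof. by move=> cK [Kx It]; split=> //; exists K. Qed.

Lemma Theta_interior K x t : cut K -> (tet K)^° x -> slab n t -> Theta (st x t) = ThetaK K (st x t).
Proof.
move=> cK Kx It; have Kx' : tet K x by exact: interior_subset.
have [L [cL Lz ->]] : exists L, [/\ cut L, prism n L (st x t) & Theta (st x t) = ThetaK L (st x t)].
  apply: (@xgetPex _ (0 : 'rV[R]_(3 + 1)) [set y | exists K, [/\ cut K, prism n K (st x t) & y = ThetaK K (st x t)]]).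
  by exists (ThetaK K (st x t)), K; split=> //; apply/prism_st.
have [->//|KL] := eqVneq K L; exfalso.
by apply: (interior_tet_disjoint mesh KL Kx); case/prism_st: Lz.
Qed.

(** On shared faces [Theta] picks the value of an arbitrary owner. In the interior of [K] the owner
    is unique, and the assumed continuity of [Theta] extends the formula to the closed prism. *)
Lemma Theta_prism K z : cut K -> prism n K z -> Theta z = ThetaK K z.
Proof.
move=> cK Kz; apply/eqP; rewrite -subr_eq0 -enorm_eq0; apply/eqP/le_anti; rewrite enorm_ge0 andbT.
apply/ler_addgt0Pr => e e0; rewrite add0r; have e2 : 0 < e / 2 by rewrite divr_gt0.
have [cTheta _] := ds_homeo ds n.
have [d1 d10 H1] := within_continuous_eps cTheta (QS_prism cK Kz) e2.
have [C C0 [d2 d20 H2]] := ThetaK_lipschitz K z.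
have dm : 0 < Num.min d1 (Num.min d2 (e / 2 / C)) by rewrite !lt_min d10 d20 divr_gt0.
have [x [t [Kx It]]] := prism_interior_approx ds Kz dm.
rewrite !lt_min => /and3P[y1 y2 y3].
have It' : slab n t by case/andP: It => ? ?; rewrite /slab /= in_itv /= !ltW.
have Kz' : prism n K (st x t) by apply/prism_st; split=> //; exact: interior_subset.
have h1 := H1 _ (QS_prism cK Kz') y1; rewrite (Theta_interior cK Kx It') in h1.
have h2 := H2 _ y2.
have h3 : C * enorm (st x t - z) <= e / 2 by rewrite mulrC -ler_pdivlMr // ltW.
apply: (le_trans (enorm_dist _ (ThetaK K (st x t)) _)); rewrite enorm_distC.
by rewrite [leRHS](splitr e); apply: lerD; [exact: ltW|exact: le_trans h2 h3].
Qed.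

Lemma Theta_inj z z' : QS ks kq n z -> QS ks kq n z' -> Theta z = Theta z' -> z = z'.
Proof. by have [_ [g [_ gP]]] := ds_homeo ds n => /gP + /gP => {2}<- {2}<- ->. Qed.

Definition zero_set K : set 'rV[R]_(3 + 1) := [set z | prism n K z /\ phihatK K z = 0].

Lemma phihatK_prism K L z : prism n K z -> prism n L z -> phihatK K z = phihatK L z.
Proof.
move=> [Kx _] [Lx _]; rewrite -(st_parts z).
exact: (phihatK_consistent mesh (ds_phih ds) incr n (tpart z) Kx Lx).
Qed.

(** A point of the deformed prism on the discrete surface has two preimages by definition, one in
    the prism and one on the zero set; injectivity of [Theta] makes them equal. *)
Lemma pieceE K : cut K -> piece ks kq n K = ThetaK K @` zero_set K.
Proof.
move=> cK; apply/seteqP; split=> y.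
  move=> [[z Kz <-] [z' [[L [Lz' fz']] Qz'] e]].
  have zz : z' = z by apply: Theta_inj e => //; exact: QS_prism cK Kz.
  exists z; last by rewrite (Theta_prism cK Kz).
  by split=> //; rewrite -fz' zz; apply: phihatK_prism => //; rewrite -zz.
move=> [z [Kz fz] <-]; rewrite -(Theta_prism cK Kz); split; first by exists z.
by exists z => //; split; [exists K|exact: QS_prism cK Kz].
Qed.

Lemma interior_faceP K1 K2 F y : interior_face ks kq n K1 K2 F -> F y ->
  exists z, [/\ prism n K1 z, prism n K2 z, phihatK K1 z = 0 & y = ThetaK K1 z].
Proof.
move=> [c1 c2 _ ->] [[[z1 [K1z _] e1] [z [[L [Lz fz]] Qz] e]] [[z2 [K2z _] e2] _]].
have q1 : z = z1 by apply: Theta_inj; rewrite ?e ?e1 //; exact: QS_prism c1 K1z.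
have q2 : z = z2 by apply: Theta_inj; rewrite ?e ?e2 //; exact: QS_prism c2 K2z.
have K1z' : prism n K1 z by rewrite q1.
have K2z' : prism n K2 z by rewrite q2.
exists z; split=> //; last by rewrite -(Theta_prism c1 K1z').
by rewrite -fz; exact: phihatK_prism.
Qed.

Lemma Theta_inverse_eps K z d : cut K -> prism n K z -> 0 < d -> exists2 r, 0 < r &
  forall y, zero_set K y -> enorm (ThetaK K y - ThetaK K z) < r -> enorm (y - z) < d.
Proof.
move=> cK Kz d0; have [_ [g [cg gP]]] := ds_homeo ds n.
have Qz := QS_prism cK Kz.
have [|r r0 rP] := within_continuous_eps cg (a := Theta z) _ d0; first by exists z.
exists r => // y [Ky _]; have Qy := QS_prism cK Ky.
rewrite -(Theta_prism cK Ky) -(Theta_prism cK Kz) => /rP.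
by rewrite !gP //; apply; exists y.
Qed.

Lemma piece_cone K z w : cut K -> prism n K z ->
  tangent_cone (piece ks kq n K) (ThetaK K z) w <->
  tangent_cone (zero_set K) z (w *m invmx (jac_tr K z)).
Proof.
move=> cK Kz; have Mu : jac_tr K z \in unitmx.
  by rewrite -(st_parts z); case: Kz => Kx It; exact: jac_tr_unit.
rewrite pieceE //; split => [|H].
  apply: tangent_cone_preimage => //; first exact: jac_trP.
  by move=> d d0; exact: Theta_inverse_eps.
rewrite -[w](mulmxKV Mu); apply: tangent_cone_image => //; exact: jac_trP.
Qed.

Lemma zero_set_cone_grad K z v : zero_set K z -> tangent_cone (zero_set K) z v ->
  dotp (grad (phihatK K) z) v = 0.
Proof.
move=> [_ fz]; apply: tangent_cone_eq; first exact: (phihatK_differentiable mesh (ds_phih ds)).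
by move=> y [_ ->].
Qed.

(** The inverse transpose in the definition of the normal cancels the derivative of the
    deformation. *)
Lemma dotp_nShK K z v : jac_tr K z \in unitmx ->
  dotp (nShK ks kq n K z) (v *m jac_tr K z) =
  (enorm (grad (phihatK K) z *m (invmx (jac_tr K z))^T))^-1 * dotp (grad (phihatK K) z) v.
Proof.
move=> Mu; rewrite /nShK /normalize dotpZl.
have e : ((invmx (jac (ThetaK K) z))^T *m (grad (phihatK K) z)^T)^T
    = grad (phihatK K) z *m (invmx (jac_tr K z))^T.
  by rewrite trmx_mul !trmxK -trmx_inv trmxK.
rewrite e; congr (_ * _); rewrite !dotp_mulmx trmx_mul -mulmxA (mulmxA (_^T)) -trmx_mul mulmxV //.
by rewrite trmx1 mul1mx.
Qed.

Lemma grad_phihatK_neq0 K x t : cut K -> tet K x -> slab n t -> grad (phihatK K) (st x t) != 0.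
Proof.
move=> cK Kx It; have := hat_grad_neq0 cK Kx It; apply: contra_neq => g0.
apply/eqP; rewrite -dotp_eq0.
by rewrite -{1}(tpart_st x t) -(grad_phihatK_x mesh (ds_phih ds)) g0 dotp0l.
Qed.

(* [v |-> v *m jac_tr K z] maps the tangent cone of the zero set of the linear
   interpolant onto that of the piece, so both are half-spaces, and the normal
   of the latter is the discrete normal. *)
Lemma conormal_chart K z nu : cut K -> zero_set K z ->
  outer_conormal (piece ks kq n K) (ThetaK K z) nu ->
  [/\ enorm nu = 1, enorm (nShK ks kq n K z) = 1, dotp (nShK ks kq n K z) nu = 0,
   exists2 k : R, 0 < k & forall v, dotp (nShK ks kq n K z) (v *m jac_tr K z) = k * dotp (grad (phihatK K) z) v
   & forall v, tangent_cone (zero_set K) z v <->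
       dotp (grad (phihatK K) z) v = 0 /\ dotp (v *m jac_tr K z) nu <= 0].
Proof.
move=> cK [Kz fz] [nu1 [m [m1 num T]]].
have Mu : jac_tr K z \in unitmx by rewrite -(st_parts z); case: Kz => Kx It; exact: jac_tr_unit.
set nn := nShK ks kq n K z; set g := grad (phihatK K) z; set M := jac_tr K z in Mu *.
have g0 : g != 0 by rewrite /g -(st_parts z); case: Kz => Kx It; exact: grad_phihatK_neq0.
have gM0 : g *m (invmx M)^T != 0.
  apply: contra_neq g0 => e; apply: (can_inj (mulmxK (_ : (invmx M)^T \in unitmx))).
    by rewrite unitmx_tr unitmx_inv.
  by rewrite e mul0mx.
have k0 : 0 < (enorm (g *m (invmx M)^T))^-1 by rewrite invr_gt0 enorm_gt0.
have nn1 : enorm nn = 1.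
  rewrite /nn /nShK normalize_id (_ : (_ *m _)^T = g *m (invmx M)^T) ?gM0 //.
  by rewrite trmx_mul !trmxK -trmx_inv trmxK.
have nM v : dotp nn (v *m M) = (enorm (g *m (invmx M)^T))^-1 * dotp g v by exact: dotp_nShK.
have half w : dotp w m = 0 -> dotp w nu <= 0 -> dotp w nn = 0.
  move=> wm wnu; have : tangent_cone (piece ks kq n K) (ThetaK K z) w by rewrite T.
  move=> /(piece_cone _ cK Kz) /zero_set_cone_grad e.
  rewrite dotpC -[w](mulmxKV Mu) nM -/M; rewrite -/M -/g in e; rewrite e ?mulr0 //.
have [nm nm0] := halfspace_normal m1 nn1 half.
have perp w : (dotp w m = 0) <-> (dotp w nn = 0).
  rewrite nm dotpZr; split=> [->|/eqP]; first by rewrite mulr0.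
  by rewrite mulf_eq0 (negPf nm0) => /eqP.
split=> //.
- by rewrite dotpC; apply/perp.
- by exists (enorm (g *m (invmx M)^T))^-1.
- move=> v; rewrite -{1}[v](mulmxK Mu); apply: (iff_trans (iff_sym (piece_cone _ cK Kz))).
  rewrite T /=; split=> -[h1 h2]; split=> //.
    have /perp := h1; rewrite dotpC nM => /eqP; rewrite mulf_eq0 gt_eqF //= => /eqP //.
  by apply/perp; rewrite dotpC nM h1 mulr0.
Qed.

End LocalDeformation.

(** * Functions that increase through each zero *)

Section Crossing.
Context {R : realType}.

(** The function is positive just after 0. The infimum m of the later points where it is not
    positive is a zero, yet just before m it is positive, where crossing upwards requires it to be
    negative. *)
Lemma single_crossing (f : R -> R) :
  (forall r, 0 <= r <= 1 -> forall e, 0 < e -> exists2 d, 0 < d &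
     forall s, 0 <= s <= 1 -> `|s - r| < d -> `|f s - f r| < e) ->
  (forall r, 0 <= r <= 1 -> f r = 0 -> exists2 d, 0 < d &
     forall s, 0 <= s <= 1 -> s != r -> `|s - r| < d -> 0 < (s - r) * f s) ->
  f 0 = 0 -> f 1 = 0 -> False.
Proof.
move=> cf cross f0 f1.
pose A : set R := [set r | 0 < r <= 1 /\ f r <= 0].
have A1 : A 1 by split; rewrite ?ltr01 ?lexx // f1.
have hA : has_inf A by split; [exists 1|exists 0 => r [/andP[/ltW]]].
pose m := inf A.
have [d0 d00 H0] := cross 0 ltac:(by rewrite lexx ler01) f0.
have lbA r : A r -> Num.min d0 1 <= r.
  move=> [/andP[r0 r1] fr]; rewrite leNgt; apply/negP; rewrite lt_min => /andP[rd _].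
  have := H0 r; rewrite subr0 (ltW r0) r1 gt_eqF // gtr0_norm // => /(_ isT isT rd).
  by rewrite pmulr_rgt0 // ltNge fr.
have m0 : 0 < m.
  by apply: (@lt_le_trans _ _ (Num.min d0 1)); [rewrite lt_min d00 ltr01|apply: lb_le_inf => //; exists 1].
have m1 : m <= 1 by apply: ge_inf => //; case: hA.
have mI : 0 <= m <= 1 by rewrite ltW.
have nearA e : 0 < e -> exists2 r, A r & r < m + e by move=> e0; exact: inf_adherent.
have notA r : 0 < r -> r < m -> 0 < f r.
  move=> r0 rm; rewrite ltNge; apply/negP => fr; have : m <= r.
    by apply: ge_inf; [case: hA|split=> //; rewrite r0 (le_trans (ltW rm) m1)].
  by rewrite leNgt rm.
have fm : f m = 0.
  apply: le_anti; apply/andP; split.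
    rewrite leNgt; apply/negP => fm; have [d d0' H] := cf m mI _ fm.
    have [r Ar rm] := nearA d d0'; case: (Ar) => /andP[r0 r1] fr.
    have mr : m <= r by apply: ge_inf => //; case: hA.
    have : `|r - m| < d by rewrite ger0_norm ?subr_ge0 // ltrBlDl.
    move=> /H; rewrite (ltW r0) r1 => /(_ isT); rewrite ltr_norml => /andP[h _]; move: h fr fm.
    by clear; lra.
  rewrite leNgt; apply/negP => fm; have fm' : 0 < - f m by rewrite oppr_gt0.
  have [d d0' H] := cf m mI _ fm'.
  pose r := m - Num.min d m / 2.
  have q0 : 0 < Num.min d m by rewrite lt_min d0'.
  have q1 : Num.min d m / 2 < Num.min d m by rewrite ltr_pdivrMr // ltr_pMr // ltr1n.
  have q2 : 0 < Num.min d m / 2 by rewrite divr_gt0.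
  have r0 : 0 < r by rewrite subr_gt0; apply: lt_le_trans q1 _; rewrite ge_min lexx orbT.
  have rm : r < m by rewrite ltrBlDr ltrDl.
  have : `|r - m| < d.
    by rewrite /r addrAC subrr add0r normrN gtr0_norm //; apply: lt_le_trans q1 _; rewrite ge_min lexx.
  move=> /H; rewrite (ltW r0) (le_trans (ltW rm) m1) => /(_ isT).
  rewrite ltr_norml => /andP[_ h]; have := notA r r0 rm; move: h; clear; lra.
have [d d0' H] := cross m mI fm.
pose r := m - Num.min d m / 2.
have q0 : 0 < Num.min d m by rewrite lt_min d0'.
have q1 : Num.min d m / 2 < Num.min d m by rewrite ltr_pdivrMr // ltr_pMr // ltr1n.
have q2 : 0 < Num.min d m / 2 by rewrite divr_gt0.
have r0 : 0 < r by rewrite subr_gt0; apply: lt_le_trans q1 _; rewrite ge_min lexx orbT.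
have rm : r < m by rewrite ltrBlDr ltrDl.
have := H r; rewrite (ltW r0) (le_trans (ltW rm) m1) lt_eqF // => /(_ isT isT).
have -> : `|r - m| < d.
  by rewrite /r addrAC subrr add0r normrN gtr0_norm //; apply: lt_le_trans q1 _; rewrite ge_min lexx.
by move=> /(_ isT); rewrite nmulr_rgt0 ?subr_lt0 // ltNge ltW // notA.
Qed.

Lemma close_vectors (n : nat) (f g g' : 'rV[R]_n) (eta : R) : eta <= 8^-1 -> 0 < enorm f ->
  enorm (g - f) <= eta * enorm f -> enorm (g' - f) <= eta * enorm f ->
  [/\ 0 < enorm g, enorm (g' - g) <= 2^-1 * enorm g & 0 < dotp g g'].
Proof.
move=> e8 f0 gf gf'.
have ef : eta * enorm f <= 8^-1 * enorm f by rewrite ler_wpM2r // ltW.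
have g1 : 8^-1 * 7%:R * enorm f <= enorm g.
  have := enorm_subr_ge f g; rewrite enorm_distC; move: (le_trans gf ef).
  by move: (enorm g) (enorm f) (enorm (g - f)) => a b d; clear; lra.
have gg : enorm (g' - g) <= 4^-1 * enorm f.
  apply: (le_trans (enorm_dist _ f _)); rewrite (enorm_distC f).
  move: (le_trans gf ef) (le_trans gf' ef).
  by move: (enorm f) (enorm (g - f)) (enorm (g' - f)) => a b d; clear; lra.
have g0 : 0 < enorm g by apply: lt_le_trans g1; rewrite !mulr_gt0.
have h : enorm (g' - g) <= 2^-1 * enorm g.
  apply: (le_trans gg); move: g1 f0; move: (enorm g) (enorm f) => a b; clear; lra.
split=> //; rewrite -[g'](subrK g) addrC dotpDr -enorm_sqr.
have := cauchy_schwarz g (g' - g); rewrite ler_norml => /andP[h1 _].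
have h2 : enorm g * enorm (g' - g) <= enorm g * (2^-1 * enorm g) by rewrite ler_wpM2l // ltW.
have h3 : 0 < enorm g ^+ 2 by rewrite exprn_gt0.
by move: h1 h2 h3; move: (dotp _ _) (enorm g) (enorm (g' - g)) => a b d; clear; nra.
Qed.

End Crossing.

(** * Common directions of two zero sets *)

Section LocalCrossing.
Context {R : realType} (P : problem R) (ks kq : nat) (c eta : R).
Hypothesis cont : continuous_setting P ks kq c.
Context (D : discretization R).
Hypothesis ds : discrete_setting ks kq D P c.
Variable n : 'I_(nslab D).
Hypothesis eta8 : eta <= 8^-1.
Implicit Types (K L : 'I_(ntet D)) (x y u w v : 'rV[R]_3) (t : R).
Local Notation cut := (Defs.cut ks kq n).
Local Notation phihatK := (phihatK ks kq n).
Local Notation hat_grad := (hat_grad ks kq n).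
Hypothesis grad_close : forall K x t, cut K -> tet K x -> slab n t ->
  0 < enorm (gradx (phi P) (st x t)) /\
  enorm (hat_grad K t - gradx (phi P) (st x t)) <= eta * enorm (gradx (phi P) (st x t)).
Let mesh := ds_mesh ds.
Let incr := tg_incr (ds_time ds).
Let fe := ds_phih ds.

Lemma cut_Omega K x t : cut K -> tet K x -> slab n t -> Omega P x.
Proof.
move=> cK Kx It; have := cut_nbhd ds cK Kx It.
by have [U [_ -> _]] := cs_nbhd cont; move=> [_ []]; rewrite xpart_st.
Qed.

(** [Omega P] is open, so the tetrahedra cover a neighbourhood of [x]; one that misses [x] has a
    negative coordinate there and keeps a positive distance. *)
Lemma nearby_tets x : Omega P x -> exists2 d, 0 < d & forall y, enorm (y - x) < d ->
  [/\ Omega P y, exists K, tet K y & forall K, tet K y -> tet K x].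
Proof.
move=> Ox; have /enorm_ball_nbhs[d0 d00 H0] : nbhs x (Omega P).
  exact: open_nbhs_nbhs (conj (cs_open cont) Ox).
have /fin_all_exists[d dP] : forall K, exists d, 0 < d /\ forall y, enorm (y - x) < d -> tet K y -> tet K x.
  move=> K; have [Kx|nKx] := pselect (tet K x); first by exists 1.
  have [j bj] : exists j, bary (vert K) j x < 0.
    apply: contrapT => H; apply: nKx; apply/(tetP mesh) => j; rewrite leNgt.
    by apply/negP => bj; apply: H; exists j.
  have [r [r0 gr _]] := tet_radius mesh K.
  exists (- bary (vert K) j x * r); split; first by rewrite mulr_gt0 ?oppr_gt0.
  move=> y yx /(tetP mesh)/(_ j) by0; exfalso.
  have h1 : bary (vert K) j y - bary (vert K) j x <= r^-1 * enorm (y - x).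
    rewrite baryB; apply: (le_trans (dotp_le _ _)); rewrite ler_wpM2r ?enorm_ge0 //.
  have h2 : r^-1 * enorm (y - x) < - bary (vert K) j x by rewrite mulrC ltr_pdivrMr.
  by move: (le_lt_trans h1 h2); rewrite ltrBlDr addNr ltNge by0.
exists (Num.min d0 (\big[Num.min/1]_K d K)).
  by rewrite lt_min d00; apply: lt_bigmin => // K _; case: (dP K).
move=> y; rewrite lt_min => /andP[y0 yK]; have Oy : Omega P y by exact: H0.
split=> //.
  have := @subset_closure _ (Omega P) y Oy; rewrite -(tri_cover mesh) => -[K _ Ky].
  by exists K.
move=> K; case: (dP K) => _ /(_ y); apply; apply: (lt_le_trans yK); exact: bigmin_le.
Qed.

(** At a fixed time the interpolant is affine, so three zeros fill a triangle; the dual vectors [p],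
    [q] of its sides show that it is not degenerate and hence not null. *)
Lemma cut_of_triangle L t a b x : slab n t -> tet L a -> tet L (a + b) -> tet L x ->
  phihatK L (st a t) = 0 -> phihatK L (st (a + b) t) = 0 -> phihatK L (st x t) = 0 ->
  (exists p, exists2 q, dotp p b = 1 /\ dotp p (x - a) = 0 & dotp q b = 0 /\ dotp q (x - a) = 1) ->
  cut L.
Proof.
move=> It La Lb Lx fa fb fx [p [q [pu pw] [qu qw]]]; exists t => //.
apply: (triangle_not_null pu pw qu qw (a := a)) => s r s0 r0 sr1.
have e : a + s *: b + r *: (x - a) =
   \sum_(i < 3) (if i == 0 :> nat then 1 - s - r else if i == 1 :> nat then s else r)
     *: (if i == 0 :> nat then a else if i == 1 :> nat then a + b else x).
  rewrite !big_ord_recl big_ord0 /= addr0; apply/rowP => i; rewrite !mxE; ring.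
have s1 : \sum_(i < 3) (if i == 0 :> nat then 1 - s - r else if i == 1 :> nat then s else r) = 1 :> R.
  by rewrite !big_ord_recl big_ord0 /=; ring.
split; last first.
  rewrite e (phihatK_affine mesh fe) // !big_ord_recl big_ord0 /= fa fb fx; ring.
apply/(tetP mesh) => j; move/(tetP mesh)/(_ j): La; move/(tetP mesh)/(_ j): Lb; move/(tetP mesh)/(_ j): Lx.
rewrite !baryD !dotpZr -baryB => h1 h2 h3.
rewrite (_ : _ + _ = (1 - s - r) * bary (vert L) j a + s * (bary (vert L) j a + dotp (bary_grad (vert L) j) b)
   + r * bary (vert L) j x); last by ring.
by rewrite !addr_ge0 ?mulr_ge0 // -addrA -opprD subr_ge0.
Qed.

(* Two zero directions on the same side of the line through [x0] coincide:
   every tetrahedron met by the segment joining them in the direction of the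
   gradient contains a zero triangle at each zero on that segment, so it is cut
   and the interpolant increases through this zero. *)
Lemma zero_directions_coincide K1 K2 x0 t0 e v1 v2 (s d : R) :
  cut K1 -> cut K2 -> tet K1 x0 -> slab n t0 -> 0 < d -> e != 0 -> v1 != 0 ->
  dotp e v1 = 0 -> dotp (hat_grad K1 t0) v1 = 0 ->
  (forall L r, tet L x0 -> `|r| <= d -> tet L (x0 + r *: e) /\ phihatK L (st (x0 + r *: e) t0) = 0) ->
  (forall r, 0 <= r <= d -> tet K1 (x0 + r *: v1) /\ phihatK K1 (st (x0 + r *: v1) t0) = 0) ->
  (forall r, 0 <= r <= d -> tet K2 (x0 + r *: v2) /\ phihatK K2 (st (x0 + r *: v2) t0) = 0) ->
  v2 = v1 + s *: hat_grad K1 t0 -> s = 0.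
Proof.
move=> c1 c2 K1x It d0 e0 v0 ev gv eP v1P v2P v2E; apply/eqP/negPn/negP => s0.
set g := hat_grad K1 t0 in gv v2E.
have Ox : Omega P x0 := cut_Omega c1 K1x It.
have [d1 d10 H1] := nearby_tets Ox.
have N0 : 0 < enorm v1 + `|s| * enorm g + 1 by rewrite ltr_wpDl // addr_ge0 ?mulr_ge0 ?enorm_ge0.
pose ep := Num.min d (d1 / (enorm v1 + `|s| * enorm g + 1)).
have ep0 : 0 < ep by rewrite lt_min d0 divr_gt0.
have epd : ep <= d by rewrite ge_min lexx.
have epd1 : ep * (enorm v1 + `|s| * enorm g + 1) <= d1 by rewrite -ler_pdivlMr // ge_min lexx orbT.
pose p (r : R) := x0 + ep *: (v1 + (r * s) *: g).
have pD r r' : p r' = p r + (ep * s * (r' - r)) *: g.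
  by rewrite /p; apply/rowP => i; rewrite !mxE; ring.
have px r : 0 <= r <= 1 -> enorm (p r - x0) < d1.
  move=> /andP[r0 r1]; rewrite addrAC subrr add0r enormZ gtr0_norm //; apply: lt_le_trans epd1.
  rewrite ltr_pM2l //; apply: (le_lt_trans (enormD _ _)); rewrite enormZ normrM (ger0_norm r0).
  rewrite -addrA ltrD2l; apply: (@le_lt_trans _ _ (`|s| * enorm g)); last by rewrite ltrDl.
  by rewrite -mulrA ler_piMl // mulr_ge0 ?enorm_ge0.
pose f (r : R) := phihatK (xget K1 [set L | tet L (p r)]) (st (p r) t0).
have fE L r : tet L (p r) -> f r = phihatK L (st (p r) t0).
  move=> Lp; rewrite /f; case: xgetP => [L' _ /= L'p|/(_ L)//].
  exact: (phihatK_consistent mesh fe incr n t0 L'p Lp).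
have common r : 0 <= r <= 1 -> exists2 dr, 0 < dr & forall r', 0 <= r' <= 1 -> `|r' - r| < dr ->
    exists L, [/\ tet L (p r), tet L (p r') & f r' - f r = ep * s * (r' - r) * dotp (hat_grad L t0) g].
  move=> rI; have [Op _ _] := H1 _ (px r rI); have [d2 d20 H2] := nearby_tets Op.
  have M0 : 0 < `|ep * s| * enorm g + 1 by rewrite ltr_wpDl // mulr_ge0 // enorm_ge0.
  exists (d2 / (`|ep * s| * enorm g + 1)); first by rewrite divr_gt0.
  move=> r' rI' rr; have pp : enorm (p r' - p r) < d2.
    rewrite (pD r r') addrAC subrr add0r enormZ normrM.
    move: rr; rewrite ltr_pdivlMr //; apply: le_lt_trans.
    by rewrite mulrAC mulrC ler_wpM2l // lerDl.
  have [_ [L Lp'] H3] := H2 _ pp; have Lp := H3 _ Lp'.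
  exists L; split=> //; rewrite (fE L r' Lp') (fE L r Lp) (pD r r') (phihatKD mesh fe) dotpZr.
  by rewrite addrAC subrr add0r.
have slope r L : 0 <= r <= 1 -> f r = 0 -> tet L (p r) -> 0 < dotp (hat_grad L t0) g.
  move=> rI fr Lp; have [_ _ /(_ L Lp) Lx] := H1 _ (px r rI).
  have cL : cut L.
    have [Lm fm] := eP L (- d) Lx ltac:(by rewrite normrN gtr0_norm).
    have [Lq fq] := eP L d Lx ltac:(by rewrite gtr0_norm).
    have ab : x0 + (- d) *: e + (2 * d) *: e = x0 + d *: e.
      by apply/rowP => i; rewrite !mxE; ring.
    apply: (@cut_of_triangle L t0 (x0 + (- d) *: e) ((2 * d) *: e) (p r)) => //; rewrite ?ab //.
      by rewrite -(fE L r Lp).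
    have vv : 0 < dotp v1 v1 by rewrite lt_def dotp_ge0 dotp_eq0 v0.
    have ee : 0 < dotp e e by rewrite lt_def dotp_ge0 dotp_eq0 e0.
    have pa : p r - (x0 + (- d) *: e) = d *: e + ep *: (v1 + (r * s) *: g).
      by rewrite /p; apply/rowP => i; rewrite !mxE; ring.
    (* Dual vectors of the triangle sides from the orthogonal pair [e], [v1]: [q] along [v1], and
       [p1] along [e], corrected by a multiple of [q]. *)
    pose q := (ep * dotp v1 v1)^-1 *: v1.
    have qe : dotp q e = 0 by rewrite dotpZl (dotpC v1) ev mulr0.
    have qw : dotp q (d *: e + ep *: (v1 + (r * s) *: g)) = 1.
      rewrite dotpDr dotpZr qe mulr0 add0r dotpZr dotpDr dotpZl !dotpZr dotpZl (dotpC v1 g) gv.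
      by rewrite !mulr0 addr0; field; rewrite !gt_eqF.
    pose p1 := (2 * d * dotp e e)^-1 *: e; pose b := dotp p1 (d *: e + ep *: (v1 + (r * s) *: g)).
    exists (p1 - b *: q), q; rewrite pa; split=> //.
    - rewrite dotpBl !dotpZl !dotpZr -/q (_ : dotp v1 e = 0) ?mulr0 ?subr0; last by rewrite dotpC.
      by field; rewrite !gt_eqF.
    - by rewrite dotpBl (dotpZl b) qw mulr1 subrr.
    - by rewrite dotpZr qe mulr0.
  have [f0 gf] := grad_close c1 K1x It; have [_ Lf] := grad_close cL Lx It.
  by have [_ _] := close_vectors eta8 f0 Lf gf.
have g0 : 0 < enorm g.
  by have [f0 gf] := grad_close c1 K1x It; have [] := close_vectors eta8 f0 gf gf.
have f0 : f 0 = 0.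
  have [K1p fp] := v1P ep ltac:(by rewrite (ltW ep0)).
  have p0 : p 0 = x0 + ep *: v1 by rewrite /p mul0r scale0r addr0.
  by rewrite (fE K1) p0.
have f1 : f 1 = 0.
  have [K2p fp] := v2P ep ltac:(by rewrite (ltW ep0)).
  have p1 : p 1 = x0 + ep *: v2 by rewrite /p mul1r v2E.
  by rewrite (fE K2) p1.
have fcont r : 0 <= r <= 1 -> forall e', 0 < e' -> exists2 d', 0 < d' &
    forall r', 0 <= r' <= 1 -> `|r' - r| < d' -> `|f r' - f r| < e'.
  move=> rI e' e'0; have [dr dr0 H] := common r rI.
  pose M := \sum_L `|dotp (hat_grad L t0) g|.
  have M0 : 0 < `|ep * s| * M + 1 by rewrite ltr_wpDl // mulr_ge0 // sumr_ge0.
  exists (Num.min dr (e' / (`|ep * s| * M + 1))); first by rewrite lt_min dr0 divr_gt0.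
  move=> r' rI'; rewrite lt_min => /andP[h1 h2]; have [L [_ _ ->]] := H r' rI' h1.
  move: h2; rewrite ltr_pdivlMr //; apply: le_lt_trans; rewrite 2!normrM -mulrA mulrCA ler_wpM2l //.
  apply: (@le_trans _ _ (`|ep * s| * M)); last by rewrite lerDl.
  by rewrite ler_wpM2l // /M (bigD1 L) //= lerDl sumr_ge0.
have crs r : 0 <= r <= 1 -> f r = 0 -> exists2 d', 0 < d' &
    forall r', 0 <= r' <= 1 -> r' != r -> `|r' - r| < d' -> 0 < (r' - r) * (s * f r').
  move=> rI fr; have [dr dr0 H] := common r rI; exists dr => // r' rI' r'r h1.
  have [L [Lp _]] := H r' rI' h1; rewrite fr subr0 => ->.
  have -> : (r' - r) * (s * (ep * s * (r' - r) * dotp (hat_grad L t0) g))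
    = ((r' - r) ^+ 2 * s ^+ 2) * (ep * dotp (hat_grad L t0) g) by ring.
  apply: mulr_gt0; first by apply: mulr_gt0; rewrite exprn_even_gt0 ?subr_eq0.
  by apply: mulr_gt0 => //; exact: (slope r).
(* The factor [s] makes the function increase through its zeros whatever the sign of [s]. *)
apply: (@single_crossing R (fun r => s * f r)); rewrite ?f0 ?f1 ?mulr0 //.
  move=> r rI e' e'0; have s1 : 0 < `|s| by rewrite normr_gt0.
  have [d' d'0 H] := fcont r rI (e' / `|s|) (divr_gt0 e'0 s1).
  exists d' => // r' rI' h; rewrite -mulrBr normrM mulrC -ltr_pdivlMr //; exact: H.
move=> r rI /eqP; rewrite mulf_eq0 (negPf s0) /= => /eqP; exact: crs.
Qed.

End LocalCrossing.

(** * Directions of the smallest face through a point *)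

Section FaceDirections.
Context {R : realType} (ks kq : nat) (D : discretization R) (Om : set 'rV[R]_3) (c : R).
Hypothesis mesh : triangulation D Om c.
Hypothesis phih_fe : st_fe_space D Om ks kq (phih D).
Implicit Types (K L : 'I_(ntet D)) (x y u : 'rV[R]_3) (t : R) (n : 'I_(nslab D)).
Local Notation nd := (tet_nondegenerate mesh _).

(** For [x] in [K], the direction space of the smallest face containing [x]: [u] is tangent to every
    facet through [x]. *)
Definition face_dir K x u := forall j, bary (vert K) j x = 0 -> dotp (bary_grad (vert K) j) u = 0.

Lemma face_dirD K x u v : face_dir K x u -> face_dir K x v -> face_dir K x (u + v).
Proof. by move=> Hu Hv j bj; rewrite dotpDr Hu ?Hv ?addr0. Qed.

Lemma face_dirZ K x u a : face_dir K x u -> face_dir K x (a *: u).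
Proof. by move=> Hu j bj; rewrite dotpZr Hu ?mulr0. Qed.

Lemma tet_line K x u : tet K x -> (forall j, bary (vert K) j x = 0 -> 0 <= dotp (bary_grad (vert K) j) u) ->
  exists2 d : R, 0 < d & forall r, 0 <= r <= d -> tet K (x + r *: u).
Proof.
move=> Kx H; have H0 := (tetP mesh K x).1 Kx.
have /fin_all_exists[d dP] : forall j, exists d, 0 < d /\ forall r, 0 <= r <= d -> 0 <= bary (vert K) j (x + r *: u).
  move=> j; have [bj|bj] := eqVneq (bary (vert K) j x) 0.
    exists 1; split=> // r /andP[r0 _]; rewrite baryD bj add0r dotpZr mulr_ge0 //; exact: H.
  have b0 : 0 < bary (vert K) j x by rewrite lt_def bj H0.
  have n0 : 0 < `|dotp (bary_grad (vert K) j) u| + 1 by rewrite ltr_wpDl.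
  exists (bary (vert K) j x / (`|dotp (bary_grad (vert K) j) u| + 1)); split; first by rewrite divr_gt0.
  move=> r /andP[r0]; rewrite ler_pdivlMr // mulrDr mulr1 => h; rewrite baryD dotpZr.
  have := ler_norm (- dotp (bary_grad (vert K) j) u); rewrite normrN => /(ler_wpM2l r0).
  rewrite mulrN lerNl => h2; rewrite -lerBlDr sub0r; apply: (le_trans _ h).
  by rewrite lerNl (le_trans _ h2) // lerN2 lerDl.
exists (\big[Num.min/1]_j d j); first by apply: lt_bigmin => // j _; case: (dP j).
move=> r /andP[r0 rd]; apply/(tetP mesh) => j; case: (dP j) => _; apply.
by rewrite r0 (le_trans rd) // bigmin_le.
Qed.

Lemma face_dir_line K x u : tet K x -> face_dir K x u ->
  exists2 d : R, 0 < d & forall r, `|r| <= d -> tet K (x + r *: u).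
Proof.
move=> Kx Hu; have [|d1 d10 H1] := tet_line (u := u) Kx; first by move=> j /Hu ->.
have [|d2 d20 H2] := tet_line (u := (-1) *: u) Kx; first by move=> j bj; rewrite (face_dirZ _ Hu bj).
exists (Num.min d1 d2); first by rewrite lt_min d10.
move=> r; rewrite le_min => /andP[r1 r2]; have [r0|r0] := leP 0 r.
  by apply: H1; rewrite r0 -(ger0_norm r0).
have := H2 (- r); rewrite scalerA mulrN1 opprK; apply.
by rewrite oppr_ge0 (ltW r0) -(ltr0_norm r0).
Qed.

Lemma line_face_dir K x u (d : R) : 0 < d -> tet K (x + d *: u) -> tet K (x - d *: u) -> face_dir K x u.
Proof.
move=> d0 /(tetP mesh) H1 /(tetP mesh) H2 j bj; move: (H1 j) (H2 j).
rewrite -scaleNr !baryD bj !add0r !dotpZr pmulr_rge0 // mulNr oppr_ge0 pmulr_rle0 // => h1 h2.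
by apply/le_anti; rewrite h2.
Qed.

Lemma common_hull K L y : K != L -> tet K y ->
  (forall j, ~~ common_vert K L j -> bary (vert K) j y = 0) -> tet L y.
Proof.
move=> KL Ky H; have [e _] := tri_conforming mesh KL.
suff : (tet K `&` tet L) y by case.
rewrite e; have [s1 s2] := bary_combine y (tet_nondegenerate mesh K).
by exists (fun j => bary (vert K) j y); split=> //; move/(tetP mesh): Ky.
Qed.

Lemma noncommon_bary K L y d : K != L -> tet K y -> tet L y -> ~~ common_vert K L d -> bary (vert K) d y = 0.
Proof.
move=> KL Ky Ly nc; apply/eqP/negPn/negP => b0; case/negP: nc.
have bp : 0 < bary (vert K) d y by rewrite lt_def b0 ((tetP mesh K y).1 Ky).
by have [i e] := common_vertex mesh KL Ky Ly bp; apply/existsP; exists i; rewrite e.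
Qed.

Lemma noncommon_vertex K L : K != L -> exists d, ~~ common_vert K L d.
Proof.
move=> KL; apply: contrapT => H.
have KC : (tet K)^° (centroid K) by apply: (bary_interior mesh) => j; rewrite (bary_centroid mesh) invr_gt0 ltr0n.
apply: (interior_tet_disjoint mesh KL KC); apply: (common_hull KL (interior_subset KC)).
by move=> j nc; exfalso; apply: H; exists j.
Qed.

(** Along a face direction the coordinates of the vertices that are not shared stay zero, so by
    conformity a short segment through [x] lies in [L] as well. *)
Lemma face_dir_shared K L x u : tet K x -> tet L x -> face_dir K x u -> face_dir L x u.
Proof.
have [->//|KL] := eqVneq K L; move=> Kx Lx Hu; have [d d0 H] := face_dir_line Kx Hu.
have inL r : `|r| <= d -> tet L (x + r *: u).
  move=> rd; apply: (common_hull KL); first exact: H.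
  move=> j nc; have bj := noncommon_bary KL Kx Lx nc.
  by rewrite baryD bj add0r dotpZr Hu ?mulr0.
apply: (line_face_dir d0); first by apply: inL; rewrite gtr0_norm.
by rewrite -scaleNr; apply: inL; rewrite normrN gtr0_norm.
Qed.

Lemma other_index (d : 'I_4) : exists j, j != d.
Proof. by have [->|d0] := eqVneq d ord0; [exists ord_max|exists ord0; rewrite eq_sym]. Qed.

Lemma third_index (d d' : 'I_4) : exists j, j != d /\ j != d'.
Proof.
have : (#|pred2 d d'| < #|'I_4|)%N by rewrite card2 card_ord; case: (d != d').
rewrite -(cardC (pred2 d d')) -addn1 leq_add2l => /card_gt0P[j].
by rewrite !inE negb_or => /andP[]; exists j.
Qed.

Lemma bary_grad_vertices K i j k :
  dotp (bary_grad (vert K) i) (vert K j - vert K k) = (j == i)%:R - (k == i)%:R.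
Proof. by rewrite -baryB !(bary_vertex _ _ nd). Qed.

Lemma bary_grad_parallel K d d' a b : d != d' ->
  a *: bary_grad (vert K) d = b *: bary_grad (vert K) d' -> a = 0 /\ b = 0.
Proof.
move=> dd' e; have [j [jd jd']] := third_index d d'.
have := congr1 (dotp^~ (vert K d - vert K j)) e; have := congr1 (dotp^~ (vert K d' - vert K j)) e.
rewrite !dotpZl !bary_grad_vertices // !eqxx (eq_sym d') (negPf dd') (negPf jd) (negPf jd') !subr0.
by rewrite !mulr0 !mulr1 => <- ->.
Qed.

Lemma bary_grad_neq0 K d : bary_grad (vert K) d != 0.
Proof.
have [d' dd'] := other_index d; apply/negP => /eqP g0.
have [] := @bary_grad_parallel K d d' 1 0; rewrite ?g0 ?scaler0 ?scale0r // 1?eq_sym //.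
by move=> /eqP; rewrite oner_eq0.
Qed.

(* It fails only on the edges of [K], at isolated zeros of the vertex values. *)
Definition good_at n K x t := forall d d', d != d' -> bary (vert K) d x = 0 -> bary (vert K) d' x = 0 ->
  forall j, root (vertex_poly ks kq n K j) t -> vertex_poly ks kq n K j = 0.

(** Only vertex [d] contributes to the interpolant. A zero off the facet opposite to [d] would be a
    zero of its polynomial, and then the gradient would vanish. That facet is shared with [L]. *)
Lemma zero_face n K L d : K != L -> (forall t, slab n t -> hat_grad ks kq n K t != 0) ->
  (forall j, j != d -> vertex_poly ks kq n K j = 0) -> (forall j, j != d -> common_vert K L j) ->
  forall z, zero_set ks kq n K z -> prism n L z.
Proof.
move=> KL g0 poly0 common.
move=> z [[Kz Iz]]; rewrite (phihatK_bary mesh phih_fe) (bigD1 d) //= big1 ?addr0; last first.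
  by move=> j jd; rewrite poly0 // horner0 mulr0.
move=> /eqP; rewrite mulf_eq0 => /orP[/eqP bz|/eqP pz].
  split=> //; apply: (common_hull KL Kz) => j cj; suff -> : j = d by [].
  by apply/eqP; apply: contraNT cj => /common.
case/negP: (g0 _ Iz); rewrite /hat_grad big1 // => j _; have [->|jd] := eqVneq j d.
  by rewrite pz scale0r.
by rewrite poly0 // horner0 scale0r.
Qed.

(* If the zero sets of [K] and [L] at time [t0] share a triangle, then this
   triangle lies in a common face on which the interpolant vanishes at [t0]; by
   [good_at] it vanishes there at all times. *)
Lemma coincident_face n K L x0 t0 e v (d0 : R) : K != L ->
  (forall t, slab n t -> hat_grad ks kq n K t != 0) ->
  good_at n K x0 t0 -> tet K x0 -> tet L x0 -> slab n t0 ->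
  e != 0 -> v != 0 -> dotp e v = 0 -> 0 < d0 ->
  tet K (x0 + d0 *: e) -> tet L (x0 + d0 *: e) -> tet K (x0 + d0 *: v) -> tet L (x0 + d0 *: v) ->
  phihatK ks kq n K (st x0 t0) = 0 ->
  dotp (hat_grad ks kq n K t0) e = 0 -> dotp (hat_grad ks kq n K t0) v = 0 ->
  ~ face_dir K x0 v ->
  forall z, zero_set ks kq n K z -> prism n L z.
Proof.
move=> KL g0 gd Kx Lx It e0 v0 ev d00 Ke Le Kv Lv f0 ge gv nv.
set g := hat_grad ks kq n K t0 in ge gv.
have gg : dotp g g != 0 by rewrite dotp_eq0 g0.
(* The coordinate of a vertex that is not shared vanishes at the three common points, so its
   gradient is orthogonal to [e] and [v], as [g] is. *)
have nc i : ~~ common_vert K L i ->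
    [/\ bary (vert K) i x0 = 0, dotp (bary_grad (vert K) i) v = 0 &
      exists2 a : R, a != 0 & bary_grad (vert K) i = a *: g].
  move=> ci; have b0 := noncommon_bary KL Kx Lx ci.
  have bg w : tet K (x0 + d0 *: w) -> tet L (x0 + d0 *: w) -> dotp (bary_grad (vert K) i) w = 0.
    move=> Kw Lw; have := noncommon_bary KL Kw Lw ci.
    by rewrite baryD b0 add0r dotpZr => /eqP; rewrite mulf_eq0 gt_eqF //= => /eqP.
  split=> //; first exact: bg.
  have E := perp_parallel (independent_perp e0 v0 ev) (g0 _ It) ge gv (bg _ Ke Le) (bg _ Kv Lv).
  exists (dotp (bary_grad (vert K) i) g / dotp g g); last by rewrite -/g in E.
  by apply: contraNneq (bary_grad_neq0 K i) => a0; rewrite E -/g a0 scale0r.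
have [d cd] := noncommon_vertex KL; have [bd bv [a a0 bg]] := nc d cd.
(* Gradients of different coordinates are never parallel, so [d] is the only vertex not shared. *)
have common j : j != d -> common_vert K L j.
  move=> jd; apply: contrapT => /negP cj; have [_ _ [b b0 bj]] := nc j cj.
  have [] := @bary_grad_parallel K j d a b jd; first by rewrite bj bg !scalerA mulrC.
  by move=> /eqP; rewrite (negPf a0).
(* At [t0] coordinate [d] is a nonzero multiple of the interpolant, and it vanishes at the other
   vertices. *)
have root0 j : j != d -> root (vertex_poly ks kq n K j) t0.
  move=> jd; have vE : vert K j = x0 + (vert K j - x0) by rewrite addrC subrK.
  apply/rootP; rewrite -(phihatK_vertex mesh phih_fe) vE (phihatKD mesh phih_fe) f0 add0r.
  have := baryB (vert K) d (vert K j) x0; rewrite bd (bary_vertex _ _ nd) (negPf jd) subr0 bg dotpZl.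
  by move=> /esym/eqP; rewrite mulf_eq0 (negPf a0) => /eqP.
(* [v] leaves the smallest face but respects coordinate [d], so a second coordinate vanishes at [x0]
   and [good_at] applies. *)
have [d' dd' bd'] : exists2 d', d != d' & bary (vert K) d' x0 = 0.
  apply: contrapT => H; apply: nv => i bi; have [->//|id'] := eqVneq i d.
  by exfalso; apply: H; exists i => //; rewrite eq_sym.
by apply: (zero_face KL g0 (d := d)) => // j /root0; exact: (gd d d').
Qed.

End FaceDirections.

(** * Sign of the interpolant on one side of a time slice *)

Section FaceSign.
Context {R : realType}.

(** While all [b j] in [J] vanish at [t0], a linear factor splits off from each; the size of one
    nonzero [b j0] limits the number of steps. *)
Lemma common_root_power (I : finType) (J : pred I) (b : I -> {poly R}) (t0 : R) :
  (exists j, J j /\ b j != 0) ->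
  exists m bt, (forall j, J j -> b j = ('X - t0%:P) ^+ m * bt j) /\ exists j, J j /\ (bt j).[t0] != 0.
Proof.
move=> [j0 [Jj0 bj0]]; have [N] := ubnP (size (b j0)); elim: N => // N IH in b bj0 *; move=> bN.
have [[j [Jj bj]]|H] := pselect (exists j, J j /\ (b j).[t0] != 0).
  by exists 0%N, b; split; [move=> i _; rewrite expr0 mul1r|exists j].
have /fin_all_exists[b' b'P] j : exists q, J j -> b j = q * ('X - t0%:P).
  have [Jj|] := boolP (J j); last by exists 0.
  have /factor_theorem[q bq] : root (b j) t0.
    by apply/negPn/negP => rb; apply: H; exists j.
  by exists q.
have b'0 : b' j0 != 0 by apply: contraNneq bj0 => e; rewrite b'P // e mul0r.
have [|m [bt [btP btn]]] := IH b' b'0.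
  by move: bN; rewrite (b'P j0 Jj0) size_Mmonic ?monicXsubC // size_XsubC addn2.
exists m.+1, bt; split=> // j Jj; rewrite (b'P j Jj) (btP j Jj) exprS.
by rewrite -[RHS]mulrA [LHS]mulrC.
Qed.

Lemma differentiable_eps (n : nat) (F : 'rV[R]_n -> R) z (e : R) : differentiable F z -> 0 < e ->
  exists2 d, 0 < d & forall y, enorm (y - z) < d -> `|F y - F z| < e.
Proof.
move=> /differentiable_continuous dF e0.
have : \forall y \near z, `|F z - F y| < e by move/cvgrPdist_lt: dF; exact.
move=> /enorm_ball_nbhs[d d0 dP].
by exists d => // y /dP; rewrite distrC.
Qed.

Lemma grad_affine_dir (n : nat) (F : 'rV[R]_n -> R) z w (a : R) : differentiable F z ->
  (forall s, F (z + s *: w) = F z + s * a) -> dotp (grad F z) w = a.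
Proof.
move=> dF H; rewrite -derive_grad //; apply/cvg_lim => //; apply: cvg_near_cst; near=> h.
have h0 : h != 0 by near: h; exact: nbhs_dnbhs_neq.
by rewrite /= (addrC (_ *: w)) H addrAC subrr add0r /GRing.scale/= mulrA mulVf // mul1r.
Unshelve. all: by end_near. Qed.

Context (ks kq : nat) (D : discretization R) (Om : set 'rV[R]_3) (c : R).
Hypothesis mesh : triangulation D Om c.
Hypothesis phih_fe : st_fe_space D Om ks kq (phih D).
Implicit Types (K L : 'I_(ntet D)) (x u : 'rV[R]_3) (t : R).
Variable n : 'I_(nslab D).
Local Notation vertex_poly := (vertex_poly ks kq n).
Local Notation hat_grad := (hat_grad ks kq n).
Local Notation zero_set := (zero_set ks kq n).
Local Notation phihatK := (phihatK ks kq n).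

(** With [bt] the vertex polynomials divided by a common power of X - t0, this is the interpolant
    without the contribution of vertex [d], divided by that power. *)
Definition reduced K d (bt : 'I_4 -> {poly R}) (z : 'rV[R]_(3 + 1)) : R :=
  \sum_(j | j != d) bary (vert K) j (xpart z) * (bt j).[tpart z].

Lemma reduced_differentiable K d bt (k : R) (z : 'rV[R]_(3 + 1)) :
  differentiable (fun y : 'rV[R]_(3 + 1) => k * reduced K d bt y) z.
Proof.
rewrite (_ : (fun y : 'rV[R]_(3 + 1) => _) = fun y : 'rV[R]_(3 + 1) => \sum_j bary (vert K) j (xpart y) *
    (if j == d then 0 else k *: bt j : {poly R}).[tpart y]); last first.
  apply/funext => y; rewrite mulr_sumr [in RHS](bigD1 d) //= eqxx horner0 mulr0 add0r.
  by apply: eq_bigr => j /negPf ->; rewrite hornerZ mulrCA.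
apply: differentiable_sum_fun => j; apply: differentiableM; last exact: poly_differentiable_tpart.
by apply: differentiable_xpart; exact: poly_fun_differentiable (poly_fun_bary _ _).
Qed.

Lemma reduced_grad K d bt (k : R) x t u :
  dotp (grad (fun y : 'rV[R]_(3 + 1) => k * reduced K d bt y) (st x t)) (st u 0) =
  k * \sum_(j | j != d) dotp (bary_grad (vert K) j) u * (bt j).[t].
Proof.
apply: grad_affine_dir; first exact: reduced_differentiable.
move=> s; rewrite -stZ -stD mulr0 addr0 /reduced !xpart_st !tpart_st [s * _]mulrCA -mulrDr; congr (_ * _).
rewrite mulr_sumr -big_split; apply: eq_bigr => j _.
by rewrite baryD dotpZr mulrDl mulrA.
Qed.

(* On the zero set [('X - t0) ^+ m] times [reduced] equals [- bary d * vertex_poly d]. *)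
Lemma face_sign K x0 t0 d m bt (v : 'rV[R]_(3 + 1)) (sg : R) :
  (forall j, j != d -> vertex_poly K j = ('X - t0%:P) ^+ m * bt j) -> (vertex_poly K d).[t0] != 0 ->
  tangent_cone (zero_set K) (st x0 t0) v -> 0 < sg * tpart v ->
  let G := fun y : 'rV[R]_(3 + 1) => sg ^+ m * (vertex_poly K d).[t0] * reduced K d bt y in
  G (st x0 t0) <= 0 /\ (G (st x0 t0) = 0 -> dotp (grad G (st x0 t0)) v <= 0).
Proof.
move=> btP pd0 Tv sv G; set z0 := st x0 t0.
have pp0 : 0 < (vertex_poly K d).[t0] ^+ 2 by rewrite exprn_even_gt0.
have [d1 d10 H1] : exists2 r : R, 0 < r & forall y : 'rV[R]_(3 + 1), enorm (y - z0) < r ->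
    0 < (vertex_poly K d).[t0] * (vertex_poly K d).[tpart y].
  have [r r0 rP] := differentiable_eps (poly_differentiable_tpart ((vertex_poly K d).[t0] *: vertex_poly K d) z0) pp0.
  exists r => // y /rP; rewrite !hornerZ tpart_st -expr2 ltr_norml => /andP[h _].
  by move: h; rewrite ltrBrDl subrr.
have sv' : 0 < dotp (st 0 sg) v by rewrite -(st_parts v) dotp_st dotp0l add0r.
(* The direction has a time component of sign [sg], so it is approached by zeros strictly on that
   side of [t0], near enough for the value at vertex [d] to keep its sign. *)
have Av := tangent_cone_ball d10 (tangent_cone_pos sv' Tv).
set A := (X in tangent_cone X) in Av.
have GA y : A y -> G y <= 0.
  move=> [[[Ky fy] /= ty] /H1 py].
  rewrite -(st_parts (y - z0)) dotp_st dotp0l add0r tpartB tpart_st in ty.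
  have tm : 0 < (sg * (tpart y - t0)) ^+ m by rewrite exprn_gt0.
  rewrite -(pmulr_lle0 _ tm) /G.
  have e : (tpart y - t0) ^+ m * reduced K d bt y = - (bary (vert K) d (xpart y) * (vertex_poly K d).[tpart y]).
    apply/eqP; rewrite -addr_eq0 addrC; apply/eqP; rewrite -[RHS]fy (phihatK_bary mesh phih_fe) (bigD1 d) //=; congr (_ + _).
    rewrite mulr_sumr; apply: eq_bigr => j jd; rewrite btP // hornerM horner_exp hornerXsubC.
    by rewrite mulrCA.
  rewrite (_ : _ * _ = - ((sg ^+ m) ^+ 2 * bary (vert K) d (xpart y) *
    ((vertex_poly K d).[t0] * (vertex_poly K d).[tpart y]))).
    rewrite oppr_le0 mulr_ge0 ?(ltW py) // mulr_ge0 ?sqr_ge0 //.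
    by have /(tetP mesh) := Ky.1.
  transitivity ((sg ^+ m) ^+ 2 * (vertex_poly K d).[t0] * ((tpart y - t0) ^+ m * reduced K d bt y)).
    by rewrite exprMn; ring.
  by rewrite e; ring.
have G0 : G z0 <= 0.
  apply/ler_addgt0Pr => e e0; have [r r0 rP] := differentiable_eps (reduced_differentiable K d bt (sg ^+ m * (vertex_poly K d).[t0]) z0) e0.
  have [a Aa az] := tangent_cone_closure Av r0.
  have := rP a az; rewrite -/(G a) -/(G z0) ltr_norml => /andP[h _]; have := GA a Aa.
  by move: h; rewrite ltrBrDl ltrBlDr => h1 h2; rewrite add0r; apply/ltW/(lt_le_trans h1); rewrite gerDr.
split=> // Gz; apply: tangent_cone_le Av; first exact: reduced_differentiable.
by move=> y /GA; rewrite Gz.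
Qed.

End FaceSign.

(** * Two zero sets on the same side of a time slice *)

Section SameSide.
Context {R : realType} (ks kq : nat) (D : discretization R) (Om : set 'rV[R]_3) (c : R).
Hypothesis mesh : triangulation D Om c.
Hypothesis phih_fe : st_fe_space D Om ks kq (phih D).
Hypothesis incr : forall n : 'I_(nslab D), tnode D n < tnode D n.+1.
Implicit Types (K L : 'I_(ntet D)) (x u : 'rV[R]_3) (t : R).
Variable n : 'I_(nslab D).
Local Notation vertex_poly := (vertex_poly ks kq n).
Local Notation hat_grad := (hat_grad ks kq n).
Local Notation zero_set := (zero_set ks kq n).
Local Notation phihatK := (phihatK ks kq n).
Local Notation nd := (tet_nondegenerate mesh _).

Lemma carrier_shared K L x0 d : K != L -> tet K x0 -> tet L x0 ->
  (forall j, bary (vert K) j x0 = 0 -> j = d) -> forall j, j != d -> exists i, vert L i = vert K j.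
Proof.
move=> KL Kx Lx H j jd; apply: (common_vertex mesh KL Kx Lx); rewrite lt_def ((tetP mesh K x0).1 Kx) andbT.
by apply: contraNneq jd => /H ->.
Qed.

(** Coordinate [d] of [K] vanishes at all vertices of [L] but [d'], so its gradient is a multiple of
    that of coordinate [d']. With a nonnegative factor, a step from [x0] towards vertex [d'] would
    stay in both tetrahedra, where coordinate [d'] is zero. *)
Lemma opposite_faces K L x0 d d' : K != L -> tet K x0 -> tet L x0 ->
  (forall j, bary (vert K) j x0 = 0 -> j = d) -> (forall j, bary (vert L) j x0 = 0 -> j = d') ->
  ~~ common_vert K L d -> ~~ common_vert L K d' ->
  exists2 a, a < 0 & bary_grad (vert K) d = a *: bary_grad (vert L) d'.
Proof.
move=> KL Kx Lx HK HL cK cL; have LK : L != K by rewrite eq_sym.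
have bK := noncommon_bary mesh KL Kx Lx cK; have bL := noncommon_bary mesh LK Lx Kx cL.
set a := bary (vert K) d (vert L d').
have face i : i != d' -> bary (vert K) d (vert L i) = 0.
  move=> id'; have [j e] := carrier_shared LK Lx Kx HL id'; rewrite -e (bary_vertex _ _ nd).
  case: eqVneq => // jd; case/negP: cK; apply/existsP; exists i; rewrite -e jd eqxx //.
have par w : dotp (bary_grad (vert K) d) w = a * dotp (bary_grad (vert L) d') w.
  rewrite -{1}(bary_grad_combine w (tet_nondegenerate mesh L)) dotp_sumr.
  rewrite (eq_bigr (fun i => dotp (bary_grad (vert L) i) w * bary (vert K) d (vert L i)
     - dotp (bary_grad (vert L) i) w * bary (vert K) d 0)); last first.
    by move=> i _; rewrite dotpZr -mulrBr baryB subr0.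
  rewrite sumrB -mulr_suml -dotp_suml (bary_grad_sum (tet_nondegenerate mesh L)) dotp0l mul0r subr0.
  rewrite (bigD1 d') //= big1 ?addr0 1?mulrC // => i id'.
  by rewrite face ?mulr0.
exists a; last first.
  apply/eqP; rewrite -subr_eq0 -dotp_eq0; set r := _ - _.
  by rewrite {1}/r dotpBl dotpZl par subrr.
rewrite ltNge; apply/negP => a0; pose w := vert L d' - x0.
have gw : dotp (bary_grad (vert L) d') w = 1 by rewrite -baryB (bary_vertex _ _ nd) eqxx bL subr0.
have [|r r0 rP] := tet_line mesh (u := w) Kx.
  by move=> j /HK ->; rewrite par gw mulr1.
have m0 : 0 < Num.min r 1 by rewrite lt_min r0 ltr01.
have Kw : tet K (x0 + Num.min r 1 *: w) by apply: rP; rewrite (ltW m0) ge_min lexx.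
have Lw : tet L (x0 + Num.min r 1 *: w).
  apply: (tet_convex mesh) => //; last exact: vert_tet mesh _ _.
  by rewrite (ltW m0) ge_min lexx orbT.
have := noncommon_bary mesh LK Lw Kw cL; rewrite baryD bL add0r dotpZr gw mulr1 => e.
by rewrite e ltxx in m0.
Qed.

Lemma zero_set_shared K L z : zero_set K z -> prism n L z -> zero_set L z.
Proof.
move=> [[Kx _] fz] Lz; split=> //; rewrite -fz -(st_parts z); case: Lz => Lx _.
exact: (phihatK_consistent mesh phih_fe incr n (tpart z) Lx Kx).
Qed.

(* Otherwise both zero sets stay on the same side of the time slice [t0]: with
   the largest power of [t - t0] divided out, the interpolant has opposite signs
   on the two zero sets and hence vanishes at [t0] on the common face. *)
Lemma no_same_side K L x0 t0 (v w : 'rV[R]_(3 + 1)) : K != L -> tet K x0 -> tet L x0 -> slab n t0 ->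
  phihatK K (st x0 t0) = 0 ->
  (forall j j', bary (vert K) j x0 = 0 -> bary (vert K) j' x0 = 0 -> j = j') ->
  (forall j j', bary (vert L) j x0 = 0 -> bary (vert L) j' x0 = 0 -> j = j') ->
  (forall t, slab n t -> hat_grad K t != 0) -> (forall t, slab n t -> hat_grad L t != 0) ->
  (forall u, face_dir K x0 u -> dotp (hat_grad K t0) u = 0) ->
  0 < dotp (hat_grad K t0) (hat_grad L t0) ->
  (forall u, face_dir K x0 u -> tangent_cone (zero_set K) (st x0 t0) (v + st u 0)) ->
  tangent_cone (zero_set L) (st x0 t0) w ->
  zero_set K <> zero_set L -> 0 < tpart v * tpart w -> False.
Proof.
move=> KL Kx Lx It f0 HK HL gK gL hU gKL Tv Tw AKL vw; have LK : L != K by rewrite eq_sym.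
have [d cd] := noncommon_vertex mesh KL; have [d' cd'] := noncommon_vertex mesh LK.
have bd := noncommon_bary mesh KL Kx Lx cd; have bd' := noncommon_bary mesh LK Lx Kx cd'.
have {}HK j : bary (vert K) j x0 = 0 -> j = d by move=> /HK; exact.
have {}HL j : bary (vert L) j x0 = 0 -> j = d' by move=> /HL; exact.
have shK := carrier_shared KL Kx Lx HK; have shL := carrier_shared LK Lx Kx HL.
have comK j : j != d -> common_vert K L j.
  by move=> /shK[i e]; apply/existsP; exists i; rewrite e.
have comL i : i != d' -> common_vert L K i.
  by move=> /shL[j e]; apply/existsP; exists j; rewrite e.
have to_face i : i != d' -> exists2 j, j != d & vertex_poly L i = vertex_poly K j.
  move=> id'; have [j e] := shL i id'; exists j.
    by apply: contraNneq cd => <-; apply/existsP; exists i; rewrite e.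
  exact/esym/(vertex_poly_shared mesh phih_fe incr).
have edge j : j != d -> face_dir K x0 (vert K j - x0).
  by move=> jd i /HK ->; rewrite -baryB (bary_vertex _ _ nd) (negPf jd) bd subr0.
have root0 j : j != d -> (vertex_poly K j).[t0] = 0.
  move=> jd; have vE : vert K j = x0 + (vert K j - x0) by rewrite addrC subrK.
  by rewrite -(phihatK_vertex mesh phih_fe) vE (phihatKD mesh phih_fe) f0 add0r hU //; exact: edge.
(* If all vertex values on the common face vanished identically, both zero sets would lie in that
   face and coincide. *)
have nz : exists j, (j != d) /\ vertex_poly K j != 0.
  apply: contrapT => H; apply: AKL.
  have pK j : j != d -> vertex_poly K j = 0.
    by move=> jd; apply/eqP/negPn/negP => pj; apply: H; exists j.
  have pL i : i != d' -> vertex_poly L i = 0 by move=> /to_face[j /pK pj ->].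
  apply/seteqP; split=> z Az.
    exact: (zero_set_shared Az (zero_face mesh phih_fe KL gK pK comK Az)).
  exact: (zero_set_shared Az (zero_face mesh phih_fe LK gL pL comL Az)).
have [m [bt [btP [j0 [j0d btj0]]]]] := common_root_power t0 nz.
have /fin_all_exists[bt' bt'P] i : exists q, i != d' -> vertex_poly L i = ('X - t0%:P) ^+ m * q.
  have [->|id'] := eqVneq i d'; first by exists 0.
  by have [j jd ->] := to_face i id'; exists (bt j) => _; exact: btP.
have redE : reduced K d bt (st x0 t0) = reduced L d' bt' (st x0 t0).
  have e : \sum_j bary (vert K) j x0 *: vertex_poly K j = \sum_i bary (vert L) i x0 *: vertex_poly L i.
    apply: (poly_eq_itv (incr n)) => t tI; rewrite !horner_sum.
    have := phihatK_consistent mesh phih_fe incr n t Kx Lx; rewrite !(phihatK_st mesh phih_fe).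
    by under eq_bigr do rewrite -hornerZ; under [in RHS]eq_bigr do rewrite -hornerZ.
  move: e; rewrite (bigD1 d) //= [in RHS](bigD1 d') //= bd bd' !scale0r !add0r.
  rewrite (eq_bigr (fun j => ('X - t0%:P) ^+ m * (bary (vert K) j x0 *: bt j))); last first.
    by move=> j jd; rewrite btP // scalerAr.
  rewrite [RHS](eq_bigr (fun i => ('X - t0%:P) ^+ m * (bary (vert L) i x0 *: bt' i))); last first.
    by move=> i id'; rewrite bt'P // scalerAr.
  rewrite -!mulr_sumr => /(mulfI _) e.
  rewrite /reduced !xpart_st !tpart_st.
  have := congr1 (horner^~ t0) (e _); rewrite expf_neq0 ?polyXsubC_eq0 // => /(_ isT).
  by rewrite !horner_sum; under eq_bigr do rewrite hornerZ; under [in RHS]eq_bigr do rewrite hornerZ.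
have hK : hat_grad K t0 = (vertex_poly K d).[t0] *: bary_grad (vert K) d.
  by rewrite /hat_grad (bigD1 d) //= big1 ?addr0 // => j /root0 ->; rewrite scale0r.
have hL : hat_grad L t0 = (vertex_poly L d').[t0] *: bary_grad (vert L) d'.
  rewrite /hat_grad (bigD1 d') //= big1 ?addr0 // => i /to_face[j /root0 pj ->].
  by rewrite pj scale0r.
have [a a0 ga] := opposite_faces KL Kx Lx HK HL cd cd'.
have gg : 0 < dotp (bary_grad (vert L) d') (bary_grad (vert L) d').
  by rewrite lt_def dotp_ge0 dotp_eq0 (bary_grad_neq0 mesh).
(* The gradients on [K] and [L] point to the same side, the gradients of the coordinates [d] and
   [d'] to opposite sides. *)
have pp : (vertex_poly K d).[t0] * (vertex_poly L d').[t0] < 0.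
  move: gKL; rewrite hK hL ga !dotpZl !dotpZr !mulrA (pmulr_lgt0 _ gg) mulrAC.
  by rewrite nmulr_lgt0.
have pK0 : (vertex_poly K d).[t0] != 0 by apply: contraTneq pp => ->; rewrite mul0r ltxx.
have pL0 : (vertex_poly L d').[t0] != 0 by apply: contraTneq pp => ->; rewrite mulr0 ltxx.
have tv : tpart v != 0 by apply: contraTneq vw => ->; rewrite mul0r ltxx.
have st' u : tpart (v + st u 0) = tpart v by rewrite tpartD tpart_st addr0.
have sv : 0 < tpart v * tpart v by rewrite -expr2 exprn_even_gt0.
have signK u (Uu : face_dir K x0 u) := face_sign mesh phih_fe btP pK0 (Tv u Uu)
  (eq_ind_r (fun a => 0 < tpart v * a) sv (st' u)).
have [sL _] := face_sign mesh phih_fe bt'P pL0 Tw vw.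
have U0 : face_dir K x0 0 by move=> j _; rewrite dotp0r.
(* This power multiplies both signed values given by [face_sign]. They are nonpositive although
   their vertex factors have opposite signs, which leaves only the value zero. *)
have tm : tpart v ^+ m != 0 by rewrite expf_neq0.
have red0 : reduced K d bt (st x0 t0) = 0.
  have [sK _] := signK 0 U0; rewrite -redE in sL.
  apply/eqP/negPn/negP => r0; have : 0 <= (tpart v ^+ m * reduced K d bt (st x0 t0)) ^+ 2 *
     ((vertex_poly K d).[t0] * (vertex_poly L d').[t0]).
    rewrite (_ : _ * _ = (tpart v ^+ m * (vertex_poly K d).[t0] * reduced K d bt (st x0 t0)) *
      (tpart v ^+ m * (vertex_poly L d').[t0] * reduced K d bt (st x0 t0))); last by ring.
    exact: mulr_le0.
  rewrite pmulr_rge0; first by rewrite leNgt pp.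
  by rewrite exprn_even_gt0 // mulf_neq0.
(* The cone contains [v] plus every real multiple of the face direction, so a linear inequality in
   that multiple forces zero slope. *)
have slope0 u : face_dir K x0 u -> \sum_(j | j != d) dotp (bary_grad (vert K) j) u * (bt j).[t0] = 0.
  move=> Uu; set S := \sum_(j | _) _.
  pose k := tpart v ^+ m * (vertex_poly K d).[t0].
  have k0 : k != 0 by rewrite mulf_neq0.
  pose g := dotp (grad (fun y : 'rV[R]_(3 + 1) => k * reduced K d bt y) (st x0 t0)) v.
  have H r : g + r * (k * S) <= 0.
    have [_ h] := signK _ (face_dirZ r Uu).
    have {h} := h ltac:(by rewrite red0 mulr0).
    rewrite dotpDr -/k -/g (_ : st (r *: u) 0 = r *: st u 0); last by rewrite -stZ mulr0.
    by rewrite dotpZr reduced_grad.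
  apply/eqP/negPn/negP => S0; have := H ((1 - g) / (k * S)).
  by rewrite mulfVK ?mulf_neq0 // addrC subrK ler10.
(* At [t0] the reduced function is affine in space, vanishes at [x0] and has no slope along the
   face, so its value at vertex [j0], which is [(bt j0).[t0]], would be zero. *)
have := slope0 _ (edge j0 j0d); rewrite (eq_bigr (fun j => (j0 == j)%:R * (bt j).[t0]
   - bary (vert K) j x0 * (bt j).[t0])); last first.
  by move=> j _; rewrite -baryB (bary_vertex _ _ nd) mulrBl.
rewrite sumrB (bigD1 j0) //= eqxx mul1r big1 ?addr0; last first.
  by move=> j /andP[_ jj0]; rewrite eq_sym (negPf jj0) mul0r.
move: red0; rewrite /reduced xpart_st tpart_st => ->; rewrite subr0 => e.
by rewrite e eqxx in btj0.
Qed.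

End SameSide.

(** * Perturbation of unit vectors *)

Section Vectors.
Context {R : realType}.

Lemma perp_family (n k : nat) (f : 'I_k -> 'rV[R]_n) : (k < n)%N ->
  exists2 v : 'rV[R]_n, v != 0 & forall i, dotp (f i) v = 0.
Proof.
move=> kn; have [v v0 vA] := kernel_nontrivial (\matrix_(i, j) f j 0 i) kn.
exists v => // i; have /matrixP/(_ 0 i) := vA; rewrite !mxE => <-.
by apply: eq_bigr => j _; rewrite !mxE mulrC.
Qed.

Lemma perp3 (a b d : 'rV[R]_4) : exists2 v : 'rV[R]_4, v != 0 & [/\ dotp a v = 0, dotp b v = 0 & dotp d v = 0].
Proof.
have [//|v v0 H] := @perp_family 4 3 (fun i => [:: a; b; d]`_i).
exists v => //; split; [exact: (H ord0)|exact: (H (@Ordinal 3 1 isT))|].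
exact: (H (@Ordinal 3 2 isT)).
Qed.

Lemma perp2 (a b : 'rV[R]_3) : exists2 v : 'rV[R]_3, v != 0 & dotp a v = 0 /\ dotp b v = 0.
Proof.
have [//|v v0 H] := @perp_family 3 2 (fun i => [:: a; b]`_i).
by exists v => //; split; [exact: (H ord0)|exact: (H (@Ordinal 2 1 isT))].
Qed.

Lemma orthogonal_basis (e f p u : 'rV[R]_3) : e != 0 -> f != 0 -> p != 0 ->
  dotp e f = 0 -> dotp p e = 0 -> dotp p f = 0 -> dotp p u = 0 ->
  u = (dotp u e / dotp e e) *: e + (dotp u f / dotp f f) *: f.
Proof.
move=> e0 f0 p0 ef pe pf pu; set v := _ + _; apply/eqP; rewrite -subr_eq0; set r := u - v.
have ee : dotp e e != 0 by rewrite dotp_eq0.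
have ff : dotp f f != 0 by rewrite dotp_eq0.
have re : dotp r e = 0 by rewrite dotpBl dotpDl !dotpZl (dotpC f) ef mulr0 addr0 divfK // subrr.
have rf : dotp r f = 0 by rewrite dotpBl dotpDl !dotpZl ef mulr0 add0r divfK // subrr.
have pr : dotp p r = 0 by rewrite dotpBr dotpDr !dotpZr pu pe pf !mulr0 addr0 subr0.
apply/negPn/negP => r0; case/negP: p0.
by rewrite (perp_parallel (independent_perp e0 f0 ef) r0 re rf pe pf) pr mul0r scale0r.
Qed.

Lemma near_pos (n : nat) (a x y : 'rV[R]_n) : enorm a = 1 -> enorm (x - a) <= 8^-1 ->
  enorm (y - a) <= 8^-1 -> 0 < dotp x y.
Proof.
move=> a1 xa ya; rewrite -[x](subrK a) -[y](subrK a).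
move: (x - a) (y - a) xa ya => u v xa ya.
rewrite dotpDl !dotpDr -(enorm_sqr a) a1 expr1n.
have h1 : `|dotp u v| <= 8^-1.
  apply: (le_trans (cauchy_schwarz _ _)); rewrite -[leRHS]mulr1; apply: ler_pM => //; try exact: enorm_ge0.
  by apply: (le_trans ya); rewrite invf_le1 // ler1n.
have h2 : `|dotp u a| <= 8^-1 by apply: (le_trans (cauchy_schwarz _ _)); rewrite a1 mulr1.
have h3 : `|dotp a v| <= 8^-1 by apply: (le_trans (cauchy_schwarz _ _)); rewrite a1 mul1r.
move: h1 h2 h3; rewrite !ler_norml => /andP[h1 _] /andP[h2 _] /andP[h3 _].
by move: h1 h2 h3; move: (dotp u v) (dotp u a) (dotp a v) => r s t; clear; lra.
Qed.

Lemma proj_off (n : nat) (a b b0 : 'rV[R]_n) (eps : R) : enorm a = 1 -> enorm b0 = 1 -> dotp a b0 = 0 ->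
  enorm (b - b0) <= eps -> eps <= 8^-1 ->
  let r := a - (dotp a b / dotp b b) *: b in
  dotp r b = 0 /\ enorm (r - a) <= 2 * eps.
Proof.
move=> a1 b1 ab bb e4 r.
have b12 : 2^-1 <= enorm b.
  have := enorm_subr_ge b0 b; rewrite enorm_distC b1; move: (le_trans bb e4).
  by move: (enorm b) (enorm (b - b0)) => s t; clear; lra.
have nb : 0 < enorm b by apply: lt_le_trans b12.
have bn : dotp b b = enorm b ^+ 2 by rewrite enorm_sqr.
have b2 : dotp b b != 0 by rewrite bn expf_neq0 // gt_eqF.
split; first by rewrite /r dotpBl dotpZl divfK // subrr.
rewrite /r addrAC subrr add0r enormN enormZ bn normrM normrV ?unitfE ?expf_neq0 ?gt_eqF //.
rewrite (ger0_norm (sqr_ge0 _)) expr2 invfM -!mulrA mulVf ?gt_eqF // mulr1.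
rewrite ler_pdivrMr //.
have h : `|dotp a b| <= eps.
  rewrite -[b](subrK b0) dotpDr ab addr0; apply: (le_trans (cauchy_schwarz _ _)).
  by rewrite a1 mul1r.
apply: (le_trans h); have e0 : 0 <= eps by exact: le_trans (enorm_ge0 _) bb.
have := ler_wpM2l e0 b12; move: (enorm b) => s; clear; lra.
Qed.

Lemma close_vectors_fine (n : nat) (f g g' : 'rV[R]_n) (eta : R) : eta <= 100^-1 -> 0 < enorm f ->
  enorm (g - f) <= eta * enorm f -> enorm (g' - f) <= eta * enorm f ->
  enorm (g' - g) <= 32^-1 * enorm g.
Proof.
move=> e1 f0 gf g'f; have ef : eta * enorm f <= 100^-1 * enorm f by rewrite ler_wpM2r // ltW.
have h := enorm_dist g' f g; have := enorm_subr_ge f g.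
rewrite !(enorm_distC f) in h *.
move: h f0 (le_trans gf ef) (le_trans g'f ef).
by move: (enorm f) (enorm (g - f)) (enorm (g' - f)) (enorm g) (enorm (g' - g)) => r s t u v; clear; lra.
Qed.

Lemma near_preimage (n : nat) (g q y : 'rV[R]_n) : enorm g = 1 ->
  enorm (q - y) <= 100^-1 * enorm y -> enorm (q - g) <= 25^-1 -> enorm (y - g) <= 8^-1.
Proof.
move=> g1 qy qg; apply: (le_trans (enorm_dist _ q _)); rewrite (enorm_distC y q).
have := enorm_subr_ge y q; rewrite (enorm_distC y q); have := enorm_subr_ge q g; rewrite g1.
by move: qy qg; move: (enorm (q - y)) (enorm (q - g)) (enorm y) (enorm q) => a b d e; clear; lra.
Qed.

(** With a = w.v < 0 the unit length gives a^2 = 1 - b^2, hence - a >= 1 - b^2 and |w + v|^2 = 2 + 2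
    a <= 2 b^2. *)
Lemma nearly_opposite (n : nat) (v w g : 'rV[R]_n) (b : R) : enorm v = 1 -> enorm w = 1 ->
  dotp v g = 0 -> enorm g = 1 -> dotp w v < 0 -> w = dotp w v *: v + b *: g -> `|b| <= 32^-1 ->
  enorm (w + v) <= 16^-1.
Proof.
move=> v1 w1 vg g1 a0 wE b1; rewrite -ler_sqr ?nnegrE ?enorm_ge0 // enorm_sqr !dotpDl !dotpDr.
have vv : dotp v v = 1 by rewrite -enorm_sqr v1 expr1n.
have ww : dotp w w = 1 by rewrite -enorm_sqr w1 expr1n.
have wg : dotp w g = b.
  by rewrite wE dotpDl !dotpZl vg mulr0 add0r -enorm_sqr g1 expr1n mulr1.
have : dotp w w = dotp w v * dotp w v + b * b by rewrite {2}wE dotpDr !dotpZr wg.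
rewrite ww vv (dotpC v w); have := ler_pM (normr_ge0 b) (normr_ge0 b) b1 b1.
rewrite -normrM ger0_norm -?expr2 ?sqr_ge0 // => h.
have : 0 <= b ^+ 2 := sqr_ge0 b.
move: h a0; move: (b ^+ 2) (dotp w v) => s a; clear => h a0 s0 e.
have a1 : 1 - s <= - a by rewrite leNgt; apply/negP; nra.
lra.
Qed.

(** Margins for the two successive projections of size 2/100 and 4/100 and for the deformation of
    nearly opposite directions, with relative error 1/100. *)
Lemma numeric_steps : [/\ 2 * (2 * 100^-1) <= 25^-1 :> R, 2 * 100^-1 <= 8^-1 :> R,
  100^-1 <= 8^-1 :> R & 100^-1 + 16^-1 <= 8^-1 :> R].
Proof. by split; lra. Qed.

End Vectors.

(** * Half-space cones and their edges before the deformation *)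

Section HalfCones.
Context {R : realType} (P : problem R) (ks kq : nat) (c eta : R).
Hypothesis ks_ge1 : (1 <= ks)%N.
Context (D : discretization R).
Hypothesis ds : discrete_setting ks kq D P c.
Variable n : 'I_(nslab D).
Implicit Types (K L : 'I_(ntet D)) (x u : 'rV[R]_3) (t : R) (z v w nu : 'rV[R]_(3 + 1)).
Local Notation cut := (Defs.cut ks kq n).
Local Notation phihatK := (phihatK ks kq n).
Local Notation hat_grad := (hat_grad ks kq n).
Local Notation zero_set := (zero_set ks kq n).
Local Notation jac_tr := (jac_tr ks kq n).
Local Notation ThetaK := (@ThetaK R ks kq D n).
Let mesh := ds_mesh ds.
Let fe := ds_phih ds.

(** The conormal pulled back to the undeformed prism; within the tangent space of the zero set its
    kernel is the edge. *)
Definition edge_form K z nu v : R := dotp (v *m jac_tr K z) nu.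

Definition half_cone K z nu := forall v, tangent_cone (zero_set K) z v <->
  dotp (grad (phihatK K) z) v = 0 /\ edge_form K z nu v <= 0.

Definition edge_vec K z nu v := dotp (grad (phihatK K) z) v = 0 /\ edge_form K z nu v = 0.

Lemma edge_formD K z nu v w : edge_form K z nu (v + w) = edge_form K z nu v + edge_form K z nu w.
Proof. by rewrite /edge_form mulmxDl dotpDl. Qed.

Lemma edge_formZ K z nu a v : edge_form K z nu (a *: v) = a * edge_form K z nu v.
Proof. by rewrite /edge_form -scalemxAl dotpZl. Qed.

Lemma edge_formE K z nu v : edge_form K z nu v = dotp (nu *m (jac_tr K z)^T) v.
Proof.
by rewrite /edge_form dotpC !dotp_mulmx trmx_mul mulmxA.
Qed.

Lemma edge_vecD K z nu v w : edge_vec K z nu v -> edge_vec K z nu w -> edge_vec K z nu (v + w).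
Proof. by move=> [h1 h2] [h3 h4]; split; rewrite ?edge_formD ?dotpDr ?h1 ?h2 ?h3 ?h4 addr0. Qed.

Lemma edge_vecZ K z nu a v : edge_vec K z nu v -> edge_vec K z nu (a *: v).
Proof. by move=> [h1 h2]; split; rewrite ?edge_formZ ?dotpZr ?h1 ?h2 mulr0. Qed.

Lemma cone_active K x t v j : tangent_cone (zero_set K) (st x t) v -> bary (vert K) j x = 0 ->
  0 <= dotp (bary_grad (vert K) j) (xpart v).
Proof.
move=> Tv bj; pose F (y : 'rV[R]_(3 + 1)) := - bary (vert K) j (xpart y).
have dF : differentiable F (st x t).
  apply: differentiableN; apply: differentiable_xpart.
  exact: poly_fun_differentiable (poly_fun_bary _ _).
have := tangent_cone_le dF _ Tv; rewrite (@grad_affine_dir _ _ F _ v (- dotp (bary_grad (vert K) j) (xpart v))) //.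
  rewrite oppr_le0; apply=> y [[Ky _] _]; rewrite /F xpart_st bj oppr0 oppr_le0.
  by move/(tetP mesh): Ky.
by move=> s; rewrite /F xpartD xpartZ baryD dotpZr opprD mulrN.
Qed.

Lemma cone_time K x t v : tangent_cone (zero_set K) (st x t) v ->
  (t = tnode D n -> 0 <= tpart v) /\ (t = tnode D n.+1 -> tpart v <= 0).
Proof.
move=> Tv; pose F (a : R) (y : 'rV[R]_(3 + 1)) := a * tpart y.
have dF a : differentiable (F a) (st x t).
  have := poly_differentiable_tpart (a *: 'X) (st x t).
  by rewrite (_ : (fun y => _) = F a) //; apply/funext => y; rewrite hornerZ hornerX.
have gF a : dotp (grad (F a) (st x t)) v = a * tpart v.
  by apply: grad_affine_dir => // s; rewrite /F tpartD tpartZ mulrDr mulrCA.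
split=> te.
  have := tangent_cone_le (dF (-1)) _ Tv; rewrite gF mulN1r oppr_le0; apply=> y [[_ Iy] _].
  by move: Iy; rewrite /F !mulN1r lerN2 tpart_st te /slab /= in_itv => /andP[].
have := tangent_cone_le (dF 1) _ Tv; rewrite gF mul1r; apply=> y [[_ Iy] _].
by move: Iy; rewrite /F !mul1r tpart_st te /slab /= in_itv => /andP[].
Qed.

Lemma edge_vec_cone K z nu v : half_cone K z nu -> edge_vec K z nu v ->
  tangent_cone (zero_set K) z v /\ tangent_cone (zero_set K) z (- v).
Proof.
move=> H [gv mv]; split; apply/H; first by rewrite gv mv.
by rewrite dotpNr gv oppr0 -scaleN1r edge_formZ mv mulr0.
Qed.

(** Both [v] and [- v] lie in the cone, so no coordinate that vanishes at [x] can change along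
    [v]. *)
Lemma edge_vec_face K x t nu v : half_cone K (st x t) nu -> edge_vec K (st x t) nu v ->
  face_dir K x (xpart v).
Proof.
move=> H /(edge_vec_cone H)[T1 T2] j bj; apply/le_anti; rewrite (cone_active T1 bj) andbT.
by have := cone_active T2 bj; rewrite -scaleN1r xpartZ dotpZr mulN1r oppr_ge0.
Qed.

(** At an end of the slab all time components in the cone have one sign, but the cone contains both
    [v] and [- v]. *)
Lemma edge_vec_time K x t nu v : half_cone K (st x t) nu -> edge_vec K (st x t) nu v -> slab n t ->
  tpart v != 0 -> tnode D n < t < tnode D n.+1.
Proof.
move=> H /(edge_vec_cone H)[T1 T2]; rewrite /slab /= in_itv /= => /andP[t1 t2] tv.
have [a1 a2] := cone_time T1; have [b1 b2] := cone_time T2.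
rewrite tpartN in b1 b2; rewrite !lt_neqAle t1 t2 !andbT; apply/andP; split; apply: contraNneq tv => e.
  have /esym h := e; apply/eqP/le_anti; rewrite (a1 h) andbT.
  by have := b1 h; rewrite oppr_ge0.
apply/eqP/le_anti; rewrite (a2 e) /=.
by have := b2 e; rewrite oppr_le0.
Qed.

Lemma spatial_line K x t u : tet K x -> slab n t -> phihatK K (st x t) = 0 ->
  dotp (hat_grad K t) u = 0 -> (forall j, bary (vert K) j x = 0 -> 0 <= dotp (bary_grad (vert K) j) u) ->
  exists2 d : R, 0 < d & forall r, 0 <= r <= d -> tet K (x + r *: u) /\ phihatK K (st (x + r *: u) t) = 0.
Proof.
move=> Kx It f0 gu H; have [d d0 dP] := tet_line mesh Kx H; exists d => // r /dP Kr; split=> //.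
by rewrite (phihatKD mesh fe) f0 dotpZr gu mulr0 addr0.
Qed.

Lemma spatial_cone K x t u : tet K x -> slab n t -> phihatK K (st x t) = 0 ->
  dotp (hat_grad K t) u = 0 -> (forall j, bary (vert K) j x = 0 -> 0 <= dotp (bary_grad (vert K) j) u) ->
  tangent_cone (zero_set K) (st x t) (st u 0).
Proof.
move=> Kx It f0 gu H; have [d d0 dP] := spatial_line Kx It f0 gu H.
apply: tangent_cone_line; exists d => // s s0 sd.
have [Ks fs] := dP s ltac:(by rewrite !ltW).
by rewrite -stZ -stD mulr0 addr0; split=> //; apply/prism_st.
Qed.

Lemma grad_spatial K x t u : dotp (grad (phihatK K) (st x t)) (st u 0) = dotp (hat_grad K t) u.
Proof. by rewrite (grad_phihatK_x mesh fe) tpart_st. Qed.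

Lemma spatial_edge K x t nu u : half_cone K (st x t) nu -> tet K x -> slab n t -> phihatK K (st x t) = 0 ->
  face_dir K x u -> dotp (hat_grad K t) u = 0 -> edge_vec K (st x t) nu (st u 0).
Proof.
move=> H Kx It f0 Uu gu; split; first by rewrite grad_spatial.
apply/le_anti/andP; split.
  suff T : tangent_cone (zero_set K) (st x t) (st u 0) by case/H: T.
  by apply: spatial_cone => // j /Uu ->.
suff /H[_] : tangent_cone (zero_set K) (st x t) ((-1) *: st u 0).
  by rewrite edge_formZ mulN1r oppr_le0.
rewrite -stZ mulr0; apply: spatial_cone => //; first by rewrite dotpZr gu mulr0.
by move=> j /Uu; rewrite dotpZr => ->; rewrite mulr0.
Qed.

(* The deformations and the interpolants of two prisms agree on their intersection. *)
Lemma common_direction K L z v (d : R) : cut K -> cut L -> 0 < d ->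
  (forall s, 0 <= s -> s < d -> prism n K (z + s *: v) /\ prism n L (z + s *: v)) ->
  v *m jac_tr K z = v *m jac_tr L z /\ dotp (grad (phihatK K) z) v = dotp (grad (phihatK L) z) v.
Proof.
move=> cK cL d0 H; have [Kz Lz] : prism n K z /\ prism n L z.
  by have := H 0 (lexx 0) d0; rewrite scale0r addr0.
have [->|v0] := eqVneq v 0; first by split; [move: (jac_tr K z) (jac_tr L z) => M1 M2; rewrite 2!mul0mx|rewrite 2!dotp0r].
have nv : 0 < enorm v by rewrite enorm_gt0.
have step (r : R) : 0 < r -> exists2 s, 0 < s & enorm (s *: v) < r /\ s < d.
  move=> r0; have m0 : 0 < Num.min d (r / enorm v) by rewrite lt_min d0 divr_gt0.
  have mm : Num.min d (r / enorm v) / 2 < Num.min d (r / enorm v) by rewrite ltr_pdivrMr // ltr_pMr // ltr1n.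
  exists (Num.min d (r / enorm v) / 2); first by rewrite divr_gt0.
  rewrite enormZ gtr0_norm ?divr_gt0 // -ltr_pdivlMr //.
  by split; apply: (lt_le_trans mm); rewrite ge_min lexx ?orbT.
have tri (m : nat) (a a' b : 'rV[R]_m) (e : R) : enorm (b - a) <= e -> enorm (b - a') <= e -> enorm (a - a') <= 2 * e.
  move=> h1 h2; apply: (le_trans (enorm_dist _ b _)); rewrite (enorm_distC a) mulr_natl mulr2n; exact: lerD.
have scale (s e X : R) : 0 < s -> s * X <= 2 * (e / 2 / enorm v * (s * enorm v)) -> X <= e.
  move=> s0; rewrite (_ : 2 * _ = s * e); first by rewrite ler_pM2l.
  by field; rewrite gt_eqF.
have shift s : z + s *: v - z = s *: v by rewrite addrAC subrr add0r.
split.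
  apply/eqP; rewrite -subr_eq0 -enorm_eq0; apply/eqP/le_anti; rewrite enorm_ge0 andbT.
  apply/ler_addgt0Pr => e e0; rewrite add0r.
  have e' : 0 < e / 2 / enorm v by rewrite !divr_gt0.
  have [d1 d10 H1] := jac_trP ks_ge1 ds n K z e'; have [d2 d20 H2] := jac_trP ks_ge1 ds n L z e'.
  have [|s s0] := step (Num.min d1 d2); first by rewrite lt_min d10.
  rewrite lt_min => -[/andP[s1 s2] sd]; have [Ks Ls] := H s (ltW s0) sd.
  have := H1 (z + s *: v); have := H2 (z + s *: v); rewrite !shift => /(_ s2) h2 /(_ s1) h1.
  have TK : ThetaK K (z + s *: v) - ThetaK K z = ThetaK L (z + s *: v) - ThetaK L z.
    rewrite -(Theta_prism ks_ge1 ds cK Ks) -(Theta_prism ks_ge1 ds cK Kz).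
    by rewrite (Theta_prism ks_ge1 ds cL Ls) (Theta_prism ks_ge1 ds cL Lz).
  rewrite TK in h1; have := tri _ _ _ _ _ h1 h2.
  move: (jac_tr K z) (jac_tr L z) => M1 M2.
  by rewrite -[_ *m M1]scalemxAl -[_ *m M2]scalemxAl -scalerBr 2!enormZ (gtr0_norm s0); exact: scale.
apply/eqP; rewrite -subr_eq0 -normr_eq0; apply/eqP/le_anti; rewrite normr_ge0 andbT.
apply/ler_addgt0Pr => e e0; rewrite add0r.
have e' : 0 < e / 2 / enorm v by rewrite !divr_gt0.
have [d1 d10 H1] := differentiable_grad (phihatK_differentiable mesh fe n K z) e'.
have [d2 d20 H2] := differentiable_grad (phihatK_differentiable mesh fe n L z) e'.
have [|s s0] := step (Num.min d1 d2); first by rewrite lt_min d10.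
rewrite lt_min => -[/andP[s1 s2] sd]; have [Ks Ls] := H s (ltW s0) sd.
have := H1 (z + s *: v); have := H2 (z + s *: v); rewrite !shift => /(_ s2) h2 /(_ s1) h1.
rewrite (phihatK_prism ds Ks Ls) (phihatK_prism ds Kz Lz) in h1.
rewrite distrC in h1; apply: (scale s) => //.
apply: (le_trans _ (le_trans (lerD h1 h2) _)); last by rewrite enormZ gtr0_norm // mulr_natl mulr2n.
rewrite -{1}(gtr0_norm s0) -normrM mulrBr -2!dotpZr.
by apply: (le_trans _ (ler_normD _ _)); rewrite addrA subrK.
Qed.

Lemma common_spatial K L x t u : cut K -> cut L -> tet K x -> tet L x -> slab n t -> face_dir K x u ->
  st u 0 *m jac_tr K (st x t) = st u 0 *m jac_tr L (st x t) /\
  dotp (hat_grad K t) u = dotp (hat_grad L t) u.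
Proof.
move=> cK cL Kx Lx It Uu; have UL := face_dir_shared mesh Kx Lx Uu.
have [d1 d10 H1] := face_dir_line mesh Kx Uu; have [d2 d20 H2] := face_dir_line mesh Lx UL.
have [||h1 h2] := @common_direction K L (st x t) (st u 0) (Num.min d1 d2) cK cL; first by rewrite lt_min d10.
  move=> s s0; rewrite lt_min => /andP[s1 s2]; rewrite -stZ -stD mulr0 addr0.
  by split; apply/prism_st; split=> //; [apply: H1|apply: H2]; rewrite ger0_norm // ltW.
split; first exact: h1.
exact: (etrans (esym (grad_spatial K x t u)) (etrans h2 (grad_spatial L x t u))).
Qed.

Lemma common_spacetime K L x t u : cut K -> cut L -> tet K x -> tet L x -> tnode D n < t < tnode D n.+1 ->
  face_dir K x u ->
  st u 1 *m jac_tr K (st x t) = st u 1 *m jac_tr L (st x t) /\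
  dotp (grad (phihatK K) (st x t)) (st u 1) = dotp (grad (phihatK L) (st x t)) (st u 1).
Proof.
move=> cK cL Kx Lx /andP[t1 t2] Uu; have UL := face_dir_shared mesh Kx Lx Uu.
have [d1 d10 H1] := face_dir_line mesh Kx Uu; have [d2 d20 H2] := face_dir_line mesh Lx UL.
apply: (@common_direction K L (st x t) (st u 1) (Num.min d1 (Num.min d2 (tnode D n.+1 - t))) cK cL).
  by rewrite !lt_min d10 d20 subr_gt0.
move=> s s0; rewrite !lt_min => /and3P[s1 s2 s3]; rewrite -stZ -stD mulr1.
have It : slab n (t + s).
  by rewrite /slab /= in_itv /= (le_trans (ltW t1)) ?lerDl // -lerBrDl ltW.
by split; apply/prism_st; (split; last exact: It); [apply: H1|apply: H2]; rewrite ger0_norm // ltW.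
Qed.

End HalfCones.
(* The orthonormal pairs [(n1, nu1)] and [(n2, nu2)] share the edge space
   [span (t1, t2)] and have opposite orientations; see [conormal_jump]. *)
Definition edge_frame (R : realType) (n1 n2 nu1 nu2 : 'rV[R]_4) := exists t1 t2 k q w1 w2 : 'rV[R]_4,
  [/\ (forall a b, a *: t1 + b *: t2 = 0 -> a = 0 /\ b = 0),
      (forall t, t \in [:: t1; t2] ->
         [/\ dotp t n1 = 0, dotp t nu1 = 0, dotp t n2 = 0, dotp t nu2 = 0 & dotp k t = 0]),
      [/\ dotp k q = 0, 0 < dotp q n1 & 0 < dotp q n2],
      [/\ dotp w1 n1 = 0, dotp w1 nu1 < 0, dotp w2 n2 = 0 & dotp w2 nu2 < 0]
    & dotp k w1 * dotp k w2 < 0].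

(** * Common edge and opposite orientations of two pieces *)

Section EdgeFrames.
Context {R : realType} (P : problem R) (ks kq : nat) (c eta : R).
Hypothesis ks_ge1 : (1 <= ks)%N.
Hypothesis cont : continuous_setting P ks kq c.
Context (D : discretization R).
Hypothesis ds : discrete_setting ks kq D P c.
Variable n : 'I_(nslab D).
Hypothesis eta1 : eta <= 100^-1.
Implicit Types (K L : 'I_(ntet D)) (x u e f : 'rV[R]_3) (t : R) (z v w nu : 'rV[R]_(3 + 1)).
Local Notation cut := (Defs.cut ks kq n).
Local Notation phihatK := (phihatK ks kq n).
Local Notation hat_grad := (hat_grad ks kq n).
Local Notation zero_set := (zero_set ks kq n).
Local Notation jac_tr := (jac_tr ks kq n).
Local Notation nShK := (nShK ks kq n).
Local Notation half_cone := (half_cone ks kq n).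
Local Notation edge_vec := (edge_vec ks kq n).
Local Notation edge_form := (edge_form ks kq n).
Hypothesis grad_close : forall K x t, cut K -> tet K x -> slab n t ->
  0 < enorm (gradx (phi P) (st x t)) /\
  enorm (hat_grad K t - gradx (phi P) (st x t)) <= eta * enorm (gradx (phi P) (st x t)).
Hypothesis Theta_id : forall K x (y : 'rV[R]_3) t, cut K -> tet K x -> slab n t -> enorm (y - x) <= diam (tet K) ->
  enorm (xpart (@ThetaK R ks kq D n K (st y t)) - xpart (@ThetaK R ks kq D n K (st x t)) - (y - x))
    <= eta * enorm (y - x).
Let mesh := ds_mesh ds.
Let incr := tg_incr (ds_time ds).
Let fe := ds_phih ds.

Lemma eta_lt1 : eta < 1.
Proof. by apply: (le_lt_trans eta1); rewrite invf_lt1 // ltr1n. Qed.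

Lemma eta_le8 : eta <= 8^-1.
Proof. by apply: (le_trans eta1); rewrite lef_pV2 ?posrE // ler_nat. Qed.

Lemma hat_grad_gt0 K x t : cut K -> tet K x -> slab n t -> 0 < enorm (hat_grad K t).
Proof.
by move=> cK Kx It; have [f0 gf] := grad_close cK Kx It; have [] := close_vectors eta_le8 f0 gf gf.
Qed.

Lemma hat_grad_slab K x : cut K -> tet K x -> forall t, slab n t -> hat_grad K t != 0.
Proof. by move=> cK Kx t It; rewrite -enorm_gt0; exact: hat_grad_gt0 cK Kx It. Qed.

Lemma spatial_image K x t u : cut K -> tet K x -> slab n t ->
  exists2 u' : 'rV[R]_3, st u 0 *m jac_tr K (st x t) = st u' 0 & enorm (u' - u) <= 100^-1 * enorm u.
Proof.
move=> cK Kx It; exists (xpart (st u 0 *m jac_tr K (st x t))).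
  by rewrite -[LHS]st_parts (tpart_jac_tr ks_ge1 ds) tpart_st.
apply: (le_trans (jac_tr_near_id ks_ge1 ds Theta_id u cK Kx It)).
by rewrite ler_wpM2r // enorm_ge0.
Qed.

(** The preimage y of [q] under the derivative of the deformation stays close to [g], and the
    product of [q] with the discrete normal is a positive multiple of that of y with
    [hat_grad K t]. *)
Lemma normal_positive K x t (g q : 'rV[R]_3) (r k : R) : cut K -> tet K x -> slab n t ->
  0 < k -> (forall v, dotp (nShK K (st x t)) (v *m jac_tr K (st x t)) = k * dotp (grad (phihatK K) (st x t)) v) ->
  enorm g = 1 -> 0 < r -> enorm (r *: hat_grad K t - g) <= 8^-1 -> enorm (q - g) <= 25^-1 ->
  0 < dotp (st q 0) (nShK K (st x t)).
Proof.
move=> cK Kx It k0 nP g1 r0 hg qg.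
have Mu := jac_tr_unit ks_ge1 ds eta_lt1 Theta_id cK Kx It.
set M := jac_tr K (st x t) in Mu nP; pose y := xpart (st q 0 *m invmx M).
have yE : st q 0 = st y 0 *m M.
  have ty : tpart (st q 0 *m invmx M) = 0.
    by rewrite -(tpart_jac_tr ks_ge1 ds n K (st x t)) -/M mulmxKV // tpart_st.
  suff -> : st y 0 = st q 0 *m invmx M by rewrite mulmxKV.
  by rewrite -[RHS]st_parts ty.
have [y' y'E yy'] := spatial_image y cK Kx It; rewrite -/M -yE in y'E.
have {y'E} qy : q = y' by have := congr1 xpart y'E; rewrite !xpart_st.
subst y'; rewrite dotpC yE nP pmulr_rgt0 // (grad_spatial ds) -(pmulr_rgt0 _ r0) -dotpZl.
exact: near_pos g1 hg (near_preimage g1 yy' qg).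
Qed.

Variables (K1 K2 : 'I_(ntet D)) (x0 : 'rV[R]_3) (t0 : R) (nu1 nu2 : 'rV[R]_(3 + 1)).
Hypotheses (c1 : cut K1) (c2 : cut K2) (K12 : K1 != K2).
Hypotheses (K1x : tet K1 x0) (K2x : tet K2 x0) (It0 : slab n t0) (f1 : phihatK K1 (st x0 t0) = 0).
Hypothesis zero_set_neq : zero_set K1 <> zero_set K2.
Local Notation z0 := (st x0 t0).
Hypotheses (H1 : half_cone K1 z0 nu1) (H2 : half_cone K2 z0 nu2).
Hypotheses (nu1_unit : enorm nu1 = 1) (nu2_unit : enorm nu2 = 1).
Hypotheses (n_nu1 : dotp (nShK K1 z0) nu1 = 0) (n_nu2 : dotp (nShK K2 z0) nu2 = 0).
Variables (k1 k2 : R).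
Hypotheses (k1_gt0 : 0 < k1) (k2_gt0 : 0 < k2).
Hypothesis n1P : forall v, dotp (nShK K1 z0) (v *m jac_tr K1 z0) = k1 * dotp (grad (phihatK K1) z0) v.
Hypothesis n2P : forall v, dotp (nShK K2 z0) (v *m jac_tr K2 z0) = k2 * dotp (grad (phihatK K2) z0) v.

Lemma f2 : phihatK K2 z0 = 0.
Proof. by rewrite -f1; exact: (phihatK_consistent mesh fe incr n t0 K2x K1x). Qed.

(** The edge vectors and the inward vectors are chosen before the deformation and pushed forward;
    only [k] and [q] live in the deformed space. *)
Lemma frame_intro (t1 t2 k q v1 v2 : 'rV[R]_(3 + 1)) :
  (forall a b, a *: t1 + b *: t2 = 0 -> a = 0 /\ b = 0) ->
  (forall w, w \in [:: t1; t2] -> [/\ edge_vec K1 z0 nu1 w, edge_vec K2 z0 nu2 w,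
     w *m jac_tr K1 z0 = w *m jac_tr K2 z0 & dotp k (w *m jac_tr K1 z0) = 0]) ->
  [/\ dotp k q = 0, 0 < dotp q (nShK K1 z0) & 0 < dotp q (nShK K2 z0)] ->
  dotp (grad (phihatK K1) z0) v1 = 0 -> edge_form K1 z0 nu1 v1 < 0 ->
  dotp (grad (phihatK K2) z0) v2 = 0 -> edge_form K2 z0 nu2 v2 < 0 ->
  dotp k (v1 *m jac_tr K1 z0) * dotp k (v2 *m jac_tr K2 z0) < 0 ->
  edge_frame (nShK K1 z0) (nShK K2 z0) nu1 nu2.
Proof.
move=> indep T Q g1 m1 g2 m2 kv; have Mu := jac_tr_unit ks_ge1 ds eta_lt1 Theta_id c1 K1x It0.
exists (t1 *m jac_tr K1 z0), (t2 *m jac_tr K1 z0), k, q, (v1 *m jac_tr K1 z0), (v2 *m jac_tr K2 z0); split=> //.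
- move=> a b; move: (jac_tr K1 z0) Mu => M Mu; rewrite !scalemxAl -mulmxDl => /(congr1 (mulmx^~ (invmx M))).
  by rewrite mulmxK // mul0mx => /indep.
- have common w : w \in [:: t1; t2] -> [/\ dotp (w *m jac_tr K1 z0) (nShK K1 z0) = 0, dotp (w *m jac_tr K1 z0) nu1 = 0,
      dotp (w *m jac_tr K1 z0) (nShK K2 z0) = 0, dotp (w *m jac_tr K1 z0) nu2 = 0 & dotp k (w *m jac_tr K1 z0) = 0].
    move=> /T[[h1 h2] [h3 h4] e h5].
    have E1 : dotp (nShK K1 z0) (w *m jac_tr K1 z0) = 0 by rewrite n1P h1 mulr0.
    have E2 : dotp (nShK K2 z0) (w *m jac_tr K2 z0) = 0 by rewrite n2P h3 mulr0.
    split; [by rewrite dotpC; exact: E1|exact: h2|by rewrite e dotpC; exact: E2|by rewrite e; exact: h4|exact: h5].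
  by move=> w; rewrite !inE => /orP[] /eqP ->; apply: common; rewrite !inE eqxx ?orbT.
- have E1 : dotp (nShK K1 z0) (v1 *m jac_tr K1 z0) = 0 by rewrite n1P g1 mulr0.
  have E2 : dotp (nShK K2 z0) (v2 *m jac_tr K2 z0) = 0 by rewrite n2P g2 mulr0.
  split; [by rewrite dotpC; exact: E1|exact: m1|by rewrite dotpC; exact: E2|exact: m2].
Qed.

Lemma inward K nu (nn : 'rV[R]_(3 + 1)) (k : R) : jac_tr K z0 \in unitmx -> 0 < k -> enorm nu = 1 -> dotp nn nu = 0 ->
  (forall v, dotp nn (v *m jac_tr K z0) = k * dotp (grad (phihatK K) z0) v) ->
  exists2 v, dotp (grad (phihatK K) z0) v = 0 & edge_form K z0 nu v < 0.
Proof.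
move=> Mu k0 nu1' nnu nP; exists (- nu *m invmx (jac_tr K z0)).
  apply/eqP; rewrite -(mulrI_eq0 _ (lregP (lt0r_neq0 k0))) -nP mulmxKV // dotpNr nnu oppr0 eqxx //.
by rewrite /edge_form mulmxKV // dotpNl -enorm_sqr nu1' expr1n oppr_lt0.
Qed.

Lemma common_spatial_edge u : face_dir K1 x0 u -> dotp (hat_grad K1 t0) u = 0 ->
  [/\ edge_vec K1 z0 nu1 (st u 0), edge_vec K2 z0 nu2 (st u 0)
    & st u 0 *m jac_tr K1 z0 = st u 0 *m jac_tr K2 z0].
Proof.
move=> U1 gu; have [e1 e2] := common_spatial ks_ge1 ds c1 c2 K1x K2x It0 U1.
split; [exact: (spatial_edge ds H1 K1x It0 f1 U1 gu)| |exact: e1].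
exact: (spatial_edge ds H2 K2x It0 f2 (face_dir_shared mesh K1x K2x U1) (etrans (esym e2) gu)).
Qed.

(** Tangency, the edge condition and a zero time component are three linear conditions in R^4. *)
Lemma spatial_edge_exists : exists2 e, enorm e = 1 & face_dir K1 x0 e /\ dotp (hat_grad K1 t0) e = 0.
Proof.
have [v v0 [gv mv tv]] := perp3 (grad (phihatK K1) z0) (nu1 *m (jac_tr K1 z0)^T) (st 0 1).
rewrite -edge_formE in mv.
have tv0 : tpart v = 0 by rewrite -tv -{2}(st_parts v) dotp_st dotp0l add0r mul1r.
have vE : v = st (xpart v) 0 by rewrite -tv0 st_parts.
have u0 : xpart v != 0 by apply: contraNneq v0 => e; rewrite vE e st0.
exists ((enorm (xpart v))^-1 *: xpart v).
  by rewrite enormZ normfV ger0_norm ?enorm_ge0 // mulVf // enorm_eq0.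
split; first by apply: face_dirZ; exact: (edge_vec_face ds H1 (conj gv mv)).
by rewrite dotpZr -(grad_spatial ds n K1 x0) -vE gv mulr0.
Qed.

Lemma dotp_time w : dotp (st 0 1) w = tpart w.
Proof. by rewrite -{1}(st_parts w) dotp_st dotp0l add0r mul1r. Qed.

Lemma spatial_combination K nu e f p u : half_cone K z0 nu -> tet K x0 -> phihatK K z0 = 0 ->
  e != 0 -> f != 0 -> dotp e f = 0 -> face_dir K x0 e -> face_dir K x0 f ->
  p = hat_grad K t0 -> p != 0 -> dotp p e = 0 -> dotp p f = 0 -> dotp p u = 0 ->
  edge_form K z0 nu (st u 0) = 0.
Proof.
move=> H Kx fK e0 f0 ef Ue Uf pE p0 pe pf pu.
have Uu : face_dir K x0 u.
  by rewrite (orthogonal_basis e0 f0 p0 ef pe pf pu); apply: face_dirD; exact: face_dirZ.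
by rewrite pE in pu; case: (spatial_edge ds H Kx It0 fK Uu pu).
Qed.

(** Two independent face directions in the zero plane force the gradient of each vanishing
    coordinate to be parallel to [hat_grad K t0]; gradients of different coordinates are not
    parallel. *)
Lemma unique_active K e f : tet K x0 -> cut K -> e != 0 -> f != 0 -> dotp e f = 0 ->
  face_dir K x0 e -> face_dir K x0 f -> dotp (hat_grad K t0) e = 0 -> dotp (hat_grad K t0) f = 0 ->
  (forall j, bary (vert K) j x0 = 0 -> exists2 a : R, a != 0 & bary_grad (vert K) j = a *: hat_grad K t0) /\
  (forall j j', bary (vert K) j x0 = 0 -> bary (vert K) j' x0 = 0 -> j = j').
Proof.
move=> Kx cK e0 f0 ef Ue Uf pe pf; have p0 := hat_grad_slab cK Kx It0.
have par j : bary (vert K) j x0 = 0 -> exists2 a : R, a != 0 & bary_grad (vert K) j = a *: hat_grad K t0.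
  move=> bj; have E := perp_parallel (independent_perp e0 f0 ef) p0 pe pf (Ue j bj) (Uf j bj).
  exists (dotp (bary_grad (vert K) j) (hat_grad K t0) / dotp (hat_grad K t0) (hat_grad K t0)); last exact: E.
  by apply: contraNneq (bary_grad_neq0 mesh K j) => a0; rewrite E a0 scale0r.
split=> // j j' /par[a a0 aE] /par[b b0 bE]; apply/eqP/negPn/negP => jj'.
have [] := @bary_grad_parallel _ _ _ _ mesh K j j' b a jj'; first by rewrite aE bE !scalerA mulrC.
by move=> /eqP; rewrite (negPf b0).
Qed.

Lemma scaled_grad_close : let r := (enorm (hat_grad K1 t0))^-1 in
  [/\ 0 < r, enorm (r *: hat_grad K1 t0) = 1, enorm (r *: hat_grad K2 t0 - r *: hat_grad K1 t0) <= 32^-1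
    & 0 < dotp (hat_grad K1 t0) (hat_grad K2 t0)].
Proof.
move=> r; have g0 := hat_grad_gt0 c1 K1x It0; have r0 : 0 < r by rewrite invr_gt0.
have [a0 ga] := grad_close c1 K1x It0; have [_ ga'] := grad_close c2 K2x It0.
have [_ _ gg] := close_vectors eta_le8 a0 ga ga'.
have h := close_vectors_fine eta1 a0 ga ga'.
split=> //; first by rewrite enormZ gtr0_norm // mulVf // gt_eqF.
by rewrite -scalerBr enormZ gtr0_norm // mulrC ler_pdivrMr.
Qed.

Lemma normals_positive (q : 'rV[R]_3) :
  enorm (q - (enorm (hat_grad K1 t0))^-1 *: hat_grad K1 t0) <= 25^-1 ->
  0 < dotp (st q 0) (nShK K1 z0) /\ 0 < dotp (st q 0) (nShK K2 z0).
Proof.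
have [r0 g1 g2 _] := scaled_grad_close; move=> hq; split.
  apply: (normal_positive c1 K1x It0 k1_gt0 n1P g1 r0 _ hq).
  by rewrite subrr enorm0 invr_ge0 ler0n.
apply: (normal_positive c2 K2x It0 k2_gt0 n2P g1 r0 _ hq); apply: (le_trans g2).
by rewrite lef_pV2 ?posrE ?ltr0n // ler_nat.
Qed.

(* The edge is a piece of the time slice [t0]. *)
Lemma edge_frame_face e f : e != 0 -> face_dir K1 x0 e -> dotp (hat_grad K1 t0) e = 0 ->
  f != 0 -> face_dir K1 x0 f -> dotp (hat_grad K1 t0) f = 0 -> dotp e f = 0 ->
  edge_frame (nShK K1 z0) (nShK K2 z0) nu1 nu2.
Proof.
move=> e0 Ue ge f0 Uf gf ef.
have p1 := hat_grad_slab c1 K1x; have p2 := hat_grad_slab c2 K2x.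
have Ue2 := face_dir_shared mesh K1x K2x Ue; have Uf2 := face_dir_shared mesh K1x K2x Uf.
have [_ ee] := common_spatial ks_ge1 ds c1 c2 K1x K2x It0 Ue.
have [_ ff] := common_spatial ks_ge1 ds c1 c2 K1x K2x It0 Uf.
have ge2 := etrans (esym ee) ge; have gf2 := etrans (esym ff) gf.
have [par1 uniq1] := unique_active K1x c1 e0 f0 ef Ue Uf ge gf.
have [_ uniq2] := unique_active K2x c2 e0 f0 ef Ue2 Uf2 ge2 gf2.
have [v1 g1 m1] := inward (jac_tr_unit ks_ge1 ds eta_lt1 Theta_id c1 K1x It0) k1_gt0 nu1_unit n_nu1 n1P.
have [v2 g2 m2] := inward (jac_tr_unit ks_ge1 ds eta_lt1 Theta_id c2 K2x It0) k2_gt0 nu2_unit n_nu2 n2P.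
(* A purely spatial [v1] would be a combination of [e] and [f], on which the edge form vanishes. *)
have tv1 : tpart v1 != 0.
  apply: contraTneq m1 => tv; have vE : v1 = st (xpart v1) 0 by rewrite -tv st_parts.
  have pu : dotp (hat_grad K1 t0) (xpart v1) = 0 by rewrite -(grad_spatial ds n K1 x0) -vE.
  by rewrite vE (spatial_combination H1 K1x f1 e0 f0 ef Ue Uf erefl (p1 _ It0) ge gf pu) ltxx.
have tv2 : tpart v2 != 0.
  apply: contraTneq m2 => tv; have vE : v2 = st (xpart v2) 0 by rewrite -tv st_parts.
  have pu : dotp (hat_grad K2 t0) (xpart v2) = 0 by rewrite -(grad_spatial ds n K2 x0) -vE.
  by rewrite vE (spatial_combination H2 K2x f2 e0 f0 ef Ue2 Uf2 erefl (p2 _ It0) ge2 gf2 pu) ltxx.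
(* The gradient is parallel to that of a coordinate vanishing at [x0], which face directions
   annihilate. *)
have hU u : face_dir K1 x0 u -> dotp (hat_grad K1 t0) u = 0.
  have [d cd] := noncommon_vertex mesh K12; have bd := noncommon_bary mesh K12 K1x K2x cd.
  move=> /(_ d bd); have [a a0 ->] := par1 d bd; rewrite dotpZl => /eqP.
  by rewrite mulf_eq0 (negPf a0) => /eqP.
have [r0 gh _ gg] := scaled_grad_close.
have Tv u : face_dir K1 x0 u -> tangent_cone (zero_set K1) z0 (v1 + st u 0).
  move=> Uu; have [[h1 h2] _ _] := common_spatial_edge Uu (hU u Uu).
  by apply/H1; rewrite dotpDr g1 h1 addr0 edge_formD h2 addr0; split=> //; exact: ltW.
have Tw : tangent_cone (zero_set K2) z0 v2 by apply/H2; split=> //; exact: ltW.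
have opp : tpart v1 * tpart v2 < 0.
  rewrite lt_neqAle mulf_neq0 //= leNgt; apply/negP.
  exact: (no_same_side mesh fe incr K12 K1x K2x It0 f1 uniq1 uniq2 p1 p2 hU gg Tv Tw zero_set_neq).
have [q1 q2] : 0 < dotp (st ((enorm (hat_grad K1 t0))^-1 *: hat_grad K1 t0) 0) (nShK K1 z0) /\
    0 < dotp (st ((enorm (hat_grad K1 t0))^-1 *: hat_grad K1 t0) 0) (nShK K2 z0).
  by apply: normals_positive; rewrite subrr enorm0 invr_ge0 ler0n.
(* [k] is the time direction, preserved by the deformation and zero on the spatial edge; [q] is the
   unit spatial gradient. *)
apply: (@frame_intro (st e 0) (st f 0) (st 0 1) _ v1 v2 _ _ (And3 _ q1 q2) g1 m1 g2 m2).
- move=> a b; rewrite -!stZ -stD !mulr0 addr0 => /(congr1 xpart); rewrite xpart_st -[xpart 0]/(lsubmx 0) raddf0.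
  exact: independent_perp.
- have common u : face_dir K1 x0 u -> [/\ edge_vec K1 z0 nu1 (st u 0), edge_vec K2 z0 nu2 (st u 0),
     st u 0 *m jac_tr K1 z0 = st u 0 *m jac_tr K2 z0 & dotp (st 0 1) (st u 0 *m jac_tr K1 z0) = 0].
    move=> Uu; have [h1 h2 h3] := common_spatial_edge Uu (hU u Uu).
    split; [exact: h1|exact: h2|exact: h3|].
    by rewrite dotp_time (tpart_jac_tr ks_ge1 ds) tpart_st.
  by move=> w; rewrite !inE => /orP[] /eqP ->; exact: common.
- by rewrite dotp_time tpart_st.
- have tM K v : tpart v = dotp (st 0 1) (v *m jac_tr K z0).
    exact: (etrans (esym (tpart_jac_tr ks_ge1 ds n K z0 v)) (esym (dotp_time _))).
  by rewrite (tM K1 v1) (tM K2 v2) in opp; exact: opp.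
Qed.

(** The edge space is a plane, so it has a nonzero vector orthogonal to [st e 0]. By assumption this
    is not spatial; it is scaled to time component 1 and places [t0] inside the slab. *)
Lemma time_edge K nu e : half_cone K z0 nu ->
  (forall u, face_dir K x0 u -> dotp (hat_grad K t0) u = 0 -> dotp e u = 0 -> u = 0) ->
  exists tau : 'rV[R]_3, [/\ edge_vec K z0 nu (st tau 1), face_dir K x0 tau & tnode D n < t0 < tnode D n.+1].
Proof.
move=> H only0; have [v v0 [gv mv ev]] := perp3 (grad (phihatK K) z0) (nu *m (jac_tr K z0)^T) (st e 0).
rewrite -edge_formE in mv; have Ev : edge_vec K z0 nu v by split.
have tv : tpart v != 0.
  apply: contraNneq v0 => tv; have vE : v = st (xpart v) 0 by rewrite -tv st_parts.
  rewrite vE (only0 (xpart v)) ?st0 //; first exact: (edge_vec_face ds H Ev).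
    by rewrite -(grad_spatial ds n K x0) -vE.
  by move: ev; rewrite {1}vE dotp_st mul0r addr0.
have sE : st ((tpart v)^-1 *: xpart v) 1 = (tpart v)^-1 *: v.
  by transitivity ((tpart v)^-1 *: st (xpart v) (tpart v)); [rewrite -stZ mulVf|rewrite st_parts].
exists ((tpart v)^-1 *: xpart v); split.
- by rewrite sE; exact: (edge_vecZ _ Ev).
- by apply: face_dirZ; exact: (edge_vec_face ds H Ev).
- exact: (edge_vec_time H Ev It0 tv).
Qed.

(** A nonzero [v] orthogonal to [e] and to the gradient has a nonzero edge form, otherwise it would
    be a spatial edge vector and vanish. Its sign is chosen so that [v] points into the piece. *)
Lemma side_direction K nu e : half_cone K z0 nu -> tet K x0 -> phihatK K z0 = 0 ->
  (forall u, face_dir K x0 u -> dotp (hat_grad K t0) u = 0 -> dotp e u = 0 -> u = 0) ->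
  exists v : 'rV[R]_3, [/\ enorm v = 1, dotp e v = 0, dotp (hat_grad K t0) v = 0, edge_form K z0 nu (st v 0) < 0
    & exists2 d : R, 0 < d & forall r, 0 <= r <= d -> tet K (x0 + r *: v) /\ phihatK K (st (x0 + r *: v) t0) = 0].
Proof.
move=> H Kx fK only0; have [v v0 [ev gv]] := perp2 e (hat_grad K t0).
have scale (a : R) : a * edge_form K z0 nu (st v 0) < 0 -> enorm (a *: v) = 1 -> exists v : 'rV[R]_3,
   [/\ enorm v = 1, dotp e v = 0, dotp (hat_grad K t0) v = 0, edge_form K z0 nu (st v 0) < 0
    & exists2 d : R, 0 < d & forall r, 0 <= r <= d -> tet K (x0 + r *: v) /\ phihatK K (st (x0 + r *: v) t0) = 0].
  move=> m0 a1; have m : edge_form K z0 nu (st (a *: v) 0) < 0.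
    by rewrite (_ : st (a *: v) 0 = a *: st v 0) ?edge_formZ // -stZ mulr0.
  have ga : dotp (hat_grad K t0) (a *: v) = 0 by rewrite dotpZr gv mulr0.
  exists (a *: v); split; [exact: a1|by rewrite dotpZr ev mulr0|exact: ga|exact: m|].
  apply: (spatial_line ds Kx It0 fK ga) => j bj; rewrite -(xpart_st (a *: v) 0); apply: (cone_active ds _ bj).
  by apply/H; split; [rewrite (grad_spatial ds)|exact: ltW].
have nv : 0 < (enorm v)^-1 by rewrite invr_gt0 enorm_gt0.
have n1 : (enorm v)^-1 * enorm v = 1 by rewrite mulVf // enorm_eq0.
have m0 : edge_form K z0 nu (st v 0) != 0.
  apply: contraNneq v0 => m0; apply/eqP/only0 => //.
  rewrite -(xpart_st v 0); apply: (edge_vec_face ds H); split; last exact: m0.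
  by rewrite (grad_spatial ds).
have [m|m] := ltP (edge_form K z0 nu (st v 0)) 0.
  by apply: (scale (enorm v)^-1); [rewrite pmulr_rlt0|rewrite enormZ gtr0_norm].
apply: (scale (- (enorm v)^-1)); last by rewrite enormZ normrN gtr0_norm.
by rewrite nmulr_rlt0 ?oppr_lt0 // lt_def m0.
Qed.

Hypotheses (good1 : good_at ks kq n K1 x0 t0) (good2 : good_at ks kq n K2 x0 t0).

(* The pieces lie on different sides of the edge in the time slice [t0]. *)
Lemma side_directions_opposite (e v1 v2 : 'rV[R]_3) (d1 d2 : R) : enorm e = 1 -> enorm v1 = 1 -> enorm v2 = 1 ->
  face_dir K1 x0 e -> dotp (hat_grad K1 t0) e = 0 ->
  (forall u, face_dir K1 x0 u -> dotp (hat_grad K1 t0) u = 0 -> dotp e u = 0 -> u = 0) ->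
  (forall u, face_dir K2 x0 u -> dotp (hat_grad K2 t0) u = 0 -> dotp e u = 0 -> u = 0) ->
  dotp e v1 = 0 -> dotp e v2 = 0 -> dotp (hat_grad K1 t0) v1 = 0 -> dotp (hat_grad K2 t0) v2 = 0 ->
  0 < d1 -> (forall r, 0 <= r <= d1 -> tet K1 (x0 + r *: v1) /\ phihatK K1 (st (x0 + r *: v1) t0) = 0) ->
  0 < d2 -> (forall r, 0 <= r <= d2 -> tet K2 (x0 + r *: v2) /\ phihatK K2 (st (x0 + r *: v2) t0) = 0) ->
  v2 = dotp v2 v1 *: v1 + (dotp v2 (hat_grad K1 t0) / dotp (hat_grad K1 t0) (hat_grad K1 t0)) *: hat_grad K1 t0
  /\ dotp v2 v1 < 0.
Proof.
move=> e1 v11 v21 Ue ge only1 only2 ev1 ev2 gv1 gv2 d10 line1 d20 line2.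
have unit0 (m : nat) (w : 'rV[R]_m) : enorm w = 1 -> w != 0 by move=> w1; rewrite -enorm_gt0 w1.
have e0 := unit0 _ _ e1; have v10 := unit0 _ _ v11; have v20 := unit0 _ _ v21.
have g0 := hat_grad_slab c1 K1x It0; set g := hat_grad K1 t0 in ge gv1 g0 only1 *.
have vv : dotp v1 v1 = 1 by rewrite -enorm_sqr v11 expr1n.
have v2E : v2 = dotp v2 v1 *: v1 + (dotp v2 g / dotp g g) *: g.
  rewrite -[dotp v2 v1]divr1 -[X in _ / X *: v1]vv.
  by apply: (orthogonal_basis v10 g0 e0) => //; rewrite 1?dotpC.
split=> //; set a := dotp v2 v1 in v2E *; set b := _ / _ in v2E; rewrite ltNge; apply/negP => a0.
have [_ _ _ gg] := scaled_grad_close; rewrite -/g in gg.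
(* For [a] = 0 the vector [v2] would be a multiple of [g], which is not orthogonal to the gradient
   on [K2]. *)
have {a0} a0 : 0 < a.
  rewrite lt_def a0 andbT; apply/negP => /eqP az; case/negP: v20; rewrite v2E az scale0r add0r.
  have := gv2; rewrite {1}v2E az scale0r add0r dotpZr dotpC => /eqP.
  by rewrite mulf_eq0 (gt_eqF gg) orbF => /eqP ->; rewrite scale0r.
have [d3 d30 line3] : exists2 d : R, 0 < d & forall L r, tet L x0 -> `|r| <= d ->
    tet L (x0 + r *: e) /\ phihatK L (st (x0 + r *: e) t0) = 0.
  have [dd dd0 H0] := face_dir_line mesh K1x Ue.
  have /fin_all_exists[d dP] L : exists d : R, 0 < d /\ (tet L x0 -> forall r, `|r| <= d -> tet L (x0 + r *: e)).
    have [Lx|nLx] := pselect (tet L x0); last by exists 1.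
    by have [d d0 dP] := face_dir_line mesh Lx (face_dir_shared mesh K1x Lx Ue); exists d.
  exists (Num.min dd (\big[Num.min/1]_L d L)).
    by rewrite lt_min dd0; apply: lt_bigmin => // L _; case: (dP L).
  move=> L r Lx; rewrite le_min => /andP[r1 r2].
  have Lr : tet L (x0 + r *: e).
    case: (dP L) => _ /(_ Lx); apply; apply: (le_trans r2); exact: bigmin_le.
  split=> //; rewrite (phihatK_consistent mesh fe incr n t0 Lr (H0 r r1)).
  by rewrite (phihatKD mesh fe) f1 add0r dotpZr ge mulr0.
pose d := Num.min d3 (Num.min d1 (d2 * a)).
have d0 : 0 < d by rewrite !lt_min d30 d10 mulr_gt0.
have dd3 : d <= d3 by rewrite ge_min lexx.
have dd1 : d <= d1 by rewrite /d minCA ge_min lexx.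
have dd2 : d <= d2 * a by rewrite /d minA ge_min lexx orbT.
have b0 : b / a = 0.
  apply: (zero_directions_coincide cont ds eta_le8 grad_close c1 c2 K1x It0 d0 e0 v10 ev1 gv1 (v2 := a^-1 *: v2)).
  - by move=> L r Lx rd; apply: line3 => //; apply: le_trans dd3.
  - by move=> r /andP[r0 rd]; apply: line1; rewrite r0 (le_trans rd).
  - move=> r /andP[r0 rd]; rewrite scalerA; apply: line2; rewrite mulr_ge0 ?invr_ge0 ?(ltW a0) //=.
    by rewrite ler_pdivrMr // (le_trans rd).
  - by rewrite v2E scalerDr !scalerA mulVf ?gt_eqF // scale1r mulrC.
have {b0} bb : b = 0 by move/eqP: b0; rewrite mulf_eq0 invr_eq0 (gt_eqF a0) orbF => /eqP.
have a1 : a = 1.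
  by have := congr1 enorm v2E; rewrite bb scale0r addr0 enormZ v11 v21 mulr1 gtr0_norm.
(* The common direction spans with [e] a triangle contained in both zero sets; [coincident_face]
   then makes these equal. *)
have v12 : v2 = v1 by rewrite v2E bb a1 scale0r addr0 scale1r.
rewrite v12 in line2 gv2; rewrite a1 mulr1 in dd2.
have dI : 0 <= d <= d1 by rewrite ltW.
have dI2 : 0 <= d <= d2 by rewrite ltW.
have dd : `|d| <= d3 by rewrite gtr0_norm.
have [K1v _] := line1 d dI; have [K2v _] := line2 d dI2.
have [K1e _] := line3 K1 d K1x dd; have [K2e _] := line3 K2 d K2x dd.
have K21 : K2 != K1 by rewrite eq_sym.
have nv1 : ~ face_dir K1 x0 v1 by move=> U1; case/negP: v10; rewrite (only1 v1 U1).
have nv2 : ~ face_dir K2 x0 v1 by move=> U2; case/negP: v10; rewrite (only2 v1 U2).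
have [_ ee] := common_spatial ks_ge1 ds c1 c2 K1x K2x It0 Ue.
have P1 := coincident_face mesh fe K12 (hat_grad_slab c1 K1x) good1 K1x K2x It0 e0 v10 ev1 d0 K1e K2e K1v K2v f1 ge gv1 nv1.
have P2 := coincident_face mesh fe K21 (hat_grad_slab c2 K2x) good2 K2x K1x It0 e0 v10 ev1 d0 K2e K1e K2v K1v f2
  (etrans (esym ee) ge) gv2 nv2.
apply: zero_set_neq; apply/seteqP; split=> z Az.
  exact: (zero_set_shared mesh fe incr Az (P1 z Az)).
exact: (zero_set_shared mesh fe incr Az (P2 z Az)).
Qed.

(* The edge crosses the time slice [t0]. *)
Lemma edge_frame_edge e : enorm e = 1 -> face_dir K1 x0 e -> dotp (hat_grad K1 t0) e = 0 ->
  (forall u, face_dir K1 x0 u -> dotp (hat_grad K1 t0) u = 0 -> dotp e u = 0 -> u = 0) ->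
  edge_frame (nShK K1 z0) (nShK K2 z0) nu1 nu2.
Proof.
move=> e1 Ue ge only1; have [b11 b22 b33 b44] := @numeric_steps R.
have [E1 E2 EM] := common_spatial_edge Ue ge.
have ee : dotp e e = 1 by rewrite -enorm_sqr e1 expr1n.
have only2 u : face_dir K2 x0 u -> dotp (hat_grad K2 t0) u = 0 -> dotp e u = 0 -> u = 0.
  move=> U2 gu eu; have U1 := face_dir_shared mesh K2x K1x U2.
  have [_ gg] := common_spatial ks_ge1 ds c1 c2 K1x K2x It0 U1.
  exact: only1 U1 (etrans gg gu) eu.
have [tau1 [W1 U1 Io]] := time_edge H1 only1; have [tau2 [W2 U2 _]] := time_edge H2 only2.
have U2' := face_dir_shared mesh K2x K1x U2.
have [_ G2] := common_spacetime ks_ge1 ds c1 c2 K1x K2x Io U2'.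
have [TM _] := common_spacetime ks_ge1 ds c1 c2 K1x K2x Io U1.
(* The difference of the two edge directions is a face direction of slope zero, hence a multiple of
   [e]; so [st tau1 1] belongs to both edges. *)
have tauE : tau1 = tau2 + dotp e (tau1 - tau2) *: e.
  have gd : dotp (hat_grad K1 t0) (tau1 - tau2) = 0.
    rewrite -(grad_spatial ds n K1 x0) (_ : st _ 0 = st tau1 1 - st tau2 1); last by rewrite -stB subrr.
    by rewrite dotpBr [X in X - _](proj1 W1) [X in _ - X](etrans G2 (proj1 W2)) subrr.
  have Ud : face_dir K1 x0 (tau1 - tau2).
    by rewrite -scaleN1r; exact: face_dirD U1 (face_dirZ (-1) U2').
  apply/eqP; rewrite -subr_eq0 opprD addrA; apply/eqP.
  move: (tau1 - tau2) gd Ud => d gd Ud; apply: only1.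
  - rewrite -scaleNr; exact: face_dirD Ud (face_dirZ _ Ue).
  - by rewrite dotpBr dotpZr gd ge mulr0 subrr.
  - by rewrite dotpBr dotpZr ee mulr1 subrr.
have W2' : edge_vec K2 z0 nu2 (st tau1 1).
  have -> : st tau1 1 = st tau2 1 + dotp e (tau1 - tau2) *: st e 0.
    by rewrite -stZ -stD mulr0 addr0 -tauE.
  exact: edge_vecD W2 (edge_vecZ _ E2).
have [v1 [v11 ev1 gv1 m1 [d1 d10 line1]]] := side_direction H1 K1x f1 only1.
have [v2 [v21 ev2 gv2 m2 [d2 d20 line2]]] := side_direction H2 K2x f2 only2.
have [v2E a0] := side_directions_opposite e1 v11 v21 Ue ge only1 only2 ev1 ev2 gv1 gv2 d10 line1 d20 line2.
have [r0 gh1 gh2 _] := scaled_grad_close.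
set g := hat_grad K1 t0 in v2E r0 gh1 gh2 ge gv1 *; set r := (enorm g)^-1 in r0 gh1 gh2.
have gv : dotp v1 (r *: g) = 0 by rewrite dotpZr dotpC gv1 mulr0.
have v2E' : v2 = dotp v2 v1 *: v1 + dotp v2 (r *: g) *: (r *: g).
  rewrite [LHS]v2E; congr (_ + _); rewrite dotpZr scalerA mulrAC; congr (_ *: _).
  rewrite -enorm_sqr mulrC; congr (_ * _).
  by rewrite -expr2 /r exprVn.
have b1 : `|dotp v2 (r *: g)| <= 32^-1.
  have -> : dotp v2 (r *: g) = - dotp v2 (r *: hat_grad K2 t0 - r *: g).
    by rewrite dotpBr (dotpZr _ (hat_grad K2 t0)) (dotpC v2 (hat_grad K2 t0)) gv2 mulr0 sub0r opprK.
  by rewrite normrN; apply: (le_trans (cauchy_schwarz _ _)); rewrite v21 mul1r.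
have near_opp := nearly_opposite v11 v21 gv gh1 a0 v2E' b1.
have [e' e'E ee'] := spatial_image e c1 K1x It0; rewrite e1 mulr1 in ee'.
have [v1' v1'E vv1] := spatial_image v1 c1 K1x It0; rewrite v11 mulr1 in vv1.
have [v2' v2'E vv2] := spatial_image v2 c2 K2x It0; rewrite v21 mulr1 in vv2.
(* [kx] is [v1] made orthogonal to the image [e'] of the edge direction, and [q] is the unit
   gradient made orthogonal to [kx]. The time entry [- dotp kx w] will make the covector vanish on
   the image of [st tau1 1] too. *)
have [] := @proj_off R 3 v1 e' e 100^-1 v11 e1 (etrans (dotpC _ _) ev1) ee' b33.
set kx := v1 - _ => ke kv.
have [] := @proj_off R 3 (r *: g) kx v1 (2 * 100^-1) gh1 v11 (etrans (dotpC _ _) gv) kv b22.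
set q := r *: g - _ => qk qg.
have [n1q n2q] : 0 < dotp (st q 0) (nShK K1 z0) /\ 0 < dotp (st q 0) (nShK K2 z0).
  by apply: normals_positive; apply: (le_trans qg); exact: b11.
pose w := xpart (st tau1 1 *m jac_tr K1 z0).
have wE : st tau1 1 *m jac_tr K1 z0 = st w 1.
  by rewrite -[LHS]st_parts (tpart_jac_tr ks_ge1 ds) tpart_st.
have kv8 : enorm (kx - v1) <= 8^-1 by apply: (le_trans kv); exact: b22.
have vv8 : enorm (v1' - v1) <= 8^-1 by apply: (le_trans vv1); exact: b33.
have vv8' : enorm (- v2' - v1) <= 8^-1.
  rewrite -opprD enormN -(subrK v2 v2') -addrA; apply: (le_trans (enormD _ _)).
  by apply: (le_trans (lerD vv2 near_opp)); exact: b44.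
have kv1 : 0 < dotp kx v1' := near_pos v11 kv8 vv8.
have kv2 : dotp kx v2' < 0 by have := near_pos v11 kv8 vv8'; rewrite dotpNr oppr_gt0.
have kqE : dotp (st kx (- dotp kx w)) (st q 0) = 0 by rewrite dotp_st mulr0 addr0 dotpC.
have g1v : dotp (grad (phihatK K1) z0) (st v1 0) = 0 by rewrite (grad_spatial ds).
have g2v : dotp (grad (phihatK K2) z0) (st v2 0) = 0 by rewrite (grad_spatial ds).
apply: (@frame_intro (st e 0) (st tau1 1) (st kx (- dotp kx w)) (st q 0) (st v1 0) (st v2 0) _ _
  (And3 kqE n1q n2q) g1v m1 g2v m2).
- move=> a b; rewrite -!stZ -stD mulr0 add0r mulr1 => ab.
  have b0 : b = 0 by have := congr1 (@tpart R) ab; rewrite tpart_st -st0 tpart_st.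
  move: ab; rewrite b0 scale0r addr0 => /(congr1 (@xpart R)); rewrite -st0 !xpart_st => /eqP.
  rewrite scaler_eq0 -enorm_eq0 e1 oner_eq0 orbF => /eqP az.
  by split; [exact: az|exact: erefl].
- have T1 : [/\ edge_vec K1 z0 nu1 (st e 0), edge_vec K2 z0 nu2 (st e 0),
      st e 0 *m jac_tr K1 z0 = st e 0 *m jac_tr K2 z0 & dotp (st kx (- dotp kx w)) (st e 0 *m jac_tr K1 z0) = 0].
    by split; [exact: E1|exact: E2|exact: EM|rewrite e'E dotp_st mulr0 addr0; exact: ke].
  have T2 : [/\ edge_vec K1 z0 nu1 (st tau1 1), edge_vec K2 z0 nu2 (st tau1 1),
      st tau1 1 *m jac_tr K1 z0 = st tau1 1 *m jac_tr K2 z0 & dotp (st kx (- dotp kx w)) (st tau1 1 *m jac_tr K1 z0) = 0].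
    by split; [exact: W1|exact: W2'|exact: TM|rewrite wE dotp_st mulr1 subrr].
  by move=> z; rewrite !inE => /orP[] /eqP ->; [exact: T1|exact: T2].
- rewrite v1'E v2'E 2!dotp_st mulr0 2!addr0 (pmulr_rlt0 _ kv1); exact: kv2.
Qed.

(** The cases are whether the spatial edge directions are more than one-dimensional. *)
Lemma edge_frame_exists : edge_frame (nShK K1 z0) (nShK K2 z0) nu1 nu2.
Proof.
have [e e1 [Ue ge]] := spatial_edge_exists.
have [[f [f0 Uf gf ef]]|H] := pselect (exists f : 'rV[R]_3,
    [/\ f != 0, face_dir K1 x0 f, dotp (hat_grad K1 t0) f = 0 & dotp e f = 0]).
  by apply: (edge_frame_face _ Ue ge f0 Uf gf ef); rewrite -enorm_gt0 e1.
apply: (edge_frame_edge e1 Ue ge) => u Uu gu eu; apply/eqP/negPn/negP => u0.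
by apply: H; exists u.
Qed.

End EdgeFrames.
(** * The exceptional set and the conormal jump *)

Section ExceptionalPoints.
Context {R : realType} (P : problem R) (ks kq : nat) (c eta : R).
Hypothesis ks_ge1 : (1 <= ks)%N.
Hypothesis cont : continuous_setting P ks kq c.
Context (D : discretization R).
Hypothesis ds : discrete_setting ks kq D P c.
Variable n : 'I_(nslab D).
Hypothesis eta1 : eta <= 100^-1.
Implicit Types (K L : 'I_(ntet D)) (x u : 'rV[R]_3) (t : R) (z v w nu : 'rV[R]_(3 + 1)).
Local Notation cut := (Defs.cut ks kq n).
Local Notation hat_grad := (hat_grad ks kq n).
Local Notation vertex_poly := (vertex_poly ks kq n).
Local Notation zero_set := (zero_set ks kq n).
Local Notation ThetaK := (@ThetaK R ks kq D n).
Hypothesis grad_close : forall K x t, cut K -> tet K x -> slab n t ->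
  0 < enorm (gradx (phi P) (st x t)) /\
  enorm (hat_grad K t - gradx (phi P) (st x t)) <= eta * enorm (gradx (phi P) (st x t)).
Hypothesis Theta_id : forall K x (y : 'rV[R]_3) t, cut K -> tet K x -> slab n t -> enorm (y - x) <= diam (tet K) ->
  enorm (xpart (ThetaK K (st y t)) - xpart (ThetaK K (st x t)) - (y - x)) <= eta * enorm (y - x).
Let mesh := ds_mesh ds.

Lemma edge_point K x (d d' : 'I_4) : tet K x -> d != d' -> bary (vert K) d x = 0 -> bary (vert K) d' x = 0 ->
  exists a a' r, 0 <= r <= 1 /\ x = vert K a + r *: (vert K a' - vert K a).
Proof.
move=> Kx dd' bd bd'; have [a [ad ad']] := third_index d d'.
have [a' a'P] : exists a', uniq [:: a'; a; d; d'].
  have : (#|[:: a; d; d']| < #|'I_4|)%N by rewrite card_ord (leq_ltn_trans (card_size _)).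
  rewrite -(cardC (mem [:: a; d; d'])) -[leqLHS]addn1 leq_add2l => /card_gt0P[a' a'P].
  by exists a'; rewrite cons_uniq; move: a'P; rewrite !inE /= !inE => ->; rewrite negb_or ad ad' dd'.
have all4 j : j \in [:: a'; a; d; d'].
  apply: contraT => nj; have /card_uniqP : uniq (j :: [:: a'; a; d; d']) by rewrite cons_uniq nj a'P.
  by move=> /= e; have := max_card (mem [:: j; a'; a; d; d']); rewrite e card_ord.
have sum4 (V : nmodType) (F : 'I_4 -> V) : F d = 0 -> F d' = 0 -> \sum_j F j = F a' + F a.
  move=> Fd Fd'; rewrite -(eq_bigl _ _ all4) -big_uniq // !big_cons big_nil Fd Fd'.
  by rewrite /= !addr0.
have [s1 s2] := bary_combine x (tet_nondegenerate mesh K).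
rewrite sum4 // in s1; rewrite sum4 ?bd ?bd' ?scale0r // in s2.
exists a, a', (bary (vert K) a' x); split; first by rewrite (bary_le1 mesh) // andbT; move/(tetP mesh): Kx.
rewrite -{1}s2 scalerBr addrCA; congr (_ + _).
by rewrite -{2}[vert K a]scale1r -scalerBl -s1 addrAC subrr add0r.
Qed.

Lemma vertex_roots K1 K2 : exists s : seq R, forall K j t, K \in [:: K1; K2] -> vertex_poly K j != 0 ->
  root (vertex_poly K j) t -> t \in s.
Proof.
have /fin_all_exists[S SP] (i : 'I_(ntet D) * 'I_4) : exists s : seq R, vertex_poly i.1 i.2 != 0 ->
    forall t, root (vertex_poly i.1 i.2) t -> t \in s.
  have [->|p0] := eqVneq (vertex_poly i.1 i.2) 0; first by exists [::].
  by have [s sP] := poly_finite_roots p0; exists s.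
exists (flatten [seq S i | i <- enum {: 'I_(ntet D) * 'I_4}]) => K j t _ p0 rt.
by apply/flatten_mapP; exists (K, j); [rewrite mem_enum|exact: (SP (K, j))].
Qed.

(* [B] consists of the images of the edges at the times at which a vertex value
   vanishes without vanishing identically. *)
Lemma exceptional_null K1 K2 : cut K1 -> cut K2 -> exists2 B : set 'rV[R]_(3 + 1), hausdorff_null 2 B &
  forall K z, K \in [:: K1; K2] -> prism n K z -> ~ B (ThetaK K z) -> good_at ks kq n K (xpart z) (tpart z).
Proof.
move=> c1 c2; have [s sP] := vertex_roots K1 K2.
have eta_1 : eta <= 1 by apply: (le_trans eta1); rewrite invf_le1 // ler1n.
pose tet_of (b : bool) := if b then K1 else K2.
(* Roots outside the slab are replaced by its left end, so that [Theta_id] applies to every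
   curve. *)
pose time (i : 'I_(size s)) : R := if asbool (slab n (nth 0 s i)) then nth 0 s i else tnode D n.
have slab_time i : slab n (time i).
  rewrite /time; case: asboolP => // _; rewrite /slab /= in_itv /= lexx /=.
  exact/ltW/(tg_incr (ds_time ds)).
pose edge K (a a' : 'I_4) (r : R) := vert K a + r *: (vert K a' - vert K a).
pose f (i : bool * ('I_4 * 'I_4) * 'I_(size s)) (r : R) :=
  ThetaK (tet_of i.1.1) (st (edge (tet_of i.1.1) i.1.2.1 i.1.2.2 r) (time i.2)).
have cut_of b : cut (tet_of b) by case: b.
have edge_tet K a a' r : 0 <= r <= 1 -> tet K (edge K a a' r).
  by move=> rI; apply: (tet_convex mesh rI); exact: vert_tet mesh _ _.
exists [set y | exists i r, 0 <= r <= 1 /\ y = f i r].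
  (* The deformation has Lipschitz constant 1 + eta <= 2 in space at a fixed time, and an edge is at
     most [mesh_size D] long. *)
  apply: (@hausdorff_null_curves _ _ _ f (2 * mesh_size D)) => -[[b [a a']] i] r r' rI rI' /=.
  rewrite /f /=; set K := tet_of b; set x := edge K a a' r; set x' := edge K a a' r'.
  have Kx : tet K x := edge_tet K a a' r rI; have Kx' : tet K x' := edge_tet K a a' r' rI'.
  have xx : enorm (x - x') <= `|r - r'| * mesh_size D.
    rewrite /x /x' /edge opprD addrACA subrr add0r -scalerBl enormZ ler_wpM2l //.
    apply: le_trans (diam_le_mesh K).
    exact: (tet_diam mesh (vert_tet mesh _ _) (vert_tet mesh _ _)).
  have h := Theta_id (cut_of b) Kx' (slab_time i) (tet_diam mesh Kx Kx').
  have -> : ThetaK K (st x (time i)) - ThetaK K (st x' (time i)) =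
      st (xpart (ThetaK K (st x (time i))) - xpart (ThetaK K (st x' (time i)))) 0.
    by rewrite /Defs.ThetaK !tpart_st !xpart_st -stB subrr.
  rewrite enorm_st0.
  move: (xpart _ - xpart _) h => X h; rewrite -[X](subrK (x - x')).
  apply: (le_trans (enormD _ _)); apply: (@le_trans _ _ (2 * enorm (x - x'))).
    rewrite mulr_natl mulr2n lerD2r; apply: (le_trans h).
    by rewrite -[leRHS]mul1r ler_wpM2r // enorm_ge0.
  by rewrite -mulrA ler_wpM2l // mulrC.
move=> K z KK Kz nB d d' dd' bd bd' j rt; apply/eqP/negPn/negP => p0; apply: nB.
have [a [a' [r [rI xE]]]] := edge_point Kz.1 dd' bd bd'.
have si : (index (tpart z) s < size s)%N by rewrite index_mem; exact: sP KK p0 rt.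
have timeE : time (Ordinal si) = tpart z.
  rewrite /time /= nth_index -?index_mem //; case: asboolP => // H; case: H; exact: Kz.2.
have [b bE] : exists b, tet_of b = K.
  by move: KK; rewrite !inE => /orP[/eqP ->|/eqP ->]; [exists true|exists false].
exists (b, (a, a'), Ordinal si), r; split=> //.
by rewrite /f /= timeE bE /edge -xE st_parts.
Qed.

Lemma conormal_jump_at K1 K2 F y z nu1 nu2 : interior_face ks kq n K1 K2 F ->
  c * (mesh_size D ^+ ks + time_step D ^+ kq) <= 2^-1 ->
  prism n K1 z -> prism n K2 z -> phihatK ks kq n K1 z = 0 -> y = ThetaK K1 z ->
  good_at ks kq n K1 (xpart z) (tpart z) -> good_at ks kq n K2 (xpart z) (tpart z) ->
  outer_conormal (piece ks kq n K1) y nu1 -> outer_conormal (piece ks kq n K2) y nu2 ->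
  enorm (nu1 + nu2) <= 2 * (c * (mesh_size D ^+ ks + time_step D ^+ kq)) /\
  enorm ((nu1 + nu2) *m PSe P y) <= 4 * (c * (mesh_size D ^+ ks + time_step D ^+ kq)) ^+ 2.
Proof.
move=> [c1 c2 neq _] small K1z K2z f1 yE good1 good2.
have K12 : K1 != K2 by apply/eqP => e; apply: neq; rewrite e.
have T1 := Theta_prism ks_ge1 ds c1 K1z; have T2 := Theta_prism ks_ge1 ds c2 K2z.
have f2 : phihatK ks kq n K2 z = 0 by rewrite -(phihatK_prism ds K1z K2z).
have yE2 : y = ThetaK K2 z by rewrite yE -T1 T2.
have lt1 := eta_lt1 eta1.
have hat0 K x t : cut K -> tet K x -> slab n t -> hat_grad K t != 0.
  by move=> cK Kx It; exact: (hat_grad_slab eta1 grad_close cK Kx It).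
have neq0 : zero_set K1 <> zero_set K2.
  move=> e; apply: neq; rewrite (pieceE ks_ge1 ds c1) (pieceE ks_ge1 ds c2) -e.
  apply/seteqP; split=> _ [w Aw <-]; exists w => //.
    by rewrite -(Theta_prism ks_ge1 ds c1 Aw.1) (Theta_prism ks_ge1 ds c2) // ; move: Aw; rewrite e => -[].
  by rewrite -(Theta_prism ks_ge1 ds c1 Aw.1) (Theta_prism ks_ge1 ds c2) // ; move: Aw; rewrite e => -[].
move=> N1 N2; rewrite {1}yE in N1; rewrite {1}yE2 in N2.
have [u1 m1 o1 [k1 k10 P1] H1] := conormal_chart ks_ge1 ds lt1 Theta_id hat0 c1 (conj K1z f1) N1.
have [u2 m2 o2 [k2 k20 P2] H2] := conormal_chart ks_ge1 ds lt1 Theta_id hat0 c2 (conj K2z f2) N2.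
have dn K : cut K -> prism n K z -> enorm (nSe P y - nShK ks kq n K z) <= c * (mesh_size D ^+ ks + time_step D ^+ kq).
  move=> cK Kz; rewrite yE -T1; apply: (ds_normal ds cK Kz); by exists K1.
have d1 := dn K1 c1 K1z; have d2 := dn K2 c2 K2z.
(* A normalized vector has length 1 or is zero; zero is not within 1/2 of a unit vector. *)
have uns : enorm (nSe P y) = 1.
  apply: normalize_normalized; apply: contraTneq (le_trans d1 small) => e.
  by rewrite /nSe /nS e sub0r enormN m1 -ltNge invf_lt1 // ltr1n.
have [t1 [t2 [k [q [w1 [w2 [E1 E2 [E3 E4 E5] [E6 E7 E8 E9] E10]]]]]]] :
    edge_frame (nShK ks kq n K1 z) (nShK ks kq n K2 z) nu1 nu2.
  move: K1z K2z f1 f2 good1 good2 H1 H2 o1 o2 P1 P2; rewrite -(st_parts z) !xpart_st !tpart_st.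
  move=> /prism_st[K1x It] /prism_st[K2x _] f1 f2 good1 good2 H1 H2 o1 o2 P1 P2.
  exact: (edge_frame_exists ks_ge1 cont ds eta1 grad_close Theta_id c1 c2 K12 K1x K2x It f1 neq0 H1 H2 u1 u2 o1 o2
    k10 k20 P1 P2 good1 good2).
exact: (conormal_jump m1 m2 u1 u2 uns o1 o2 E1 E2 E3 E4 E5 E6 E7 E8 E9 E10 d1 d2 small).
Qed.

End ExceptionalPoints.

(** * Assembly of the two estimates *)

Lemma ae_on_off_null (R : realType) (n : nat) (F : set 'rV[R]_n) (B : set 'rV[R]_n) (Q : 'rV[R]_n -> Prop) d :
  hausdorff_null d B -> (forall y, F y -> ~ B y -> Q y) -> ae_on d F Q.
Proof.
by move=> B0 H; apply: hausdorff_null_sub B0 => y [Fy nQ]; apply: contrapT => nB; apply: nQ; exact: H.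
Qed.

(** Here d = c (a + b). The inequality (a + b)^2 <= 2 (a^2 + b^2) turns 4 c^2 into 8 c^2, and the
    sum of both constants serves both bounds. *)
Lemma rate_constants (R : realType) (c a b : R) : 0 < c -> 0 <= a -> 0 <= b ->
  2 * (c * (a + b)) <= (2 * c + 8 * c ^+ 2) * (a + b) /\
  4 * (c * (a + b)) ^+ 2 <= (2 * c + 8 * c ^+ 2) * (a ^+ 2 + b ^+ 2).
Proof.
move=> c0 a0 b0; have cc : 0 <= c ^+ 2 := sqr_ge0 c; split.
  by rewrite mulrA ler_wpM2r ?addr_ge0 // lerDl mulr_ge0.
have sq : (a + b) ^+ 2 <= 2 * (a ^+ 2 + b ^+ 2).
  by rewrite -subr_ge0 (_ : _ - _ = (a - b) ^+ 2) ?sqr_ge0 //; ring.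
rewrite exprMn; apply: (@le_trans _ _ (8 * c ^+ 2 * (a ^+ 2 + b ^+ 2))).
  rewrite (_ : 8 * c ^+ 2 * _ = 4 * (c ^+ 2 * (2 * (a ^+ 2 + b ^+ 2)))); last by ring.
  by rewrite ler_wpM2l // ler_wpM2l.
by rewrite ler_wpM2r ?addr_ge0 ?sqr_ge0 // lerDr mulr_ge0 // ltW.
Qed.

Theorem lemma5p6 (R : realType) (P : problem R) (ks kq : nat) (c : R)
    (ks_ge1 : (1 <= ks)%N) (kq_ge1 : (1 <= kq)%N)
    (cont : continuous_setting P ks kq c) :
  exists C h0 : R, [/\ 0 < C, 0 < h0 &
    forall D : discretization R, discrete_setting ks kq D P c ->
      mesh_size D <= h0 -> time_step D <= h0 ->
    forall (n : 'I_(nslab D)) (K1 K2 : 'I_(ntet D)) (F : set 'rV[R]_(3 + 1)),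
      interior_face ks kq n K1 K2 F ->
      ae_on 2 F (fun y => forall nu1 nu2 : 'rV[R]_(3 + 1),
        outer_conormal (piece ks kq n K1) y nu1 ->
        outer_conormal (piece ks kq n K2) y nu2 ->
        enorm (nu1 + nu2) <= C * (mesh_size D ^+ ks + time_step D ^+ kq)) /\
      ae_on 2 F (fun y => forall nu1 nu2 : 'rV[R]_(3 + 1),
        outer_conormal (piece ks kq n K1) y nu1 ->
        outer_conormal (piece ks kq n K2) y nu2 ->
        enorm ((nu1 + nu2) *m PSe P y)
          <= C * (mesh_size D ^+ (2 * ks) + time_step D ^+ (2 * kq)))].
Proof.
have c0 := cs_const cont.
have eta0 : 0 < 100^-1 :> R by rewrite invr_gt0 ltr0n.
have [h0 h00 H] := mesh_estimates ks_ge1 kq_ge1 cont eta0.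
exists (2 * c + 8 * c ^+ 2), h0; split=> //.
  by rewrite addr_gt0 // mulr_gt0 // exprn_gt0.
move=> D ds mh th n K1 K2 F face; have [small est] := H D ds mh th.
have grad_close K x t : Defs.cut ks kq n K -> tet K x -> slab n t ->
    0 < enorm (gradx (phi P) (st x t)) /\
    enorm (hat_grad ks kq n K t - gradx (phi P) (st x t)) <= 100^-1 * enorm (gradx (phi P) (st x t)).
  by move=> cK Kx It; have [] := est n K x t cK Kx It.
have Theta_id K x (y : 'rV[R]_3) t : Defs.cut ks kq n K -> tet K x -> slab n t -> enorm (y - x) <= diam (tet K) ->
    enorm (xpart (@ThetaK R ks kq D n K (st y t)) - xpart (@ThetaK R ks kq D n K (st x t)) - (y - x))
      <= 100^-1 * enorm (y - x).
  by move=> cK Kx It; have [_ _] := est n K x t cK Kx It; exact.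
have [cut1 cut2 _ _] := face.
have [B Bnull BP] := exceptional_null ds (lexx _) Theta_id cut1 cut2.
have bound y nu1 nu2 : F y -> ~ B y ->
    outer_conormal (piece ks kq n K1) y nu1 -> outer_conormal (piece ks kq n K2) y nu2 ->
    enorm (nu1 + nu2) <= 2 * (c * (mesh_size D ^+ ks + time_step D ^+ kq)) /\
    enorm ((nu1 + nu2) *m PSe P y) <= 4 * (c * (mesh_size D ^+ ks + time_step D ^+ kq)) ^+ 2.
  move=> Fy nB; have [z [K1z K2z fz yE]] := interior_faceP ks_ge1 ds face Fy.
  have nB1 : ~ B (@ThetaK R ks kq D n K1 z) by rewrite -yE.
  have nB2 : ~ B (@ThetaK R ks kq D n K2 z).
    by rewrite -(Theta_prism ks_ge1 ds cut2 K2z) (Theta_prism ks_ge1 ds cut1 K1z).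
  apply: (conormal_jump_at ks_ge1 cont ds (lexx _) grad_close Theta_id face small K1z K2z fz yE).
    by apply: (BP K1 z _ K1z nB1); rewrite !inE eqxx.
  by apply: (BP K2 z _ K2z nB2); rewrite !inE eqxx orbT.
have [b1 b2] := rate_constants c0 (exprn_ge0 ks (mesh_size_ge0 D)) (exprn_ge0 kq (time_step_ge0 D)).
rewrite -!exprM !(mulnC _ 2) in b2.
split; apply: (ae_on_off_null Bnull) => y Fy nB nu1 nu2 N1 N2; have [h1 h2] := bound y nu1 nu2 Fy nB N1 N2.
  exact: le_trans h1 b1.
exact: le_trans h2 b2.
Qed.
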